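(* Let $\psi_n^{\mathrm{ssep}}$ be the scaled non-coincident cumulants of the stationary classical symmetric simple exclusion process with boundary densities $n_a=0$ (left) and $n_b=1$ (right). For a bounded measurable function $a:[0,1]\to\mathbb{R}$ let $$\psi_n^{\mathrm{ssep}}[a]:=\int_{[0,1]^n}\psi^{\mathrm{ssep}}_n(x_1,\dots,x_n)\prod_{k=1}^n a(x_k)\,dx_k,\qquad \mathfrak{F}_0[a]:=\sum_{n\ge1}\frac{1}{n!}\psi_n^{\mathrm{ssep}}[a].$$ Then $$\mathfrak{F}_0[a]=-\sum_{n\ge1}\frac{(-1)^n}{n}R_n(\mathbb{I}_{[a]}),$$ where $\mathbb{I}_{[a]}:=\int_0^1 dx\,a(x)\,\mathbb{I}_x$, i.e. $\mathbb{I}_{[a]}(x)=\int_x^1a(y)\,dy$, and $R_n(\mathbb{I}_{[a]})$ is the $n$-th free cumulant of $\mathbb{I}_{[a]}$ with respect to Lebesgue measure on $[0,1]$. Equivalently, for every $n\ge1$, $$\psi_n^{\mathrm{ssep}}[a]=(-1)^{n-1}(n-1)!\,R_n(\mathbb{I}_{[a]}).$$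
   Context: Classical SSEP: the continuous-time Markov chain on $\{0,1\}^N$ with configurations $(\tau_1,\dots,\tau_N)$ in which, for each pair of adjacent sites $i,i+1$, a particle jumps to the neighbouring site at rate $1$ if that site is empty (moves $[01]\to[10]$ and $[10]\to[01]$ at equal rates). At each of the boundary sites $1$ and $N$, particles are injected (if the site is empty) and extracted (if it is occupied) at fixed rates. The boundary density is injection rate divided by the sum of injection and extraction rates. The convention $n_a=0$, $n_b=1$ means: at site $1$ only extraction (positive rate), at site $N$ only injection (positive rate). $\mathbb{E}_{\mathrm{ssep}}$ is the expectation in the unique invariant measure, and $\mathbb{E}_{\mathrm{ssep}}[\cdots]^c$ denotes the joint cumulant. Scaled non-coincident cumulants: for pairwise distinct $x_1,\dots,x_n\in[0,1]$, $$\psi^{\mathrm{ssep}}_n(x_1,\dots,x_n):=\lim_{N\to\infty}N^{n-1}\,\mathbb{E}_{\mathrm{ssep}}\big[\tau_{[x_1N]}\cdots\tau_{[x_nN]}\big]^c .$$ This limit is known to exist and to be piecewise polynomial. $\mathbb{I}_x=1_{[0,x]}$ is the indicator function of $[0,x]$, viewed as a random variable on $[0,1]$ with Lebesgue measure $\mu_L$ as probability measure. Free (non-crossing) cumulants of a bounded random variable $X$ on $([0,1],\mu_L)$: the numbers $R_n(X)$, $n\ge1$, determined recursively by $\int_0^1X(x)^n\,dx=\sum_{\pi\in NC(n)}\prod_{p\in\pi}R_{|p|}(X)$ for all $n\ge1$, where $NC(n)$ is the set of non-crossing partitions of $\{1,\dots,n\}$. $\mathfrak{F}_0[a]$ is a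 generating series: the first identity is understood termwise, i.e. as an identity of power series in $v$ after replacing $a$ by $va$. *)

(* Defs.v *)
From HB Require Import structures.
From mathcomp Require Import all_boot all_order all_algebra.

Set Implicit Arguments.
Unset Strict Implicit.
Unset Printing Implicit Defensive.

Import Order.TTheory GRing.Theory Num.Theory.

Local Open Scope ring_scope.

Section Cumulants.
Variable R : comPzRingType.

(* Joint cumulant of X_0, ..., X_(n-1) for the expectation functional [E]:
   the sum over set partitions pi of (-1)^(|pi|-1) (|pi|-1)! prod_B E[X_B]. *)
Definition joint_cumulant (T : Type) (E : (T -> R) -> R) (n : nat)
    (X : 'I_n -> T -> R) : R :=
  \sum_(P : {set {set 'I_n}} | partition P [set: 'I_n])
    (-1) ^+ #|P|.-1 * (#|P|.-1)`!%:R *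
    \prod_(B in P) E (fun w => \prod_(i in B) X i w).

Definition noncrossing (n : nat) (P : {set {set 'I_n}}) : bool :=
  [forall B in P, forall C in P, (B != C) ==>
    ~~ [exists i in B, exists j in C, exists k in B, exists l in C,
          [&& i < j, j < k & k < l]%N]].

Definition NC (n : nat) : {set {set {set 'I_n}}} :=
  [set P | partition P [set: 'I_n] && noncrossing P].

(* [:: 0; R_1; ...; R_n], where R_n is obtained from the moment m n by
   isolating the one-block partition in the moment-cumulant formula. *)
Fixpoint free_cumulant_seq (m : nat -> R) (n : nat) : seq R :=
  if n is k.+1 then
    let s := free_cumulant_seq m k in
    rcons s (m n - \sum_(P in NC n | P != [set [set: 'I_n]])
                     \prod_(B in P) s`_#|B|)
  else [:: 0].

Definition free_cumulant_of_moments (m : nat -> R) (n : nat) : R :=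
  (free_cumulant_seq m n)`_n.

Lemma size_free_cumulant_seq m n : size (free_cumulant_seq m n) = n.+1.
Proof. by elim: n => //= n IH; rewrite size_rcons IH. Qed.

Lemma nth_free_cumulant_seq m n k : (k <= n)%N ->
  (free_cumulant_seq m n)`_k = free_cumulant_of_moments m k.
Proof.
elim: n => [|n IH]; first by rewrite leqn0 => /eqP ->.
rewrite leq_eqVlt => /orP[/eqP -> //|lt_kn].
by rewrite /= nth_rcons size_free_cumulant_seq lt_kn IH.
Qed.

Lemma NC_one_block n : [set [set: 'I_n.+1]] \in NC n.+1.
Proof.
rewrite inE; apply/andP; split.
  apply/and3P; split; first by rewrite /cover big_set1.
  - apply/trivIsetP => A B; rewrite !inE => /eqP -> /eqP ->.
    by rewrite eqxx.
  - by rewrite inE eq_sym -card_gt0 cardsT card_ord.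
apply/forall_inP => B; rewrite inE => /eqP ->.
by apply/forall_inP => C; rewrite inE => /eqP ->; rewrite eqxx.
Qed.

Lemma NC_small_block n (P : {set {set 'I_n.+1}}) (B : {set 'I_n.+1}) :
  P \in NC n.+1 -> P != [set [set: 'I_n.+1]] -> B \in P ->
  (0 < #|B| <= n)%N.
Proof.
rewrite inE => /andP[/and3P[/eqP cov tI n0] _] neq BP.
apply/andP; split.
  by rewrite card_gt0; apply: contraNneq n0 => <-.
rewrite -ltnS ltn_neqAle -[X in (_ <= X)%N](card_ord n.+1) max_card andbT.
apply: contraNneq neq => cB.
have BT : B = [set: 'I_n.+1].
  by apply/eqP; rewrite eqEcard subsetT cardsT card_ord cB leqnn.
apply/eqP/setP => C; rewrite inE; apply/idP/eqP => [CP|->]; last by rewrite -BT.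
apply/eqP; case: (eqVneq C B) => [->|CB]; first by rewrite BT.
have := trivIsetP tI _ _ CP BP CB; rewrite BT -setI_eq0 setIT => /eqP C0.
by move: n0; rewrite -C0 CP.
Qed.

Lemma free_cumulantE m n : (0 < n)%N ->
  m n = \sum_(P in NC n) \prod_(B in P) free_cumulant_of_moments m #|B|.
Proof.
case: n => // n _; rewrite (bigD1 _ (NC_one_block n)) big_set1 cardsT card_ord.
rewrite /free_cumulant_of_moments /= nth_rcons size_free_cumulant_seq ltnn eqxx.
rewrite [X in _ = _ - X + _](eq_bigr (fun P : {set {set 'I_n.+1}} =>
    \prod_(B in P) free_cumulant_of_moments m #|B|)); first by rewrite subrK.
move=> P /andP[PNC neq]; apply: eq_bigr => B BP.
by have /andP[_ ?] := NC_small_block PNC neq BP; rewrite nth_free_cumulant_seq.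
Qed.

Lemma free_cumulant_unique m (kappa : nat -> R) :
  (forall n, (0 < n)%N -> m n = \sum_(P in NC n) \prod_(B in P) kappa #|B|) ->
  forall n, (0 < n)%N -> kappa n = free_cumulant_of_moments m n.
Proof.
move=> mE n; elim/ltn_ind: n => -[//|n] IH _.
have := mE n.+1 isT; rewrite {1}(@free_cumulantE m n.+1)//.
rewrite !(bigD1 _ (NC_one_block n)) /= !big_set1 cardsT card_ord.
rewrite [X in _ + X = _](eq_bigr (fun P : {set {set 'I_n.+1}} =>
    \prod_(B in P) kappa #|B|)); first by move/addIr.
move=> P /andP[PNC neq]; apply: eq_bigr => B BP.
by have /andP[? ?] := NC_small_block PNC neq BP; rewrite IH.
Qed.

End Cumulants.

From mathcomp Require Import all_classical all_reals all_analysis.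
Import numFieldNormedType.Exports.

Local Open Scope classical_set_scope.

Section SSEP.
Variable R : realType.

(* Site k (1 <= k <= N) of the chain is the ordinal of value k.-1. *)
Definition config (N : nat) : finType := {ffun 'I_N -> bool}.

Definition set_site N (t : config N) (i : 'I_N) (b : bool) : config N :=
  [ffun k => if k == i then b else t k].

Definition adjacent N (i j : 'I_N) : bool :=
  (i.+1 == j :> nat) || (j.+1 == i :> nat).

Record boundary_rates := BoundaryRates { injection : R; extraction : R }.

Definition admissible_rates (b : boundary_rates) : Prop :=
  [/\ 0 <= injection b, 0 <= extraction b & 0 < injection b + extraction b].

Definition boundary_density (b : boundary_rates) : R :=
  injection b / (injection b + extraction b).

Definition boundary_rate N (b : boundary_rates) (i : 'I_N)
    (t t' : config N) : R :=
  if t' == set_site t i (~~ t i) then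
    (if t i then extraction b else injection b)
  else 0.

(* Rate of the transition t -> t', for t != t'. *)
Definition ssep_rate N (bl br : boundary_rates) (t t' : config N) : R :=
  (\sum_(i : 'I_N) \sum_(j : 'I_N | adjacent i j)
     [&& t i, ~~ t j & t' == set_site (set_site t i false) j true]%:R)
  + (\sum_(i : 'I_N | i == 0 :> nat) boundary_rate bl i t t')
  + (\sum_(i : 'I_N | i.+1 == N) boundary_rate br i t t').

Definition ssep_generator N (bl br : boundary_rates) (t t' : config N) : R :=
  if t == t' then - \sum_(s | s != t) ssep_rate bl br t s
  else ssep_rate bl br t t'.

Definition ssep_invariant N (bl br : boundary_rates)
    (P : config N -> R) : Prop :=
  [/\ forall t, 0 <= P t,
      \sum_t P t = 1 &
      forall t', \sum_t P t * ssep_generator bl br t t' = 0].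

Definition expectation_of N (P : config N -> R) (f : config N -> R) : R :=
  \sum_t P t * f t.

(* Occupation tau_k of the site k in 1..N, and 0 for other k (the integer part
   [x N] is not a site when x N < 1). *)
Definition occupation N (k : nat) (t : config N) : R :=
  \sum_(i : 'I_N | i.+1 == k) (t i)%:R.

(* psi_n for the stationary expectations given by the P N. It is defined at
   pairwise distinct points only; the value 0 at coinciding points is a
   convention on a Lebesgue-null set. *)
Definition psi_ssep (P : forall N, config N -> R) (n : nat)
    (x : n.-tuple R) : R :=
  if uniq x then
    limn (fun N : nat => N%:R ^+ n.-1 *
      joint_cumulant (expectation_of (P N))
        (fun i : 'I_n => @occupation N (Num.truncn (tnth x i * N%:R))))
  else 0.

End SSEP.

Section LebesguePower.
Variable R : realType.
Local Notation TR := (measurableTypeR R).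

Definition cons_pair n (p : TR * n.-tuple TR) : n.+1.-tuple TR :=
  [tuple of p.1 :: p.2].

Lemma measurable_cons_pair n : measurable_fun setT (@cons_pair n).
Proof. exact: measurable_cons measurable_fst measurable_snd. Qed.

HB.instance Definition _ n := isMeasurableFun.Build _ _ _ _ (@cons_pair n)
  (@measurable_cons_pair n).

Section step.
Variables (n : nat) (mu : {sigma_finite_measure set (n.-tuple TR) -> \bar R}).

Definition lebesgue_cons : set (n.+1.-tuple TR) -> \bar R :=
  pushforward (@lebesgue_measure R \x mu)%E (@cons_pair n).

Let lebesgue_cons0 : lebesgue_cons set0 = 0%E.
Proof. exact: measure0. Qed.

Let lebesgue_cons_ge0 A : (0 <= lebesgue_cons A)%E.
Proof. exact: measure_ge0. Qed.

Let lebesgue_cons_sigma_additive : semi_sigma_additive lebesgue_cons.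
Proof. exact: measure_semi_sigma_additive. Qed.

HB.instance Definition _ := isMeasure.Build _ _ _ lebesgue_cons
  lebesgue_cons0 lebesgue_cons_ge0 lebesgue_cons_sigma_additive.

Let lebesgue_cons_sigma_finite : sigma_finite setT lebesgue_cons.
Proof.
have /sigma_finiteP[F [TF ndF Foo]] := sigma_finiteT (@lebesgue_measure R).
have /sigma_finiteP[G [TG ndG Goo]] := sigma_finiteT mu.
pose unc (t : n.+1.-tuple TR) : TR * n.-tuple TR :=
  (thead t, [tuple of behead t]).
have munc : measurable_fun setT unc.
  apply: measurable_fun_pair; last exact: measurable_behead.
  exact: measurable_tnth.
have uncK p : unc (cons_pair p) = p.
  by case: p => x t; congr (_, _); apply: val_inj.
exists (fun k => unc @^-1` (F k `*` G k)).
  rewrite -preimage_bigcup -[LHS](preimage_setT unc); congr (_ @^-1` _).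
  rewrite -setXTT TF TG predeqE => -[x y]; split.
    move=> [/= [p _ Fpx] [k _ Gky]]; exists (maxn p k) => //; split.
    - by move: x Fpx; exact/subsetPset/ndF/leq_maxl.
    - by move: y Gky; exact/subsetPset/ndG/leq_maxr.
  by move=> [p _ []/= ? ?]; split; exists p.
move=> k; have [mFk Fk] := Foo k; have [mGk Gk] := Goo k.
split.
  rewrite -[X in measurable X]setTI; apply: munc => //; exact: measurableX.
rewrite /lebesgue_cons /pushforward (_ : _ @^-1` _ = F k `*` G k); last first.
  rewrite -comp_preimage (_ : unc \o _ = id)//.
  by apply/funext => p; exact: uncK.
by rewrite product_measure1E// lte_mul_pinfty// ge0_fin_numE.
Qed.

HB.instance Definition _ := Measure_isSigmaFinite.Build _ _ _ lebesgue_cons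
  lebesgue_cons_sigma_finite.

End step.

(* The n-dimensional Lebesgue measure: the n-fold product of [lebesgue_measure],
   transported along (x, t) |-> x :: t. *)
Fixpoint lebesgue_tuple n : {sigma_finite_measure set (n.-tuple TR) -> \bar R} :=
  if n is k.+1 then lebesgue_cons (lebesgue_tuple k)
  else @dirac _ (0.-tuple TR) [tuple] R.

End LebesguePower.

Section Functionals.
Variable R : realType.

Definition unit_cube (n : nat) : set (n.-tuple (measurableTypeR R)) :=
  [set x | forall i : 'I_n, 0 <= tnth x i <= 1].
Arguments unit_cube n : clear implicits.

Definition psi_functional (P : forall N, config N -> R) (n : nat)
    (a : R -> R) : R :=
  \int[lebesgue_tuple R n]_(x in unit_cube n)
    (psi_ssep P x * \prod_(k < n) a (tnth x k)).

Definition indicator_average (a : R -> R) (x : R) : R :=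
  \int[lebesgue_measure]_(y in `[0, 1]) (a y * \1_`[0, y] x).

Lemma indicator_averageE (a : R -> R) (x : R) : 0 <= x <= 1 ->
  indicator_average a x = \int[lebesgue_measure]_(y in `[x, 1]) a y.
Proof.
move=> /andP[x0 x1]; rewrite /indicator_average Rintegral_mkcond.
rewrite [RHS]Rintegral_mkcond; apply: eq_Rintegral => y _.
rewrite !patchE indicE !mem_setE !in_itv /= x0 /=.
have [xy|yx] := leP x y; first by rewrite (le_trans x0 xy) mulr1.
by rewrite mulr0 if_same.
Qed.

(* Free cumulants of X as a random variable on [0, 1] with Lebesgue measure. *)
Definition free_cumulant (X : R -> R) (n : nat) : R :=
  free_cumulant_of_moments
    (fun k => \int[lebesgue_measure]_(x in `[0, 1]) (X x ^+ k)) n.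

(* n-th term (n >= 1) of the generating series F_0[a]. *)
Definition F0_term (P : forall N, config N -> R) (a : R -> R) (n : nat) : R :=
  psi_functional P n a / n`!%:R.

(* n-th term (n >= 1) of - sum_n (-1)^n / n R_n(I_[a]). *)
Definition free_series_term (a : R -> R) (n : nat) : R :=
  - ((-1) ^+ n / n%:R * free_cumulant (indicator_average a) n).

(* With a replaced by v a, the series sum_(n >= 1) F a n is, term by term, the
   formal power series sum_(n >= 1) c n v^n in v. *)
Definition is_power_series (F : (R -> R) -> nat -> R) (a : R -> R)
    (c : nat -> R) : Prop :=
  forall (v : R) (n : nat), (0 < n)%N -> F (fun x => v * a x) n = c n * v ^+ n.

End Functionals.

(* Main.v *)
(** The stationary moments are explicit: with [a] and [b] the inverses of the
    extraction rate at site 1 and of the injection rate at site [N],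
    E[tau_(i_1) ... tau_(i_n)] = prod_k (i_k - k + a) / (N + a + b - k) for
    i_1 < ... < i_n. Cumulants are taken in the algebra of set functions with
    the subset convolution, whose Euler derivation D f (A) = |A| f(A) turns
    "E is the exponential of kappa" into D E = E * D kappa. The numerators have
    cumulants (-1)^(|B|-1) (|B|-1)! min_B (i + a - 1), and shifting the
    denominators by c multiplies E by a series u_c which behaves like u_1^c.
    After rescaling, eta := D psi satisfies u (1 - eta) = 1 and
      eta = sum_B (-1)^(|B|-1) |B|! (min_B x) xi^B u^|B|.
    Since min_B x is the integral over y in [0, 1] of prod_(i in B) 1_(y <= x_i),
    integrating against the test function replaces min_B x by the moment m_|B| of
    its average. The generating series H of the integrated eta thus satisfies
    U (1 - H) = 1 and 1 - H = M(- X U), with M the moment series. Opening the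
    block of the first element in the sum over noncrossing partitions gives
    M = K(X M) for the free cumulant series K, hence
    K(- X) = K(z M(z)) = M(z) = 1 - H at z = - X U. *)

Require Import Defs.
From HB Require Import structures.
From mathcomp Require Import all_boot all_order all_algebra perm.
From mathcomp Require Import ring lra zify reals.

Set Implicit Arguments.
Unset Strict Implicit.
Unset Printing Implicit Defensive.

Import Order.TTheory GRing.Theory Num.Theory.

Local Open Scope ring_scope.

(** * Subset convolution *)

(** The obstacle is cancellation: a cumulant of order n is an alternating sum of products of moments
    that do not decay, yet it must have size N^(1-n). No cancellation is ever tracked. The relations
    between the cumulants and the auxiliary series are exact at finite N and homogeneous, so powers
    of N can be distributed over them; only a factor N / (N + O(1)) remains, and convergence follows
    by induction on the size of the set. The shift c arises because the denominator of E(A) depends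
    on |A| alone: splitting a block B off the numerator leaves a numerator on A minus B over the
    denominator of index |A minus B| + |B|. Using D kappa in place of kappa keeps all relations
    polynomial, without logarithm or exponential. A second obstacle is that integration need not
    commute with the products in the limiting relations. Here it does, since the two factors of a
    subset convolution involve disjoint sets of coordinates. The same system is therefore solved
    pointwise, with minima as data, and once more with moments as data, and the two solutions are
    compared. *)

Section SetAlgebra.
Variables (R : comPzRingType) (I : finType).

(* Square-free polynomials in variables xi_i: the value at A is the coefficient of
   prod_(i in A) xi_i. *)
Definition setfun := {ffun {set I} -> R}.

HB.instance Definition _ := GRing.Zmodule.on setfun.

Implicit Types (f g h : setfun) (A B C : {set I}).

Definition setfun_one : setfun := [ffun A => (A == set0)%:R].
Definition setfun_mul f g : setfun :=
  [ffun A : {set I} => \sum_(B : {set I} | B \subset A) f B * g (A :\: B)].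

(** Over pairs of disjoint sets with union [A] the convolution is visibly symmetric; [setfun_mulC]
    is read off from this form. *)
Lemma setfun_mulE2 f g A : setfun_mul f g A =
  \sum_(B : {set I}) \sum_(C : {set I})
     f B * g C * ((B :|: C == A) && [disjoint B & C])%:R.
Proof.
rewrite ffunE big_mkcond; apply: eq_bigr => B _.
case: ifP => BA; last first.
  rewrite big1 // => C _; case: eqP => [BC|]; last by rewrite mulr0.
  by move: BA; rewrite -BC subsetUl.
have E C : (B :|: C == A) && [disjoint B & C] = (C == A :\: B).
  apply/andP/eqP => [[/eqP <- dBC]|->].
    by rewrite setDUl setDv set0U; apply/esym/setDidPl; rewrite disjoint_sym.
  rewrite setDE setUIr setUCr setIT (setUidPr BA); split=> //.
  by rewrite disjoints_subset setCI setCK subsetUr.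
rewrite (bigD1 (A :\: B)) //= E eqxx mulr1 big1 ?addr0 // => C CA.
by rewrite E (negbTE CA) mulr0.
Qed.

Lemma setfun_mulC : commutative setfun_mul.
Proof.
move=> f g; apply/ffunP => A; rewrite !setfun_mulE2 exchange_big.
apply: eq_bigr => B _; apply: eq_bigr => C _.
by rewrite setUC disjoint_sym (mulrC (f C)).
Qed.

Lemma setfun_mulA : associative setfun_mul.
Proof.
move=> f g h; apply/ffunP => A; rewrite [LHS]ffunE [RHS]ffunE.
rewrite [RHS](eq_bigr (fun S : {set I} => \sum_(B : {set I} | B \subset S)
   f B * g (S :\: B) * h (A :\: S))); last first.
  by move=> S _; rewrite ffunE mulr_suml.
rewrite (exchange_big_dep (fun B => B \subset A)) /=; last first.
  by move=> S B SA BS; apply: subset_trans SA.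
apply: eq_bigr => B BA; rewrite ffunE mulr_sumr.
rewrite [RHS](reindex_onto (fun C => B :|: C) (fun S => S :\: B)) /=; last first.
  by move=> S /andP[_ BS]; rewrite setDE setUIr setUCr setIT (setUidPr BS).
apply: eq_big => C.
  rewrite subUset BA subsetUl /= andbT setDUl setDv set0U.
  by rewrite subsetD; rewrite (sameP eqP setDidPl).
rewrite subsetD => /andP[CA dCB].
rewrite setDUl setDv set0U (setDidPl dCB) setDDl mulrA.
by congr (_ * h _); rewrite setDDl.
Qed.

Lemma setfun_mul1 : left_id setfun_one setfun_mul.
Proof.
move=> f; apply/ffunP => A; rewrite ffunE (bigD1 set0) ?sub0set //= !ffunE eqxx.
rewrite mul1r setD0 big1 ?addr0 // => B /andP[_ /negbTE B0].
by rewrite ffunE B0 mul0r.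
Qed.

Lemma setfun_mulDl : left_distributive setfun_mul +%R.
Proof.
move=> f g h; apply/ffunP => A; rewrite !ffunE -big_split /=.
by apply: eq_bigr => B _; rewrite ffunE mulrDl.
Qed.

HB.instance Definition _ := GRing.Zmodule_isComPzRing.Build setfun
  setfun_mulA setfun_mulC setfun_mul1 setfun_mulDl.

Lemma setfun_mulE f g A :
  (f * g) A = \sum_(B : {set I} | B \subset A) f B * g (A :\: B).
Proof. by rewrite ffunE. Qed.

Lemma setfun_1E A : (1 : setfun) A = (A == set0)%:R.
Proof. by rewrite ffunE. Qed.

Lemma setfun_mul0E f g : (f * g) set0 = f set0 * g set0.
Proof.
rewrite setfun_mulE (big_pred1 set0) ?setD0 // => B.
by rewrite subset0.
Qed.

Definition euler f : setfun := [ffun A : {set I} => #|A|%:R * f A].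

Lemma euler0 f : euler f set0 = 0.
Proof. by rewrite ffunE cards0 mul0r. Qed.

Lemma eulerM f g : euler (f * g) = euler f * g + f * euler g.
Proof.
apply/ffunP => A; rewrite [LHS]ffunE [RHS]ffunE !setfun_mulE mulr_sumr.
rewrite -big_split /=; apply: eq_bigr => B BA; rewrite !ffunE.
rewrite -(subnKC (subset_leq_card BA)) natrD mulrDl.
rewrite -cardsDS //.
by rewrite !mulrA; congr (_ + _ * _); rewrite mulrC.
Qed.

(** A degree filtration: by [vanishM], a set function without constant term is nilpotent, since no
    set has more than [#|I|] elements. *)
Definition vanish (k : nat) f := forall A, (#|A| < k)%N -> f A = 0.

Lemma vanishM k l f g : vanish k f -> vanish l g -> vanish (k + l) (f * g).
Proof.
move=> fk gl A Akl; rewrite setfun_mulE big1 // => B BA.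
have [Bk|kB] := ltnP #|B| k; first by rewrite fk ?mul0r.
rewrite gl ?mulr0 // cardsDS // ltn_subLR ?subset_leq_card //.
by apply: leq_trans Akl _; rewrite leq_add2r.
Qed.

(** Geometric series in the nilpotent element [1 - f], which stops at exponent [#|I|]. *)
Lemma setfun_inv f : f set0 = 1 -> exists g, f * g = 1.
Proof.
move=> f0; pose e := 1 - f.
have ve k : vanish k (e ^+ k).
  elim: k => [|k IH]; first by move=> A.
  rewrite exprS -add1n; apply: vanishM IH.
  move=> A; rewrite ltnS leqn0 cards_eq0 => /eqP ->.
  by rewrite !ffunE eqxx f0 subrr.
have e0 : e ^+ #|I|.+1 = 0.
  by apply/ffunP => A; rewrite ve ?ltnS ?max_card // ffunE.
exists (\sum_(i < #|I|.+1) e ^+ i).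
have -> : f = 1 - e by rewrite /e opprB addrC subrK.
have := subrX1 e #|I|.+1; rewrite e0 sub0r => E.
by rewrite -[X in X * _]opprB mulNr -E opprK.
Qed.

Lemma setfun_lreg f g h : f set0 = 1 -> f * g = f * h -> g = h.
Proof.
move=> /setfun_inv[k fk] E.
by rewrite -[g]mul1r -[h]mul1r -fk mulrAC E mulrAC.
Qed.

End SetAlgebra.

(** * Set partitions and cumulants *)

Section PartitionSums.
Variables (V : nmodType) (T : finType).
Implicit Types (A B C : {set T}) (P Q : {set {set T}}).

Lemma partition_setU1 P A C : C != set0 -> C \subset A ->
  partition P (A :\: C) -> partition (C |: P) A /\ C \notin P.
Proof.
move=> C0 CA pP; split; last first.
  apply/negP => /(partitionS pP); rewrite subsetD => /andP[_].
  by rewrite -setI_eq0 setIid; apply/negP.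
rewrite -[X in partition _ X](setID A C) (setIidPr CA).
by apply: partitionU1 => //; rewrite disjoints_subset subsetC setDE subsetIr.
Qed.

(** Both sides enumerate the partitions of [A] with one marked block [C]. *)
Lemma sum_partition_block A (F : {set T} -> {set {set T}} -> V) :
  \sum_(C : {set T} | (C \subset A) && (C != set0))
     \sum_(P : {set {set T}} | partition P (A :\: C)) F C P =
  \sum_(Q : {set {set T}} | partition Q A) \sum_(C in Q) F C (Q :\ C).
Proof.
rewrite [RHS](exchange_big_dep (fun C => (C \subset A) && (C != set0))) /=;
    last first.
  by move=> Q C pQ CQ; rewrite (partitionS pQ) ?(partition_neq0 pQ).
apply: eq_bigr => C /andP[CA C0].
rewrite [RHS](reindex_onto (fun P => C |: P) (fun Q => Q :\ C)) /=; last first.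
  by move=> Q /andP[_]; exact: setD1K.
apply: eq_big => P; last first.
  by move=> /(partition_setU1 C0 CA)[_ CP]; rewrite setU1K.
rewrite setU11 andbT; apply/idP/andP => [pP|[pP /eqP <-]].
  by have [-> CP] := partition_setU1 C0 CA pP; rewrite setU1K.
by apply: partitionD1; rewrite ?setU11.
Qed.

Lemma sum_partition_pblock A x (F : {set {set T}} -> V) : x \in A ->
  \sum_(Q : {set {set T}} | partition Q A) F Q =
  \sum_(B : {set T} | (B \subset A) && (x \in B))
     \sum_(P : {set {set T}} | partition P (A :\: B)) F (B |: P).
Proof.
(* Every block is marked, but only the marked block containing [x] survives; this reduces the claim
   to [sum_partition_block]. *)
move=> xA; transitivity (\sum_(Q : {set {set T}} | partition Q A)
    \sum_(B in Q) if x \in B then F (B |: Q :\ B) else 0).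
  apply: eq_bigr => Q pQ; have xc : x \in cover Q by rewrite (cover_partition pQ).
  rewrite (bigD1 (pblock Q x)) ?pblock_mem //= mem_pblock xc.
  rewrite setD1K ?pblock_mem // big1 ?addr0 // => B /andP[BQ neq].
  case: ifP => // xB; case/eqP: neq.
  by rewrite (def_pblock (partition_trivIset pQ) BQ xB).
rewrite -(sum_partition_block A (fun B P => if x \in B then F (B |: P) else 0)).
rewrite big_mkcond [RHS]big_mkcond; apply: eq_bigr => B _.
have [xB|xB] := boolP (x \in B); rewrite ?andbF ?andbT; last first.
  by case: ifP => // _; rewrite big1.
have [BA|//] := boolP (B \subset A).
by have [B0|//] := eqVneq B set0; rewrite B0 inE in xB.
Qed.

Lemma big_subset_card (F : nat -> V) A :
  \sum_(B : {set T} | B \subset A) F #|B| =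
  \sum_(k < #|A|.+1) F k *+ 'C(#|A|, k).
Proof.
rewrite (partition_big (fun B : {set T} => inord #|B| : 'I_#|A|.+1) predT) //=.
apply: eq_bigr => k _; rewrite -cards_draws -sumr_const.
apply: eq_big => B.
  rewrite inE; apply: andb_id2l => BA; apply/eqP/eqP => [<-|->].
    by rewrite inordK // ltnS subset_leq_card.
  by rewrite inord_val.
by move=> /andP[BA /eqP <-]; rewrite inordK // ltnS subset_leq_card.
Qed.

End PartitionSums.

Section Cumulant.
Variables (R : comPzRingType) (T : finType).
Implicit Types (A B S : {set T}) (P Q : {set {set T}}).

Definition cumulant (E : {set T} -> R) A : R :=
  \sum_(P : {set {set T}} | partition P A)
    (-1) ^+ #|P|.-1 * (#|P|.-1)`!%:R * \prod_(B in P) E B.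

(* The pairs (S, partition of S) with S a proper subset of A containing i
   correspond to the partitions of A with a marked block (the complement of S)
   not containing i. *)
Lemma moment_cumulant (E : {set T} -> R) A i : E set0 = 1 -> i \in A ->
  E A = \sum_(S : {set T} | (S \subset A) && (i \in S))
          cumulant E S * E (A :\: S).
Proof.
move=> E0 iA; rewrite (bigD1 A) ?subxx //= setDv E0 mulr1.
pose c k : R := (-1) ^+ k.-1 * (k.-1)`!%:R.
have -> : \sum_(S : {set T} | (S \subset A) && (i \in S) && (S != A))
     cumulant E S * E (A :\: S) =
   \sum_(C : {set T} | (C \subset A) && (C != set0))
     \sum_(P : {set {set T}} | partition P (A :\: C))
       (if i \in C then 0 else c #|P| * \prod_(B in P) E B * E C).
  rewrite (reindex_onto (fun C => A :\: C) (fun S => A :\: S)) /=; last first.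
    by move=> S /andP[/andP[SA _] _]; rewrite setDDr setDv set0U (setIidPr SA).
  rewrite [RHS](bigID (fun C : {set T} => i \in C)) /= [X in _ = X + _]big1.
    rewrite add0r; apply: eq_big => C; last first.
      move=> /andP[/andP[/andP[_]]]; rewrite inE iA andbT => iC _.
      rewrite setDDr setDv set0U => /eqP CA.
      by rewrite CA /cumulant mulr_suml; apply: eq_bigr => P _; rewrite (negbTE iC).
    rewrite subsetDl inE iA andbT /= setDDr setDv set0U (sameP eqP setIidPr).
    rewrite (sameP eqP setDidPl) -setI_eq0.
    have [CA|] := boolP (C \subset A); rewrite ?andbF ?andbT //=.
    by rewrite (setIidPr CA) andbC.
  by move=> C /andP[_ iC]; apply: big1 => P _; rewrite iC.
rewrite (sum_partition_block A (fun C P =>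
   if i \in C then 0 else c #|P| * \prod_(B in P) E B * E C)).
rewrite /cumulant -big_split /=.
have A0 : A != set0 by apply/set0Pn; exists i.
have pA : partition [set A] A.
  by rewrite /partition cover1 eqxx trivIset1 inE eq_sym.
rewrite (bigD1 [set A]) //= big_set1 cards1 expr0 !mul1r big_set1 iA addr0.
rewrite big1 ?addr0 // => Q /andP[pQ QA].
have ic : i \in cover Q by rewrite (cover_partition pQ).
have Bi := pblock_mem ic; have iB : i \in pblock Q i by rewrite mem_pblock.
set B := pblock Q i in Bi iB.
rewrite [X in _ + X](bigD1 B) //= iB add0r.
rewrite [X in _ + X](eq_bigr (fun=> c #|Q|.-1 * \prod_(C in Q) E C)); last first.
  move=> C /andP[CQ CB]; rewrite ifF; last first.
    by apply: contraNF CB => iC; rewrite /B (def_pblock (partition_trivIset pQ) CQ iC).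
  rewrite -mulrA (bigD1 C CQ) /= (cardsD1 C Q) CQ /=; congr (_ * _).
  by rewrite mulrC; congr (_ * _); apply: eq_bigl => D; rewrite !inE andbC.
rewrite [X in _ + X](eq_bigl (mem (Q :\ B))) ?sumr_const; last first.
  by move=> D; rewrite !inE andbC.
(* A partition with k + 1 > 1 blocks has its own weight (-1)^k k!, and each of its k blocks avoiding
   [i] contributes (-1)^(k-1) (k-1)! when marked; the total is zero. *)
rewrite -mulrnAl -mulrDl (_ : _ + _ = 0) ?mul0r //.
rewrite (cardsD1 B Q) Bi /= /c.
have : (0 < #|Q :\ B|)%N.
  rewrite card_gt0; apply: contraNneq QA => QB0.
  have QB : Q = [set B] by rewrite -(setD1K Bi) QB0 setU0.
  by rewrite QB -(cover_partition pQ) QB cover1.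
case: #|Q :\ B| => // k _; rewrite /= exprS factS natrM -mulr_natr.
by rewrite mulN1r mulNr mulrA mul1r (mulrAC _ k.+1%:R) mulr_natr addNr.
Qed.

End Cumulant.

(** Summing [moment_cumulant] over [i] in [A] counts each [S] exactly [#|S|] times, so the choice of
    a distinguished element disappears. *)
Lemma euler_cumulant (R : comPzRingType) (T : finType) (E : setfun R T) :
  E set0 = 1 -> euler E = euler [ffun A : {set T} => cumulant E A] * E.
Proof.
move=> E0; apply/ffunP => A; rewrite ffunE setfun_mulE.
rewrite mulrC mulr_natr -sumr_const.
rewrite (eq_bigr (fun i => \sum_(S : {set T} | (S \subset A) && (i \in S))
          cumulant E S * E (A :\: S))); last first.
  by move=> i iA; exact: moment_cumulant.
rewrite (exchange_big_dep (fun S : {set T} => S \subset A)) /=; last by move=> i S _ /andP[].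
apply: eq_bigr => S SA; rewrite !ffunE.
rewrite (eq_bigl (mem S)) ?sumr_const => [|i].
  by rewrite -mulrA mulr_natl.
by rewrite SA /=; apply: andb_idl => /(subsetP SA).
Qed.

Lemma sum_subset_setU1 (V : nmodType) (T : finType) (F : {set T} -> V)
    (B : {set T}) i : i \notin B ->
  \sum_(S : {set T} | S \subset i |: B) F S =
  \sum_(S : {set T} | S \subset B) (F S + F (i |: S)).
Proof.
move=> iB; rewrite big_split /= (bigID (fun S : {set T} => i \in S)) /= addrC.
congr (_ + _).
  apply: eq_bigl => S; apply/andP/idP => [[Si iS]|SB].
    by rewrite -(setU1K iB) subsetD1 Si.
  split; last by apply: contra iB; apply: subsetP.
  by apply: subset_trans SB (subsetUr _ _).
rewrite (reindex_onto (fun S => i |: S) (fun S => S :\ i)) /=; last first.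
  by move=> S /andP[_]; exact: setD1K.
apply: eq_bigl => S; rewrite setU11 andbT; apply/andP/idP => [[SB]|SB].
  by move=> /eqP <-; rewrite -(setU1K iB) setSD.
by rewrite setUS // setU1K //; apply: contra iB; apply: subsetP.
Qed.

(** * Cumulants of falling products *)

Section FallingProduct.
Variables (R : realFieldType) (T : finType) (y : T -> R) (m : {set T} -> R).
Hypothesis y_inj : injective y.
Hypothesis m1 : forall i, m [set i] = y i.
Hypothesis mU1 : forall (B : {set T}) i, B != set0 ->
  (forall j, j \in B -> y j < y i) -> m (i |: B) = m B.

Definition min_cumulant : setfun R T :=
  [ffun A : {set T} => (-1) ^+ #|A|.-1 * (#|A|.-1)`!%:R * m A].

Lemma set_argmax (A : {set T}) : A != set0 ->
  exists i, [/\ i \in A & forall j, j \in A :\ i -> y j < y i].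
Proof.
case/set0Pn => i0 i0A; case: (arg_maxP y i0A) => i iA ymax; exists i; split=> // j.
rewrite !inE => /andP[ji jA]; rewrite lt_neqAle; apply/andP; split; last exact: ymax.
by apply: contra ji => /eqP/y_inj ->.
Qed.

(* Both sides obey the same recursion when a point above all others is inserted. *)
Lemma euler_falling (G : setfun R T) : G set0 = 1 ->
  (forall (B : {set T}) i, i \notin B -> (forall j, j \in B -> y j < y i) ->
     G (i |: B) = (y i - #|B|%:R) * G B) ->
  euler G = euler min_cumulant * G.
Proof.
move=> G0 GU; apply/ffunP => A.
have [n] := ubnP #|A|; elim: n A => // n IH A; rewrite ltnS => An.
have [->|A0] := eqVneq A set0; first by rewrite setfun_mul0E !euler0 mul0r.
have [i [iA imax]] := set_argmax A0.
rewrite -(setD1K iA); set B := A :\ i in imax *.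
have iB : i \notin B by rewrite !inE eqxx.
have Bn : (#|B| < n)%N by move: An; rewrite (cardsD1 i A) iA.
rewrite setfun_mulE sum_subset_setU1 //.
(* For nonempty [S], inserting [i] multiplies [euler min_cumulant] by [- (#|S| + 1)], which cancels
   the dependence on [#|S|] of the factor [y i - #|B :\: S|]. Only [S = set0] leaves the extra term
   [y i * G B]. *)
rewrite (eq_bigr (fun S => (y i - #|B|%:R - 1) * (euler min_cumulant S * G (B :\: S))
   + (if S == set0 then y i * G B else 0))); last first.
  move=> S SB; have iS : i \notin S by apply: contra iB; apply: subsetP.
  have -> : (i |: B) :\: S = i |: (B :\: S).
    by rewrite setDUl; congr (_ :|: _); apply/setDidPl; rewrite disjoints1.
  have -> : (i |: B) :\: (i |: S) = B :\: S.
    by rewrite -setDDl setU1K.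
  rewrite GU; last 2 first.
  - by rewrite inE negb_and iB orbT.
  - by move=> j; rewrite inE => /andP[_]; exact: imax.
  rewrite cardsDS // natrB ?subset_leq_card // !ffunE cardsU1 iS /=.
  have [->|S0] := eqVneq S set0.
    by rewrite setU0 m1 cards0 setD0 expr0 mulr1n; ring.
  rewrite mU1 //; last by move=> j /(subsetP SB); exact: imax.
  move: S0; rewrite -card_gt0; case: #|S| => // k _ /=.
  rewrite factS exprS !natrM natrD [k.+1%:R]mulrSr; ring.
rewrite big_split /= -mulr_sumr -setfun_mulE -IH //.
rewrite -big_mkcondr /= (big_pred1 set0); last first.
  by move=> S; apply: andb_idl => /eqP ->; rewrite sub0set.
rewrite !ffunE cardsU1 iB GU // natrD /=; ring.
Qed.

End FallingProduct.

Definition setfun_single (R : comPzRingType) (T : finType) (B : {set T}) (v : R) :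
  setfun R T := [ffun A : {set T} => if A == B then v else 0].

Lemma setfun_singleM (R : comPzRingType) (T : finType) (B : {set T}) (v : R)
    (f : setfun R T) A :
  (setfun_single B v * f) A = if B \subset A then v * f (A :\: B) else 0.
Proof.
rewrite setfun_mulE; case: ifPn => BA; last first.
  rewrite big1 // => C CA; rewrite ffunE; case: eqP => [CB|]; last by rewrite mul0r.
  by rewrite -CB CA in BA.
rewrite (bigD1 B) //= ffunE eqxx big1 ?addr0 // => C /andP[_ /negbTE CB].
by rewrite ffunE CB mul0r.
Qed.

(** * Division by denominators that depend on the cardinality *)

Section QuotientCumulants.
Variables (R : fieldType) (T : finType) (M : R) (d : nat -> R).
Variables (G g kappa : setfun R T).
Hypothesis d0 : d 0%N = 1.
Hypothesis dE : forall k, (k < #|T|.*2)%N -> (M - k.+1%:R) * d k.+1 = d k.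
Hypothesis G0 : G set0 = 1.
Hypothesis euler_G : euler G = euler g * G.
Let F c : setfun R T := [ffun A : {set T} => G A * d (#|A| + c)].
Hypothesis euler_F : euler (F 0%N) = euler kappa * F 0%N.

(** [u c] is the quotient [F c / F 0]. Writing [#|A|] as [#|A :\: B| + #|B|] inside [d] turns
    [euler_G] into an expansion of [euler (F 0)] with terms [euler g B] times [F #|B|]; division by
    [F 0] gives the second clause. The third is the recursion [dE], that is (M - c - 1 - D) F_(c+1)
    = F_c, rewritten by the Leibniz rule for [F c.+1 = F 0 * u c.+1]. *)
Lemma quotient_cumulants : exists u : nat -> setfun R T,
  [/\ u 0%N = 1,
      forall A : {set T}, euler kappa A =
        \sum_(B : {set T} | B \subset A) euler g B * u #|B| (A :\: B) &
      forall c (A : {set T}), (c < #|T|)%N -> (M - c.+1%:R - #|A|%:R) * u c.+1 A =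
        u c A + (euler kappa * u c.+1) A].
Proof.
have F0 : F 0%N set0 = 1 by rewrite ffunE G0 cards0 d0 mul1r.
have [h Fh] := setfun_inv F0.
pose u c := h * F c; exists u.
have Fu c : F c = F 0%N * u c by rewrite /u mulrA Fh mul1r.
have u0 : u 0%N = 1 by rewrite /u mulrC.
split=> //.
  have : euler (F 0%N) =
      F 0%N * \sum_(B : {set T}) setfun_single B (euler g B) * u #|B|.
    apply/ffunP => A; rewrite mulr_sumr.
    have -> : euler (F 0%N) A = euler G A * d #|A| by rewrite !ffunE addn0 mulrA.
    rewrite euler_G setfun_mulE mulr_suml sum_ffunE big_mkcond /=.
    apply: eq_bigr => B _; rewrite [F 0%N * _]mulrCA -Fu setfun_singleM.
    case: ifP => // BA; rewrite [F _ _]ffunE cardsDS //.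
    by rewrite subnK ?subset_leq_card // mulrA.
  rewrite euler_F mulrC => /(setfun_lreg F0) -> A.
  rewrite sum_ffunE [RHS]big_mkcond /=.
  by apply: eq_bigr => B _; rewrite setfun_singleM.
move=> c A cT.
have : F 0%N * ([ffun A : {set T} => (M - c.+1%:R) * u c.+1 A] - euler (u c.+1)) =
       F 0%N * (u c + euler kappa * u c.+1).
  rewrite [in RHS]mulrDr -Fu mulrBr mulrA [F 0%N * euler kappa]mulrC -euler_F.
  apply: (addIr (F 0%N * euler (u c.+1))); rewrite subrK -addrA -eulerM -Fu.
  have -> : F 0%N * [ffun A : {set T} => (M - c.+1%:R) * u c.+1 A] =
            [ffun A : {set T} => (M - c.+1%:R) * F c.+1 A].
    apply/ffunP => B; rewrite [in RHS]Fu setfun_mulE [RHS]ffunE setfun_mulE.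
    rewrite mulr_sumr; apply: eq_bigr => C _.
    by rewrite [[ffun _ => (M - _) * _] _]ffunE mulrCA.
  apply/ffunP => B; rewrite !ffunE addnS.
  rewrite -[d (#|B| + c)]dE; last first.
    by rewrite -addnn -addnS leq_add ?max_card.
  rewrite -addnS natrD; ring.
move=> /(setfun_lreg F0)/ffunP/(_ A); move: (u c.+1) (u c) => v w.
rewrite [RHS]ffunE => <-; rewrite [RHS]ffunE.
by rewrite mulrBl !ffunE.
Qed.

End QuotientCumulants.

(** * Noncrossing partitions *)

Lemma partition_setUK (T : finType) (X Z : {set T}) (P1 P2 : {set {set T}}) :
  [disjoint X & Z] -> partition P1 X -> partition P2 Z -> (P1 :|: P2) ::&: X = P1.
Proof.
move=> dXZ p1 p2; apply/setP => C; rewrite !inE.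
apply/idP/idP => [/andP[/orP[//|C2] CX]|C1]; last by rewrite C1 (partitionS p1).
have := partition_neq0 p2 C2; rewrite -subset0 -(eqP (_ : X :&: Z == set0)).
  by rewrite subsetI CX (partitionS p2).
by rewrite setI_eq0.
Qed.

Lemma big_partition_setU (V : nmodType) (T : finType) (X Z : {set T})
    (F : {set {set T}} -> V) : [disjoint X & Z] ->
  \sum_(Q : {set {set T}} | partition Q (X :|: Z) &&
      [forall C in Q, (C \subset X) || (C \subset Z)]) F Q =
  \sum_(P1 : {set {set T}} | partition P1 X)
    \sum_(P2 : {set {set T}} | partition P2 Z) F (P1 :|: P2).
Proof.
move=> dXZ; rewrite pair_big_dep /=.
have dXZ0 : X :&: Z = set0 by apply/eqP; rewrite setI_eq0.
have restr (Q : {set {set T}}) (X1 Z1 : {set T}) : X1 :&: Z1 = set0 ->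
    partition Q (X1 :|: Z1) ->
    [forall C in Q, (C \subset X1) || (C \subset Z1)] -> partition (Q ::&: X1) X1.
  move=> d /and3P[/eqP cQ tQ Q0] /forall_inP sQ; apply/and3P; split.
  - rewrite eqEsubset; apply/andP; split.
      by apply: subset_trans (cover_setI _ _) (subsetIr _ _).
    apply/subsetP => x xX; have xc : x \in cover Q by rewrite cQ inE xX.
    apply/bigcupP; exists (pblock Q x); last by rewrite mem_pblock.
    rewrite !inE pblock_mem //=; have /orP[//|/subsetP/(_ x)] := sQ _ (pblock_mem xc).
    rewrite mem_pblock xc => /(_ isT) xZ.
    by move: (in_set0 x); rewrite -d inE xX xZ.
  - exact: trivIsetI.
  - by rewrite !inE (negbTE Q0).
rewrite (reindex_onto (fun P : {set {set T}} * {set {set T}} => P.1 :|: P.2)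
   (fun Q => (Q ::&: X, Q ::&: Z))) /=; last first.
  move=> Q /andP[_ /forall_inP sQ]; apply/setP => C; rewrite !inE -andb_orr.
  by apply: andb_idr; exact: sQ.
apply: eq_bigl => -[P1 P2] /=; apply/idP/idP.
  move=> /andP[/andP[pQ sQ] /eqP[E1 E2]]; apply/andP; split.
    by rewrite -E1; exact: (restr _ _ Z dXZ0 pQ sQ).
  rewrite -E2; apply: (restr _ _ X); rewrite 1?setIC // 1?[Z :|: X]setUC //.
  apply/forall_inP => C CQ; rewrite orbC; exact: (forall_inP sQ).
move=> /andP[p1 p2].
have s12 (C : {set T}) : C \in P1 :|: P2 -> (C \subset X) || (C \subset Z).
  by rewrite inE => /orP[/(partitionS p1) ->//|/(partitionS p2) ->]; rewrite orbT.
apply/andP; split.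
  apply/andP; split; last by apply/forall_inP.
  apply/and3P; split.
  - by rewrite /cover bigcup_setU -!/(cover _) (cover_partition p1) (cover_partition p2) eqxx.
  - apply: trivIsetU; [exact: partition_trivIset p1|exact: partition_trivIset p2|].
    by rewrite (cover_partition p1) (cover_partition p2).
  - by rewrite inE (partition0 p1) (partition0 p2).
apply/eqP; congr (_, _); first exact: (partition_setUK dXZ p1 p2).
by rewrite setUC; apply: (@partition_setUK _ _ X) => //; rewrite disjoint_sym.
Qed.

Section Noncrossing.
Variable n : nat.
Implicit Types (P Q : {set {set 'I_n}}) (B C : {set 'I_n}).

Definition noncrossing_spec P := forall B C (i j k l : 'I_n),
  B \in P -> C \in P -> i \in B -> j \in C -> k \in B -> l \in C ->
  (i < j)%N -> (j < k)%N -> (k < l)%N -> B = C.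

Lemma noncrossingP P : reflect (noncrossing_spec P) (noncrossing P).
Proof.
apply: (iffP idP) => [ncP B C i j k l BP CP iB jC kB lC ij jk kl|ncP].
  apply/eqP/negPn/negP => BC.
  have /forall_inP/(_ _ CP)/implyP/(_ BC) := forall_inP ncP _ BP.
  case/negP; apply/exists_inP; exists i => //; apply/exists_inP; exists j => //.
  by apply/exists_inP; exists k => //; apply/exists_inP; exists l => //; apply/and3P.
apply/forall_inP => B BP; apply/forall_inP => C CP; apply/implyP => BC.
apply/negP => /exists_inP[i iB /exists_inP[j jC /exists_inP[k kB]]].
move=> /exists_inP[l lC /and3P[ij jk kl]].
by case/eqP: BC; exact: (ncP _ _ i j k l).
Qed.

Lemma noncrossingS P Q : P \subset Q -> noncrossing Q -> noncrossing P.
Proof.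
move=> /subsetP PQ /noncrossingP ncQ; apply/noncrossingP => B C i j k l BP CP.
by apply: ncQ; exact: PQ.
Qed.

Definition ord_itv (p q : nat) : {set 'I_n} := [set i : 'I_n | p <= i < q]%N.

Section Split.
Variables (p i : 'I_n) (q : nat) (B : {set 'I_n}).
Hypotheses (pi : (p < i)%N) (iB : i \in B) (Bi : B \subset ord_itv i q).
Let X := ord_itv p.+1 i.
Let Z := ord_itv i q :\: B.

(** Here [i] is the second smallest element of the block [p |: B]. The remaining points are the gap
    [X] strictly between [p] and [i], and the points [Z] beyond [i] outside [B]. *)
Lemma ord_itv_split : ord_itv p q :\: (p |: B) = X :|: Z.
Proof.
have iq : (i < q)%N by have := subsetP Bi i iB; rewrite inE => /andP[].
apply/setP => k; rewrite !inE -val_eqE /=.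
have [kB|kB] := boolP (k \in B).
  have := subsetP Bi k kB; rewrite inE /= orbT /= orbF => /andP[ik _].
  by rewrite [(k < i)%N]ltnNge ik andbF.
rewrite orbF /=; lia.
Qed.

Lemma disjoint_split : [disjoint X & Z].
Proof.
rewrite -setI_eq0; apply/eqP/setP => k; rewrite !inE.
by case: (k \in B) => /=; lia.
Qed.

(** A block with a point y in the gap and a point x in [Z] would cross [p |: B] along p < y < i <
    x. *)
Lemma noncrossing_splits Q : partition Q (X :|: Z) ->
  noncrossing ((p |: B) |: Q) -> [forall C in Q, (C \subset X) || (C \subset Z)].
Proof.
move=> pQ /noncrossingP ncQ; apply/forall_inP => C CQ.
have CXZ := partitionS pQ CQ.
have [//|/subsetPn[x xC xX]] := boolP (C \subset X); apply/subsetP => y yC /=.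
have xZ : x \in Z by have := subsetP CXZ x xC; rewrite inE (negbTE xX).
have := subsetP CXZ y yC; rewrite inE => /orP[yX|//].
move: xZ yX; rewrite !inE => /andP[xB /andP[ix xq]] /andP[py yi].
have xi : (i < x)%N.
  rewrite ltn_neqAle ix andbT; apply: contraNneq xB => /val_inj <- //.
have E : p |: B = C.
  by apply: (ncQ _ _ p y i x) => //; rewrite !inE ?eqxx ?iB ?CQ ?orbT.
have := subsetP CXZ p; rewrite -E !inE eqxx /= => /(_ isT).
by rewrite ltnn [(i <= p)%N]leqNgt pi andbF.
Qed.

(** Points of [P1] lie strictly between [p] and [i], all other points do not, so these two families
    never cross. Against a block of [P2], which lies beyond [i], the element [i] of [B] can play the
    part of [p]. *)
Lemma noncrossing_split P1 P2 : partition P1 X -> partition P2 Z ->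
  noncrossing ((p |: B) |: (P1 :|: P2)) = noncrossing P1 && noncrossing (B |: P2).
Proof.
move=> p1 p2.
have P1X C x : C \in P1 -> x \in C -> (p < x < i)%N.
  by move=> CP /(subsetP (partitionS p1 CP)); rewrite inE.
have P2Z C x : C \in P2 -> x \in C -> (i < x < q)%N && (x \notin B).
  move=> CP /(subsetP (partitionS p2 CP)); rewrite !inE => /andP[xB /andP[ix ->]].
  rewrite xB !andbT ltn_neqAle ix andbT.
  by apply: contraNneq xB => /val_inj <-.
have Bi' x : x \in B -> (i <= x)%N.
  by move=> /(subsetP Bi); rewrite inE => /andP[].
have BP2 : B \notin P2.
  by apply/negP => BP; have := P2Z _ _ BP iB; rewrite iB andbF.
have pBN (x : 'I_n) : (p < x)%N -> x \in p |: B -> x \in B.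
  by move=> px; rewrite !inE => /orP[/eqP xp|//]; move: px; rewrite xp ltnn.
apply/idP/andP => [ncQ|[/noncrossingP nc1 /noncrossingP nc2]].
  split; first by apply: noncrossingS ncQ; rewrite setUCA subsetUl.
  move/noncrossingP: ncQ => ncQ; apply/noncrossingP => C D a b c d.
  have pP2 : p |: B \notin P2.
    apply/negP => pBP; have := P2Z _ p pBP; rewrite !inE eqxx => /(_ isT).
    by rewrite ltnNge (ltnW pi).
  rewrite !inE => /orP[/eqP ->|CP] /orP[/eqP ->|DP] aC bD cC dD ab bc cd //.
  - have E : p |: B = D by apply: (ncQ _ _ a b c d); rewrite // !inE ?eqxx ?aC ?cC ?DP ?orbT.
    by rewrite E DP in pP2.
  - have E : C = p |: B by apply: (ncQ _ _ a b c d); rewrite // !inE ?eqxx ?bD ?dD ?CP ?orbT.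
    by rewrite -E CP in pP2.
  - by apply: (ncQ _ _ a b c d); rewrite // !inE ?CP ?DP ?orbT.
apply/noncrossingP => C D a b c d; rewrite !inE.
move=> /or3P[/eqP ->|CP|CP] /or3P[/eqP ->|DP|DP] aC bD cC dD ab bc cd //.
- have /andP[pb bi] := P1X _ _ DP bD; have /andP[pd di] := P1X _ _ DP dD.
  by have := Bi' _ (pBN c (ltn_trans pb bc) cC); rewrite leqNgt (ltn_trans cd di).
- have /andP[/andP[ib bq] bB] := P2Z _ _ DP bD.
  have cB : c \in B by apply: pBN cC; apply: ltn_trans bc; apply: ltn_trans ib.
  have E : B = D by apply: (nc2 _ _ i b c d); rewrite // !inE ?eqxx ?DP ?orbT.
  by rewrite E bD in bB.
- have /andP[pa ai] := P1X _ _ CP aC; have /andP[pc ci] := P1X _ _ CP cC.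
  by have := Bi' _ (pBN b (ltn_trans pa ab) bD); rewrite leqNgt (ltn_trans bc ci).
- by apply: (nc1 _ _ a b c d).
- have /andP[/andP[ib _] _] := P2Z _ _ DP bD; have /andP[_ ci] := P1X _ _ CP cC.
  by move: (ltn_trans ib bc); rewrite ltnNge (ltnW ci).
- have /andP[/andP[ia _] aB] := P2Z _ _ CP aC.
  have pb : (p < b)%N by apply: ltn_trans ab; apply: ltn_trans ia.
  have bB := pBN _ pb bD; have dB := pBN _ (ltn_trans pb (ltn_trans bc cd)) dD.
  have E : C = B by apply: (nc2 _ _ a b c d); rewrite // !inE ?eqxx ?CP ?orbT.
  by rewrite -E aC in aB.
- have /andP[/andP[ic _] _] := P2Z _ _ CP cC; have /andP[_ di] := P1X _ _ DP dD.
  by move: (ltn_trans ic cd); rewrite ltnNge (ltnW di).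
- by apply: (nc2 _ _ a b c d); rewrite // !inE ?CP ?DP ?orbT.
Qed.

End Split.

Variables (R : comPzRingType) (kap : nat -> R).

Definition nc_sum (A : {set 'I_n}) : R :=
  \sum_(P : {set {set 'I_n}} | partition P A && noncrossing P)
    \prod_(B in P) kap #|B|.

(* The block of [p] is counted as if it had [j] further elements. *)
Definition nc_sum_open (p : 'I_n) (A : {set 'I_n}) (j : nat) : R :=
  \sum_(B : {set 'I_n} | (B \subset A) && (p \in B))
    \sum_(Q : {set {set 'I_n}} | partition Q (A :\: B) && noncrossing (B |: Q))
      kap (#|B| + j) * \prod_(C in Q) kap #|C|.

Lemma nc_sum_set0 : nc_sum set0 = 1.
Proof.
rewrite /nc_sum (big_pred1 set0) ?big_set0 // => P.
rewrite partition_set0 /=; apply: andb_idr => /eqP ->.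
by apply/noncrossingP => B C i j k l; rewrite inE.
Qed.

Lemma nc_sum_openE (p : 'I_n) (A : {set 'I_n}) : p \in A -> nc_sum A = nc_sum_open p A 0.
Proof.
move=> pA; rewrite /nc_sum big_mkcondr (sum_partition_pblock _ pA) /=.
apply: eq_bigr => B /andP[BA pB]; rewrite [RHS]big_mkcondr /=.
apply: eq_bigr => Q pQ; case: ifP => // _.
have B0 : B != set0 by apply/set0Pn; exists p.
have [_ BQ] := partition_setU1 B0 BA pQ.
by rewrite big_setU1 //= addn0.
Qed.

Lemma sum_subset_min (F : {set 'I_n} -> R) (r q : nat) :
  \sum_(B : {set 'I_n} | B \subset ord_itv r q) F B =
  F set0 + \sum_(i : 'I_n | (r <= i < q)%N)
    \sum_(B : {set 'I_n} | (B \subset ord_itv i q) && (i \in B)) F B.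
Proof.
rewrite (bigD1 set0) ?sub0set //=; congr (_ + _).
rewrite [RHS](exchange_big_dep
  (fun B : {set 'I_n} => (B \subset ord_itv r q) && (B != set0))) /=; last first.
  move=> i B /andP[ri iq] /andP[/subsetP Bi iB]; apply/andP; split.
    apply/subsetP => k /Bi; rewrite !inE => /andP[ik ->].
    by rewrite (leq_trans ri ik).
  by apply/set0Pn; exists i.
apply: eq_bigr => B /andP[/subsetP Br /set0Pn[i0 i0B]].
case: (arg_minnP (fun i : 'I_n => i : nat) i0B) => i iB0 imin.
have iB : i \in B := iB0.
rewrite (big_pred1 i) // => k; apply/andP/eqP => [[/andP[rk kq] /andP[/subsetP Bk kB]]|->].
  apply/val_inj/eqP; rewrite /= eqn_leq imin // andbT.
  by have := Bk i iB; rewrite inE => /andP[].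
have := Br i iB; rewrite inE => ->; split=> //; rewrite iB andbT.
apply/subsetP => l lB; rewrite inE imin //=.
by have := Br l lB; rewrite inE => /andP[].
Qed.

(** The sum is split by the second element [i] of the block of [p], the first term being the case
    where there is none. Removing [p] leaves an open block starting at [i], so the count of further
    elements rises from [j] to [j.+1]; the gap before [i] is partitioned independently. *)
Lemma nc_sum_open_rec (p : 'I_n) (q j : nat) : (p < q <= n)%N ->
  nc_sum_open p (ord_itv p q) j =
  nc_sum (ord_itv p.+1 q) * kap j.+1 +
  \sum_(i : 'I_n | (p < i < q)%N)
    nc_sum (ord_itv p.+1 i) * nc_sum_open i (ord_itv i q) j.+1.
Proof.
move=> /andP[pq qn]; rewrite /nc_sum_open.
have pN : p \notin ord_itv p.+1 q by rewrite inE ltnn.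
have pE : ord_itv p q = p |: ord_itv p.+1 q.
  by apply/setP => k; rewrite !inE -val_eqE /=; lia.
have -> : \sum_(B : {set 'I_n} | (B \subset ord_itv p q) && (p \in B))
    \sum_(Q : {set {set 'I_n}} | partition Q (ord_itv p q :\: B) && noncrossing (B |: Q))
      kap (#|B| + j) * \prod_(C in Q) kap #|C| =
  \sum_(B : {set 'I_n} | B \subset ord_itv p.+1 q)
    \sum_(Q : {set {set 'I_n}} | partition Q (ord_itv p q :\: (p |: B)) &&
        noncrossing ((p |: B) |: Q))
      kap (#|B| + j.+1) * \prod_(C in Q) kap #|C|.
  rewrite (reindex_onto (fun B => p |: B) (fun B => B :\ p)) /=; last first.
    by move=> B /andP[_]; exact: setD1K.
  apply: eq_big => B.
    rewrite setU11 andbT pE; apply/andP/idP => [[pB]|Bp].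
      by move=> /eqP <-; rewrite -(setU1K pN) setSD.
    by rewrite setUS // setU1K //; apply: contra pN; apply: subsetP.
  move=> /andP[_ /eqP BE]; have pB : p \notin B by rewrite -BE !inE eqxx.
  by apply: eq_bigr => Q _; rewrite cardsU1 pB add1n addSnnS.
rewrite sum_subset_min; congr (_ + _).
  rewrite setU0 cards0 mulrC /nc_sum mulr_sumr; apply: eq_bigl => Q.
  have -> : ord_itv p q :\: [set p] = ord_itv p.+1 q by rewrite pE setU1K.
  apply: andb_id2l => pQ; apply/idP/idP; first by apply: noncrossingS; rewrite subsetUr.
  move=> /noncrossingP ncQ; apply/noncrossingP => B C a b c d; rewrite !inE.
  move=> /orP[/eqP ->|BQ] /orP[/eqP ->|CQ] //.
  - rewrite !inE => /eqP -> _ /eqP -> _ pb bp.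
    by move: (ltn_trans pb bp); rewrite ltnn.
  - rewrite !inE => _ /eqP -> _ /eqP -> _ pb bp.
    by move: (ltn_trans pb bp); rewrite ltnn.
  - by apply: ncQ.
apply: eq_bigr => i /andP[pi iq]; rewrite mulr_sumr; apply: eq_bigr => B /andP[Bi iB].
rewrite (ord_itv_split pi iB Bi).
rewrite /nc_sum mulr_suml.
transitivity (\sum_(Q : {set {set 'I_n}} | partition Q (ord_itv p.+1 i :|: ord_itv i q :\: B) &&
   [forall C in Q, (C \subset ord_itv p.+1 i) || (C \subset ord_itv i q :\: B)])
   if noncrossing ((p |: B) |: Q) then kap (#|B| + j.+1) * \prod_(C in Q) kap #|C| else 0).
  rewrite [RHS]big_mkcondr [LHS]big_mkcondr /=; apply: eq_bigr => Q pQ.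
  case: ifP => ncQ; last by case: ifP.
  by rewrite (noncrossing_splits pi iB pQ ncQ).
rewrite big_partition_setU ?disjoint_split //.
rewrite [RHS]big_mkcondr /=; apply: eq_bigr => P1 p1.
transitivity (\sum_(P2 : {set {set 'I_n}} | partition P2 (ord_itv i q :\: B))
  if noncrossing P1 && noncrossing (B |: P2) then
   (\prod_(C in P1) kap #|C|) * (kap (#|B| + j.+1) * \prod_(C in P2) kap #|C|) else 0).
  apply: eq_bigr => P2 p2; rewrite (noncrossing_split pi iB Bi p1 p2).
  case: ifP => // _.
  rewrite mulrCA -bigU /=; last first.
    rewrite -setI_eq0; apply/eqP/setP => C; rewrite !inE; apply/negP => /andP[C1 C2].
    case/set0Pn: (partition_neq0 p1 C1) => x xC.
    have := subsetP (partitionS p2 C2) x xC; have := subsetP (partitionS p1 C1) x xC.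
    by rewrite !inE => /andP[_ xi] /andP[_ /andP[ix _]]; rewrite leqNgt xi in ix.
  by congr (_ * _); apply: eq_bigl => C; rewrite !inE.
case: ifP => _ /=; last by rewrite big1.
by rewrite mulr_sumr [RHS]big_mkcondr.
Qed.

End Noncrossing.

(** * Recursion on the length of the interval *)

Section NoncrossingSeries.
Variables (R : comPzRingType) (kap : nat -> R).
Hypothesis kap0 : kap 0 = 1.

(** Stands for [l] points still to be partitioned, the first of which belongs to an open block with
    [j] elements so far; with no point left the block closes with weight [kap j]. The call on
    [l' - t] is not structural, hence the fuel. *)
Fixpoint nc_series_fuel (f l j : nat) : R :=
  if f is f'.+1 then
    if l is l'.+1 then
      \sum_(t < l) nc_series_fuel f' t 0 * nc_series_fuel f' (l' - t) j.+1
    else kap j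
  else kap j.

Definition nc_series l j := nc_series_fuel l l j.

Lemma nc_series_fuelE f l j : (l <= f)%N -> nc_series_fuel f l j = nc_series l j.
Proof.
suff H g : (l <= f)%N -> (l <= g)%N -> nc_series_fuel f l j = nc_series_fuel g l j.
  by move=> lf; apply: H.
elim: f g l j => [|f IH] [|g] [|l] j //= lf lg.
apply: eq_bigr => t _; have tl : (t <= l)%N by rewrite -ltnS.
have lt := leq_subr t l.
by congr (_ * _); apply: IH; rewrite ?(leq_trans tl) ?(leq_trans lt).
Qed.

Lemma nc_seriesS l j :
  nc_series l.+1 j = \sum_(t < l.+1) nc_series t 0 * nc_series (l - t) j.+1.
Proof.
rewrite {1}/nc_series /=; apply: eq_bigr => t _.
by rewrite !nc_series_fuelE // ?leq_subr // -ltnS.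
Qed.

Lemma nc_sum_interval n (p q : nat) : (p <= q <= n)%N ->
  nc_sum kap (ord_itv n p q) = nc_series (q - p) 0 /\
  forall (i : 'I_n) j, (i < q)%N -> i = p :> nat ->
    nc_sum_open kap i (ord_itv n i q) j = nc_series (q - p) j.
Proof.
have [k] := ubnP (q - p); elim: k p q => // k IH p q; rewrite ltnS => qpk /andP[pq qn].
suff O : forall (i : 'I_n) j, (i < q)%N -> i = p :> nat ->
    nc_sum_open kap i (ord_itv n i q) j = nc_series (q - p) j.
  split=> //; move: pq; rewrite leq_eqVlt => /orP[/eqP <-|pq].
    have -> : ord_itv n p p = set0 by apply/setP => x; rewrite !inE; lia.
    by rewrite nc_sum_set0 subnn.
  have pn := leq_trans pq qn.
  by rewrite (@nc_sum_openE _ _ _ (Ordinal pn)) ?O // inE leqnn.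
move=> i j iq ip; rewrite nc_sum_open_rec ?iq //.
rewrite -ip in qpk *; case E: (q - i)%N => [|l]; first by move: iq E; lia.
(* The last summand, with no point left after the gap, is the case where the block ends at [i]. *)
rewrite nc_seriesS big_ord_recr /= subnn addrC; congr (_ + _).
  have [-> _] := IH i.+1 q ltac:(lia) ltac:(lia).
  by rewrite (_ : q - i.+1 = l)%N //; lia.
pose F t := nc_series (t - i.+1) 0 * nc_series (q - t) j.+1.
transitivity (\sum_(t : 'I_n | (i < t < q)%N) F t).
  apply: eq_bigr => t /andP[it tq].
  have [-> _] := IH i.+1 t ltac:(lia) ltac:(lia).
  by have [_ ->] := IH t q ltac:(lia) ltac:(lia).
rewrite -(big_mkord (fun t => (i < t < q)%N) F).
rewrite (@big_cat_nat _ _ _ i.+1) //=.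
rewrite [X in X + _]big_nat_cond big_pred0 ?add0r; last by move=> t; lia.
rewrite (@big_cat_nat _ _ _ q) //=.
rewrite [X in _ + X]big_nat_cond [X in _ + X]big_pred0 ?addr0; last by move=> t; lia.
have -> : \sum_(i.+1 <= t < q | (i < t < q)%N) F t = \sum_(i.+1 <= t < q) F t.
  by rewrite big_nat_cond [RHS]big_nat_cond; apply: eq_bigl => t; lia.
rewrite -{1}[i.+1]add0n big_addn (_ : q - i.+1 = l)%N; last by lia.
rewrite big_mkord; apply: eq_bigr => t _; rewrite /F addnK.
by congr (_ * nc_series _ _); move: (ltn_ord t); lia.
Qed.

Lemma nc_series_NC n :
  nc_series n 0 = \sum_(P in NC n) \prod_(B in P) kap #|B|.
Proof.
have [E _] := @nc_sum_interval n 0 n ltac:(lia).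
rewrite -(subn0 n) -E /nc_sum subn0.
have -> : ord_itv n 0 n = [set: 'I_n] by apply/setP => x; rewrite !inE ltn_ord.
by apply: eq_bigl => P; rewrite inE.
Qed.

End NoncrossingSeries.

(** * Functional equations of the generating series *)

Section TruncatedSeries.
Variables (R : comNzRingType) (N : nat).
Implicit Types p q r s : {poly R}.

(** Power series are modelled by polynomials modulo X^(N+1); with an explicit quotient [r],
    compatibility with the ring operations is left to [ring]. *)
Definition eq_trunc p q := exists r, p = q + r * 'X^(N.+1).

Lemma eq_trunc_refl p : eq_trunc p p.
Proof. by exists 0; rewrite mul0r addr0. Qed.

Lemma eq_trunc_sym p q : eq_trunc p q -> eq_trunc q p.
Proof. by case=> r ->; exists (- r); rewrite mulNr addrK. Qed.

Lemma eq_trunc_trans q p s : eq_trunc p q -> eq_trunc q s -> eq_trunc p s.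
Proof. by case=> r -> [r' ->]; exists (r' + r); rewrite mulrDl addrA. Qed.

Lemma eq_truncD p q r s : eq_trunc p q -> eq_trunc r s -> eq_trunc (p + r) (q + s).
Proof. by case=> a -> [b ->]; exists (a + b); ring. Qed.

Lemma eq_truncN p q : eq_trunc p q -> eq_trunc (- p) (- q).
Proof. by case=> r ->; exists (- r); ring. Qed.

Lemma eq_truncM p q r s : eq_trunc p q -> eq_trunc r s -> eq_trunc (p * r) (q * s).
Proof.
case=> a -> [b ->]; exists (a * s + q * b + a * b * 'X^(N.+1)); ring.
Qed.

(** The factor ['X] in the inner polynomial sends X^(N+1) to a multiple of itself. *)
Lemma eq_trunc_comp p q r : eq_trunc p q -> eq_trunc (p \Po ('X * r)) (q \Po ('X * r)).
Proof.
case=> a ->; exists ((a \Po ('X * r)) * r ^+ N.+1).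
by rewrite comp_polyD comp_polyM comp_Xn_poly exprMn; congr (_ + _); ring.
Qed.

Lemma eq_truncX p q k : eq_trunc p q -> eq_trunc (p ^+ k) (q ^+ k).
Proof.
move=> pq; elim: k => [|k IH]; first by rewrite !expr0; exact: eq_trunc_refl.
by rewrite !exprS; apply: eq_truncM.
Qed.

Lemma eq_trunc_sum (I : Type) (s : seq I) (P : pred I) (F G : I -> {poly R}) :
  (forall i, P i -> eq_trunc (F i) (G i)) ->
  eq_trunc (\sum_(i <- s | P i) F i) (\sum_(i <- s | P i) G i).
Proof.
move=> FG; apply: (big_ind2 eq_trunc) => //; first exact: eq_trunc_refl.
by move=> *; apply: eq_truncD.
Qed.

Lemma eq_trunc_compr p q r : eq_trunc q r -> eq_trunc (p \Po q) (p \Po r).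
Proof.
move=> qr; rewrite !comp_polyE; apply: eq_trunc_sum => i _; rewrite -!mul_polyC.
by apply: eq_truncM (eq_trunc_refl _) _; apply: eq_truncX.
Qed.

Lemma eq_trunc_coef p q i : eq_trunc p q -> (i <= N)%N -> p`_i = q`_i.
Proof. by case=> r -> iN; rewrite coefD coefMXn ltnS iN addr0. Qed.

Lemma coef_eq_trunc p q : (forall i, (i <= N)%N -> p`_i = q`_i) -> eq_trunc p q.
Proof.
move=> pq; exists (drop_poly N.+1 (p - q)).
rewrite -{1}[p](subrK q) addrC; congr (_ + _).
rewrite -{1}[p - q](poly_take_drop N.+1) -[RHS]add0r; congr (_ + _).
apply/polyP => i; rewrite coef_take_poly coef0; case: ifP => // iN.
by rewrite coefB pq ?subrr.
Qed.

End TruncatedSeries.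

Lemma coefM_poly (R : comNzRingType) N (f g : nat -> R) k : (k <= N)%N ->
  ((\poly_(i < N.+1) f i) * (\poly_(i < N.+1) g i))`_k =
  \sum_(t < k.+1) f t * g (k - t)%N.
Proof.
move=> kN; rewrite coefM; apply: eq_bigr => t _; rewrite !coef_poly !ltnS.
by rewrite (leq_trans (leq_subr _ _) kN) (leq_trans _ kN) // -ltnS.
Qed.

Lemma poly_compE (R : comNzRingType) N (f : nat -> R) q :
  (\poly_(i < N.+1) f i) \Po q = \sum_(i < N.+1) f i *: q ^+ i.
Proof.
rewrite poly_def raddf_sum; apply: eq_bigr => i _ /=.
by rewrite comp_polyZ comp_Xn_poly.
Qed.

(** The series V_j of the [nc_series kap _ j] satisfy V_j = kap_j + X M V_(j+1), with M = V_0. After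
    N + 1 substitutions the remainder (X M)^(N+1) V_(N+1) vanishes modulo X^(N+1). *)
Lemma nc_series_comp (R : comNzRingType) (kap : nat -> R) N :
  let M := \poly_(i < N.+1) nc_series kap i 0 in
  eq_trunc N M ((\poly_(i < N.+1) kap i) \Po ('X * M)).
Proof.
move=> M; pose V j := \poly_(i < N.+1) nc_series kap i j.
have VS j : eq_trunc N (V j) ((kap j)%:P + 'X * M * V j.+1).
  apply: coef_eq_trunc => -[|k] kN; rewrite coef_poly coefD coefC -mulrA coefXM /=.
    by rewrite addr0.
  by rewrite ltnS kN add0r coefM_poly ?nc_seriesS // ltnW.
have Vk k : eq_trunc N M (\sum_(i < k) kap i *: ('X * M) ^+ i + ('X * M) ^+ k * V k).
  elim: k => [|k IH].
    by rewrite big_ord0 add0r expr0 mul1r; exact: eq_trunc_refl.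
  apply: eq_trunc_trans IH _; rewrite big_ord_recr /= -addrA.
  apply: eq_truncD (eq_trunc_refl _ _) _.
  apply: eq_trunc_trans (eq_truncM (eq_trunc_refl _ _) (VS k)) _.
  rewrite mulrDr mulrA -exprSr mulrC mul_polyC; exact: eq_trunc_refl.
rewrite poly_compE; apply: eq_trunc_trans (Vk N.+1) _.
apply: eq_trunc_sym; exists (- (M ^+ N.+1 * V N.+1)).
rewrite exprMn; ring.
Qed.

Section FunctionalEquation.
Variables (R : comNzRingType) (kap : nat -> R) (N : nat).
Variables (h : nat -> R) (u : nat -> nat -> R).
Let mu k := nc_series kap k 0.
Hypothesis kap0 : kap 0 = 1.
Hypothesis h0 : h 0 = 0.
Hypothesis u0 : forall k, u 0 k = (k == 0)%:R.
Hypothesis uS : forall c k, (c < N)%N -> (k <= N)%N ->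
  u c.+1 k = u c k + \sum_(t < k.+1) h t * u c.+1 (k - t).
Hypothesis hE : forall k, (0 < k <= N)%N ->
  h k = \sum_(b < k) (-1) ^+ b * mu b.+1 * u b.+1 (k - b.+1).

Lemma functional_equation k : (0 < k <= N)%N -> h k = (-1) ^+ k.-1 * kap k.
Proof.
pose K := \poly_(i < N.+1) kap i; pose M := \poly_(i < N.+1) mu i.
pose H := \poly_(i < N.+1) h i; pose W c := \poly_(i < N.+1) u c i.
pose z := 'X * - W 1.
move=> /andP[k0 kN]; have N0 : (0 < N)%N by apply: leq_trans kN.
have refl := eq_trunc_refl N.
have W0 : eq_trunc N (W 0) 1.
  by apply: coef_eq_trunc => i iN; rewrite coef_poly ltnS iN u0 coef1.
have WS c : (c < N)%N -> eq_trunc N (W c.+1 * (1 - H)) (W c).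
  move=> cn; have : eq_trunc N (W c.+1) (W c + H * W c.+1).
    apply: coef_eq_trunc => i iN.
    by rewrite coefD coefM_poly // !coef_poly ltnS iN uS.
  by case=> r E; exists r; rewrite mulrBr mulr1 {1}E; ring.
(* At [c = 0] the relation [WS] says that [W 1] inverts [1 - H]; multiplying [WS] by [W 1] then
   gives W_(c+1) = W_c W_1. *)
have Wc c : (c <= N)%N -> eq_trunc N (W c) (W 1 ^+ c).
  elim: c => [|c IH] cn; first by rewrite expr0.
  have : eq_trunc N (W c.+1 * (1 - H) * W 1) (W c * W 1).
    by apply: eq_truncM => //; exact: WS.
  have : eq_trunc N (W c.+1 * (1 - H) * W 1) (W c.+1).
    rewrite -mulrA -[X in eq_trunc _ _ X]mulr1; apply: eq_truncM => //.
    rewrite mulrC; apply: eq_trunc_trans (WS 0 N0) W0.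
  move=> /eq_trunc_sym E1 E2; apply: eq_trunc_trans E1 _.
  apply: eq_trunc_trans E2 _; rewrite exprSr; apply: eq_truncM => //.
  exact/IH/ltnW.
have HE : eq_trunc N (1 - H) (M \Po z).
  have HH : eq_trunc N H (\sum_(b < N) ((-1) ^+ b * mu b.+1) *: ('X^(b.+1) * W b.+1)).
    apply: coef_eq_trunc => i iN; rewrite coef_sum coef_poly ltnS iN.
    case: i iN => [|i] iN.
      by rewrite h0 big1 // => b _; rewrite coefZ coefXnM mulr0.
    rewrite hE // (big_ord_widen N (fun b => (-1) ^+ b * mu b.+1 * u b.+1 (i.+1 - b.+1)%N)) //.
    rewrite big_mkcond; apply: eq_bigr => b _.
    rewrite coefZ coefXnM ltnS ltnNge -ltnS; case: ltnP => bi; last by rewrite mulr0.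
    by rewrite coef_poly ltnS (leq_trans (leq_subr _ _) iN).
  (* The sign in [z] produces (-1)^(b+1), whence the minus sign in front of the sum in [HH]; the
     constant term is [mu 0 = kap 0 = 1]. *)
  have MZ : M \Po z = 1 - \sum_(b < N) ((-1) ^+ b * mu b.+1) *: ('X^(b.+1) * W 1 ^+ b.+1).
    rewrite /M poly_compE big_ord_recl expr0 {1}/mu /nc_series /= kap0 scale1r.
    rewrite -sumrN; congr (_ + _); apply: eq_bigr => b _.
    rewrite /bump leq0n add1n /z mulrN [in LHS]exprNn exprMn.
    rewrite -!mul_polyC exprS polyCM rmorphXn rmorphN1 /=; ring.
  rewrite MZ; apply: eq_truncD => //; apply: eq_truncN.
  apply: eq_trunc_trans HH _; apply: eq_trunc_sum => b _; rewrite -!mul_polyC.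
  by do 2![apply: eq_truncM => //]; exact: Wc.
have MK := nc_series_comp kap N; rewrite -/mu -/M -/K /= in MK.
have KH : eq_trunc N (1 - H) (K \Po (- 'X)).
  apply: (eq_trunc_trans HE).
  have E3 := eq_trunc_comp (- W 1) MK; rewrite -/z in E3.
  apply: (eq_trunc_trans E3).
  (* It remains to see that z M(z) = - X W_1 (1 - H) = - X. *)
  rewrite -comp_polyA comp_polyM comp_polyX; apply: eq_trunc_compr.
  apply: eq_trunc_trans (eq_truncM (refl _ _) (eq_trunc_sym HE)) _.
  rewrite /z mulrN mulNr; apply: eq_truncN.
  rewrite -mulrA -[X in eq_trunc _ _ X]mulr1; apply: eq_truncM => //.
  by apply: eq_trunc_trans (WS 0 N0) W0.
have := eq_trunc_coef KH kN; rewrite poly_compE coef_sum.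
have kN' : (k < N.+1)%N by [].
have coefNXn i : ((- 'X : {poly R}) ^+ i)`_k = (-1) ^+ i * (k == i)%:R.
  rewrite [(- _) ^+ i in LHS]exprNn (_ : (-1) ^+ i = ((-1) ^+ i)%:P) ?coefCM ?coefXn //.
  by rewrite rmorphXn rmorphN1.
rewrite (bigD1 (Ordinal kN')) //= big1 => [|i ik]; last first.
  rewrite coefZ coefNXn (_ : (k == i) = false) ?mulr0 //.
  by apply: contraNF ik => /eqP ki; apply/eqP/val_inj.
rewrite addr0 coefB coef1 (gtn_eqF k0) sub0r coef_poly kN' coefZ coefNXn eqxx mulr1.
move=> /eqP; rewrite eqr_oppLR => /eqP ->.
by case: (k) k0 => // l _; rewrite exprS mulN1r mulrN opprK mulrC.
Qed.

End FunctionalEquation.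

(** * The system of equations satisfied in the limit *)

Section LimitSystem.
Variables (R : comPzRingType) (I : finType) (T : setfun R I).
Hypothesis T0 : T set0 = 0.
Implicit Types (f g h : setfun R I) (A B C : {set I}).

Definition agree k f g := forall A, (#|A| < k)%N -> f A = g A.

Lemma agreeM k f f' g g' : agree k f f' -> agree k g g' -> agree k (f * g) (f' * g').
Proof.
move=> ff gg A Ak; rewrite !setfun_mulE; apply: eq_bigr => B BA.
rewrite ff ?gg //; apply: leq_ltn_trans Ak; apply: subset_leq_card => //.
exact: subsetDl.
Qed.

Lemma agreeX k f g i : agree k f g -> agree k (f ^+ i) (g ^+ i).
Proof.
move=> fg; elim: i => [|i IH]; first by rewrite !expr0.
by rewrite !exprS; apply: agreeM.
Qed.

Let geom f := \sum_(i < #|I|.+1) f ^+ i.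

Lemma geomE f : f set0 = 0 -> geom f = 1 + f * geom f.
Proof.
move=> f0; have vf k : vanish k (f ^+ k).
  elim: k => [|k IH]; first by move=> A.
  rewrite exprS -add1n; apply: vanishM IH.
  by move=> A; rewrite ltnS leqn0 cards_eq0 => /eqP ->.
have fI : f ^+ #|I|.+1 = 0.
  by apply/ffunP => A; rewrite vf ?ltnS ?max_card // ffunE.
apply/eqP; rewrite -subr_eq -[X in X - _]mul1r -mulrBl.
by rewrite -[1 - f]opprB mulNr -subrX1 fI sub0r opprK.
Qed.

Let step f : setfun R I :=
  [ffun A : {set I} => \sum_(B : {set I} | B \subset A)
     T B * (geom f ^+ #|B|) (A :\: B)].

(** The term [B = set0] is killed by [T0]; every other term sees its argument only on subsets of
    [A :\: B], which is strictly smaller than [A]. *)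
Lemma agree_step k f g : agree k f g -> agree k.+1 (step f) (step g).
Proof.
move=> fg A Ak; rewrite !ffunE; apply: eq_bigr => B BA.
have [->|B0] := eqVneq B set0; first by rewrite T0 !mul0r.
have AB : (#|A :\: B| < k)%N.
  rewrite cardsDS // -ltnS; apply: leq_ltn_trans Ak.
  rewrite ltn_subrL card_gt0 B0 (leq_trans _ (subset_leq_card BA)) //.
  by rewrite card_gt0.
congr (_ * _); apply: (agreeX _ _ AB) => C Ck.
by rewrite !sum_ffunE; apply: eq_bigr => i _; apply: (agreeX _ fg Ck).
Qed.

(* [step] gains one degree of agreement, so its iterates become stationary. *)
Lemma limit_system : exists (H : setfun R I) (U : nat -> setfun R I),
  [/\ H set0 = 0, U 0%N = 1, forall c, U c.+1 = U c + H * U c.+1 &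
      forall A, H A = \sum_(B : {set I} | B \subset A) T B * U #|B| (A :\: B)].
Proof.
have it k : agree k (iter k step 0) (iter k.+1 step 0).
  by elim: k => [|k IH]; [move=> A | exact: agree_step].
pose H := iter #|I|.+1 step 0.
have HE : H = step H by apply/ffunP => A; apply: it; rewrite ltnS max_card.
have H0 : H set0 = 0.
  rewrite HE ffunE big1 // => B; rewrite subset0 => /eqP ->.
  by rewrite T0 mul0r.
exists H, (fun c => geom H ^+ c); split=> //.
- by move=> c; rewrite exprS {1}(geomE H0) mulrDl mul1r mulrA.
- by move=> A; rewrite {1}HE ffunE.
Qed.

End LimitSystem.

Lemma card_ord_lt n k : (k <= n)%N -> #|[set i : 'I_n | (i < k)%N]| = k.
Proof.
move=> kn; have winj : injective (widen_ord kn) by move=> i j /(congr1 val)/= /val_inj.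
rewrite -[RHS]card_ord -cardsT -(card_imset _ winj); apply: eq_card => i.
rewrite inE; apply/idP/imsetP => [ik|[j _ ->]]; last exact: (ltn_ord j).
by exists (Ordinal ik) => //; apply/val_inj.
Qed.

(** * Data depending on the cardinality only *)

Section SizeSystem.
Variables (R : realFieldType) (n : nat) (t : nat -> R).
Variables (T H : setfun R 'I_n) (U : nat -> setfun R 'I_n).
Hypothesis TE : forall B : {set 'I_n}, T B = t #|B|.
Hypotheses (t0 : t 0%N = 0) (U0 : U 0%N = 1).
Hypothesis US : forall c, U c.+1 = U c + H * U c.+1.
Hypothesis HE : forall A : {set 'I_n}, H A =
  \sum_(B : {set 'I_n} | B \subset A) T B * U #|B| (A :\: B).

Let init k := [set i : 'I_n | (i < k)%N].

Definition size_H k := H (init k).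
Definition size_U c k := U c (init k).

(** The case [j = 0] is cut off in the recursion for [U] because it would involve [U c.+1 A] itself,
    on which the induction hypothesis is silent; its coefficient [H set0] is zero. The term [B = A]
    is the reason for the premise [H A = size_H k]. *)
Lemma size_system_rec k : (forall A : {set 'I_n}, (#|A| < k)%N ->
    H A = size_H #|A| /\ forall c, U c A = size_U c #|A|) ->
  forall A : {set 'I_n}, #|A| = k ->
  H A = \sum_(j < k.+1) (t j * size_U j (k - j)) *+ 'C(k, j) /\
  (H A = size_H k -> forall c, U c.+1 A = U c A +
     \sum_(j < k.+1) (size_H j * (if j == 0%N :> nat then 0 else size_U c.+1 (k - j))) *+ 'C(k, j)).
Proof.
move=> IH A Ak.
have small (B : {set 'I_n}) : B \subset A -> B != set0 -> (#|A :\: B| < k)%N.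
  move=> BA B0; rewrite -Ak cardsDS // ltn_subrL card_gt0 B0.
  by rewrite (leq_trans _ (subset_leq_card BA)) // card_gt0.
have H0 : H set0 = 0.
  rewrite HE big1 // => B; rewrite subset0 => /eqP ->.
  by rewrite TE cards0 t0 mul0r.
split=> [|HAk c].
  rewrite HE -Ak -(big_subset_card (fun j => t j * size_U j (#|A| - j))).
  apply: eq_bigr => B BA; rewrite TE.
  have [->|B0] := eqVneq B set0; first by rewrite cards0 t0 !mul0r.
  by rewrite (IH _ (small _ BA B0)).2 cardsDS.
rewrite US [LHS]ffunE setfun_mulE; congr (_ + _).
rewrite -Ak -(big_subset_card (fun j => size_H j *
   (if j == 0%N then 0 else size_U c.+1 (#|A| - j)))).
apply: eq_bigr => B BA.
have [->|B0] := eqVneq B set0; first by rewrite cards0 H0 mulr0 mul0r.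
rewrite cards_eq0 (negbTE B0) (IH _ (small _ BA B0)).2 cardsDS //; congr (_ * _).
have [->|BneA] := eqVneq B A; first by rewrite HAk Ak.
apply: (IH _ _).1; rewrite -Ak; apply: proper_card.
by rewrite properEneq BneA.
Qed.

Lemma size_system k (A : {set 'I_n}) : (#|A| < k)%N ->
  H A = size_H #|A| /\ forall c, U c A = size_U c #|A|.
Proof.
elim: k A => // k IH A; rewrite ltnS leq_eqVlt => /orP[/eqP Ak|]; last exact: IH.
have kn : (k <= n)%N by rewrite -Ak -[X in (_ <= X)%N]card_ord max_card.
have [HA UA] := size_system_rec IH Ak.
have [Hi Ui] := size_system_rec IH (card_ord_lt kn).
have HAi : H A = size_H k by rewrite HA -Hi.
rewrite Ak; split=> //; elim=> [|c IHc].
  by rewrite /size_U U0 !setfun_1E -!cards_eq0 card_ord_lt // Ak.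
by rewrite UA // IHc /size_U Ui.
Qed.

Lemma size_HE k : (k <= n)%N ->
  size_H k = \sum_(j < k.+1) (t j * size_U j (k - j)) *+ 'C(k, j).
Proof.
move=> kn; have [E _] := size_system_rec (k := k)
  (fun A _ => size_system (ltnSn #|A|)) (card_ord_lt kn).
by rewrite /size_H E.
Qed.

Lemma size_H0 : size_H 0 = 0.
Proof. by rewrite size_HE // big_ord1 t0 mul0r. Qed.

Lemma size_US c k : (k <= n)%N -> size_U c.+1 k =
  size_U c k + \sum_(j < k.+1) (size_H j * size_U c.+1 (k - j)) *+ 'C(k, j).
Proof.
move=> kn; have [_ E] := size_system_rec (k := k)
  (fun A _ => size_system (ltnSn #|A|)) (card_ord_lt kn).
rewrite {1}/size_U E //; congr (_ + _); apply: eq_bigr => j _.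
by case: eqP => // ->; rewrite size_H0 !mul0r.
Qed.

End SizeSystem.

Lemma binomial_split (R : realFieldType) k j (x y : R) : (j <= k)%N ->
  (x * y) *+ 'C(k, j) / k`!%:R = (x / j`!%:R) * (y / (k - j)`!%:R).
Proof.
move=> jk; have f0 m : m`!%:R != 0 :> R by rewrite pnatr_eq0 -lt0n fact_gt0.
rewrite -mulr_natr -(bin_fact jk) !natrM; field.
by rewrite !f0 /= pnatr_eq0 -lt0n bin_gt0.
Qed.

(** Dividing by [k!] turns the binomial convolutions of the cardinality system into Cauchy products,
    so that [functional_equation] applies to exponential generating series. *)
Lemma moment_system (R : realFieldType) n (m : nat -> R)
    (H : setfun R 'I_n) (U : nat -> setfun R 'I_n) : (0 < n)%N ->
  U 0%N = 1 -> (forall c, U c.+1 = U c + H * U c.+1) ->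
  (forall A : {set 'I_n}, H A = \sum_(B : {set 'I_n} | B \subset A)
      euler (min_cumulant (fun C : {set 'I_n} => m #|C|)) B * U #|B| (A :\: B)) ->
  H [set: 'I_n] = n`!%:R * ((-1) ^+ n.-1 * free_cumulant_of_moments m n).
Proof.
move=> n0 U0 US HE.
pose t j : R := j%:R * ((-1) ^+ j.-1 * (j.-1)`!%:R * m j).
have TE (B : {set 'I_n}) : euler (min_cumulant (fun C : {set 'I_n} => m #|C|)) B = t #|B|.
  by rewrite !ffunE.
have t0 : t 0%N = 0 by rewrite /t mul0r.
pose kap j := if j is 0 then 1 else free_cumulant_of_moments m j.
have mE k : m k.+1 = nc_series kap k.+1 0.
  rewrite nc_series_NC // (@free_cumulantE _ m k.+1) //.
  apply: eq_bigr => Q; rewrite inE => /andP[pQ _]; apply: eq_bigr => B BQ.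
  have : (0 < #|B|)%N by rewrite card_gt0 (partition_neq0 pQ).
  by case: #|B|.
have f0 j : j`!%:R != 0 :> R by rewrite pnatr_eq0 -lt0n fact_gt0.
pose h k := size_H H k / k`!%:R; pose u c k := size_U U c k / k`!%:R.
have := @functional_equation R kap n h u _ _ _ _ _ n; rewrite n0 leqnn.
have [HT _] := size_system TE t0 U0 US HE (ltnSn #|[set: 'I_n]|).
rewrite HT cardsT card_ord => fe.
have -> : size_H H n = n`!%:R * h n by rewrite /h mulrC divfK.
rewrite fe //; first by case: (n) n0.
- by rewrite /h (size_H0 TE t0 U0 US HE) mul0r.
- move=> k; rewrite /u /size_U U0 setfun_1E.
  have [->|k0] := eqVneq k 0%N.
    by rewrite (_ : [set i : 'I_n | _] = set0) ?eqxx ?fact0 ?divr1 //.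
  rewrite (_ : _ == set0 = false) ?mul0r //; apply/negbTE/set0Pn.
  by exists (Ordinal n0); rewrite inE lt0n.
- move=> c k _ kn; rewrite /u (size_US TE t0 U0 US HE c kn) mulrDl mulr_suml.
  congr (_ + _); apply: eq_bigr => j _; rewrite binomial_split //.
  by rewrite -ltnS.
move=> k /andP[k0 kn]; rewrite /h (size_HE TE t0 U0 US HE kn) mulr_suml.
rewrite big_ord_recl /= t0 !mul0r mul0rn mul0r add0r; apply: eq_bigr => b _.
rewrite /bump leq0n add1n binomial_split //; congr (_ * _).
(* t_(b+1) / (b+1)! = (-1)^b m_(b+1): the Euler factor and the factorial of the cumulant absorb the
   denominator. *)
rewrite -mE /t /= factS natrM; field.
by rewrite f0 addrC natr1 pnatr_eq0.
Qed.

(** The rescaled cumulants satisfy the moment-cumulant formula because block sizes add up to [n];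
    uniqueness does the rest. *)
Lemma free_cumulant_scale (R : comPzRingType) (m : nat -> R) (v : R) n : (0 < n)%N ->
  free_cumulant_of_moments (fun k => v ^+ k * m k) n = v ^+ n * free_cumulant_of_moments m n.
Proof.
move=> n0; symmetry; move: n n0.
apply: (@free_cumulant_unique _ _ (fun k => v ^+ k * free_cumulant_of_moments m k)) => n n0.
rewrite (@free_cumulantE _ m n) // mulr_sumr; apply: eq_bigr => P.
rewrite inE => /andP[pP _]; rewrite big_split /= prodrXr; congr (v ^+ _ * _).
by rewrite -(card_partition pP) cardsT card_ord.
Qed.

(** * Stationary moments *)

Lemma sum_bonds (V : zmodType) N (x : 'I_N -> V) :
  \sum_(i : 'I_N) \sum_(j : 'I_N | i.+1 == j) (x i - x j) =
  \sum_(i : 'I_N | i == 0 :> nat) x i - \sum_(i : 'I_N | i.+1 == N) x i.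
Proof.
have E1 : \sum_(i : 'I_N) \sum_(j : 'I_N | i.+1 == j) x i = \sum_(i : 'I_N | i.+1 != N) x i.
  rewrite [RHS]big_mkcond; apply: eq_bigr => i _; case: eqP => iN /=.
    by rewrite big_pred0 // => j; rewrite iN; apply/negbTE; rewrite neq_ltn ltn_ord orbT.
  have iN' : (i.+1 < N)%N by rewrite ltn_neqAle ltn_ord andbT; apply/eqP.
  by rewrite (big_pred1 (Ordinal iN')) // => j; rewrite -val_eqE eq_sym.
have E2 : \sum_(i : 'I_N) \sum_(j : 'I_N | i.+1 == j) x j = \sum_(i : 'I_N | i != 0 :> nat) x i.
  rewrite (exchange_big_dep xpredT) //= [RHS]big_mkcond; apply: eq_bigr => j _.
  case: eqP => [j0|/eqP j0] /=; first by rewrite big_pred0 // => i; rewrite j0.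
  have jN : (j.-1 < N)%N by apply: leq_ltn_trans (ltn_ord j); exact: leq_pred.
  rewrite (big_pred1 (Ordinal jN)) // => i; apply/eqP/eqP => [ij|->].
    by apply/val_inj; rewrite /= -ij.
  by rewrite /= prednK // lt0n.
under eq_bigr => i _ do rewrite big_split /= sumrN.
rewrite big_split /= sumrN E1 E2.
have BN : \sum_(i : 'I_N | i.+1 != N) x i =
    \sum_i x i - \sum_(i : 'I_N | i.+1 == N) x i.
  by rewrite [X in X - _](bigID (fun i : 'I_N => i.+1 == N)) /= addrAC subrr add0r.
have B0 : \sum_(i : 'I_N | i != 0 :> nat) x i =
    \sum_i x i - \sum_(i : 'I_N | i == 0 :> nat) x i.
  by rewrite [X in X - _](bigID (fun i : 'I_N => i == 0 :> nat)) /= addrAC subrr add0r.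
by rewrite BN B0 opprB addrC addrA subrK.
Qed.

Section Dynamics.
Variables (R : realType) (N : nat).
Implicit Types (A B C : {set 'I_N}) (t : config N) (i j : 'I_N).

Definition occ A t : R := \prod_(i in A) (t i)%:R.

Definition swap_config i j t : config N := [ffun k => t (tperm i j k)].

Lemma occ_swap i j A t : occ A (swap_config i j t) = occ (tperm i j @: A) t.
Proof.
rewrite /occ big_imset /=; last by move=> x y _ _; exact: perm_inj.
by apply: eq_bigr => k _; rewrite ffunE.
Qed.

Variables bl br : boundary_rates R.

(** Under [ibl] and [ebr] below, this is the generator applied to [occ A], read as an operator on
    functions of [A]: the points of [A] are stirred along bonds, killed at site 1 and absorbed at
    site [N]. Products of occupations thus close among themselves (duality). *)
Definition ssep_dual (e : {set 'I_N} -> R) A : R :=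
  \sum_(i : 'I_N) \sum_(j : 'I_N | i.+1 == j) (e (tperm i j @: A) - e A)
  - \sum_(i : 'I_N | i == 0 :> nat) (i \in A)%:R * (extraction bl * e A)
  + \sum_(i : 'I_N | i.+1 == N) (i \in A)%:R * (injection br * (e (A :\ i) - e A)).

Hypotheses (ibl : injection bl = 0) (ebr : extraction br = 0).

Lemma occ_set_false A i t :
  occ A (set_site t i false) = if i \in A then 0 else occ A t.
Proof.
case: ifPn => iA; first by rewrite /occ (bigD1 i) //= ffunE eqxx mul0r.
apply: eq_bigr => k kA; rewrite ffunE ifN //.
by apply: contraNneq iA => <-.
Qed.

Lemma occ_set_true A i t :
  occ A (set_site t i true) = if i \in A then occ (A :\ i) t else occ A t.
Proof.
case: ifPn => iA.
  rewrite /occ (bigD1 i) //= ffunE eqxx mul1r.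
  apply: eq_big => k; first by rewrite !inE andbC.
  by move=> /andP[_ /negbTE ki]; rewrite ffunE ki.
apply: eq_bigr => k kA; rewrite ffunE ifN //.
by apply: contraNneq iA => <-.
Qed.

Lemma occ_false A i t : i \in A -> t i = false -> occ A t = 0.
Proof. by move=> iA ti; rewrite /occ (bigD1 i) //= ti mul0r. Qed.

Lemma occ_true A i t : i \in A -> t i = true -> occ (A :\ i) t = occ A t.
Proof.
move=> iA ti; rewrite /occ [RHS](bigD1 i) //= ti mul1r.
by apply: eq_bigl => k; rewrite !inE andbC.
Qed.

Lemma boundary_rate_sum b i (f : config N -> R) t :
  \sum_(s : config N) boundary_rate b i t s * (f s - f t) =
  (if t i then extraction b else injection b) * (f (set_site t i (~~ t i)) - f t).
Proof.
rewrite (bigD1 (set_site t i (~~ t i))) //= /boundary_rate eqxx big1 ?addr0 //.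
by move=> s /negbTE ->; rewrite mul0r.
Qed.

(** The two jumps along a bond together act as an exchange of the occupations at rate 1, since
    exchanging equal occupations changes nothing. This removes the exclusion constraint from the
    bond part. *)
Lemma ssep_rate_sum (f : config N -> R) t :
  \sum_(s : config N) ssep_rate bl br t s * (f s - f t) =
  \sum_(i : 'I_N) \sum_(j : 'I_N | i.+1 == j) (f (swap_config i j t) - f t)
  + \sum_(i : 'I_N | i == 0 :> nat) (t i)%:R * (extraction bl * (f (set_site t i false) - f t))
  + \sum_(i : 'I_N | i.+1 == N) (~~ t i)%:R * (injection br * (f (set_site t i true) - f t)).
Proof.
have pick (u : config N) : \sum_(s : config N) (s == u)%:R * (f s - f t) = f u - f t.
  rewrite (bigD1 u) //= eqxx mul1r big1 ?addr0 // => s /negbTE ->.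
  by rewrite mul0r.
under eq_bigr => s _ do rewrite !mulrDl.
rewrite !big_split /=; congr (_ + _ + _).
- under eq_bigr => s _ do rewrite mulr_suml.
  rewrite exchange_big /=.
  pose hop i j : config N := set_site (set_site t i false) j true.
  transitivity (\sum_i \sum_(j : 'I_N | adjacent i j)
      (t i && ~~ t j)%:R * (f (hop i j) - f t)).
    apply: eq_bigr => i _; under eq_bigr => s _ do rewrite mulr_suml.
    rewrite exchange_big /=; apply: eq_bigr => j _.
    under eq_bigr => s _ do rewrite andbA -mulnb natrM -mulrA.
    by rewrite -mulr_sumr pick.
  (* Each bond is taken once, as [i.+1 = j], with its two opposite jumps. *)
  transitivity (\sum_(i : 'I_N) \sum_(j : 'I_N | i.+1 == j)
     ((t i && ~~ t j)%:R * (f (hop i j) - f t) +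
      (t j && ~~ t i)%:R * (f (hop j i) - f t))).
    under [RHS]eq_bigr => i _ do rewrite big_split /=.
    rewrite big_split /= [X in _ = _ + X](exchange_big_dep xpredT) //= -big_split /=.
    apply: eq_bigr => i _; rewrite (bigID (fun j : 'I_N => i.+1 == j)) /=.
    congr (_ + _); apply: eq_bigl => j; rewrite /adjacent.
      by case: (i.+1 == j :> nat); rewrite ?andbF.
    case: eqP => [<-|]; rewrite /= ?andbT ?andbF //.
    by apply/esym/eqP; lia.
  apply: eq_bigr => i _; apply: eq_bigr => j /eqP ij.
  have ij' : i != j by rewrite -val_eqE /= -ij neq_ltn ltnSn.
  have ji' : j != i by rewrite eq_sym.
  have same : t i = t j -> swap_config i j t = t.
    move=> tij; apply/ffunP => k; rewrite ffunE.
    by case: tpermP => [->|->|].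
  case ti: (t i) same; case tj: (t j) => /= same; rewrite ?mul0r ?mul1r ?addr0 ?add0r.
  + by rewrite same ?subrr.
  + congr (f _ - _); apply/ffunP => k; rewrite !ffunE.
    case: tpermP => [->|->|/eqP/negbTE -> /eqP/negbTE ->//];
      by rewrite ?eqxx ?(negbTE ij') ?(negbTE ji') ?ti ?tj.
  + congr (f _ - _); apply/ffunP => k; rewrite !ffunE.
    case: tpermP => [->|->|/eqP/negbTE -> /eqP/negbTE ->//];
      by rewrite ?eqxx ?(negbTE ij') ?(negbTE ji') ?ti ?tj.
  + by rewrite same ?subrr.
- under eq_bigr => s _ do rewrite mulr_suml.
  rewrite exchange_big /=; apply: eq_bigr => i _; rewrite boundary_rate_sum ibl.
  by case: (t i); rewrite ?mul1r ?mul0r.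
- under eq_bigr => s _ do rewrite mulr_suml.
  rewrite exchange_big /=; apply: eq_bigr => i _; rewrite boundary_rate_sum ebr.
  by case: (t i); rewrite ?mul1r ?mul0r.
Qed.

Variable P : config N -> R.
Hypothesis invP : ssep_invariant bl br P.

(** Invariance is paired with [occ A]. The rows of the generator sum to zero, so it acts through the
    differences [occ A s - occ A t], to which [ssep_rate_sum] applies. *)
Lemma stationary_dual A : ssep_dual (fun A => expectation_of P (occ A)) A = 0.
Proof.
have [_ _ st] := invP.
have : \sum_t P t * \sum_(s : config N) ssep_rate bl br t s * (occ A s - occ A t) = 0.
  transitivity (\sum_(s : config N) (\sum_t P t * ssep_generator bl br t s) * occ A s).
    under [RHS]eq_bigr => s _ do rewrite mulr_suml.
    rewrite exchange_big /=; apply: eq_bigr => t _.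
    under [RHS]eq_bigr => s _ do rewrite -mulrA.
    rewrite -mulr_sumr; congr (_ * _).
    rewrite [RHS](bigD1 t) //= {1}/ssep_generator eqxx mulNr mulr_suml -sumrN -big_split /=.
    rewrite (bigD1 t) //= subrr mulr0 add0r; apply: eq_bigr => s st'.
    by rewrite /ssep_generator eq_sym (negbTE st') mulrBr addrC.
  by rewrite big1 // => s _; rewrite st mul0r.
under eq_bigr => t _ do rewrite ssep_rate_sum !mulrDr !mulr_sumr.
rewrite !big_split /= => <-; rewrite /ssep_dual; congr (_ + _ + _).
- rewrite exchange_big /=; apply: eq_bigr => i _.
  under [RHS]eq_bigr => t _ do rewrite mulr_sumr.
  rewrite exchange_big /=; apply: eq_bigr => j _.
  by rewrite /expectation_of -sumrB; apply: eq_bigr => t _; rewrite occ_swap mulrBr.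
- rewrite exchange_big /= -sumrN; apply: eq_bigr => i _.
  rewrite /expectation_of mulr_sumr mulr_sumr -sumrN; apply: eq_bigr => t _.
  rewrite occ_set_false; case: ifP => iA; last by rewrite subrr !(mulr0, mul0r) oppr0.
  have [ti|/negbTE ti] := boolP (t i); rewrite ?mul1r ?mul0r ?sub0r ?mulr0.
    by rewrite mulrN mulrN (mulrCA (P t)).
  by rewrite (occ_false iA ti) !mulr0 oppr0.
- rewrite exchange_big /=; apply: eq_bigr => i _.
  rewrite /expectation_of -sumrB !mulr_sumr; apply: eq_bigr => t _.
  rewrite occ_set_true; case: ifP => iA; last by rewrite subrr !(mulr0, mul0r).
  rewrite mul1r -mulrBr (mulrCA (injection br)); congr (_ * _).
  have [ti|/negbTE ti] := boolP (t i); rewrite ?mul1r ?mul0r //.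
  by rewrite (occ_true iA ti) subrr mulr0.
Qed.

End Dynamics.

(** * Uniqueness for the dual equation *)

Section DualUniqueness.
Variables (R : realType) (N : nat) (bl br : boundary_rates R).
Hypotheses (bl_gt0 : 0 < extraction bl) (br_gt0 : 0 < injection br).
Implicit Types (A B C : {set 'I_N}) (e : {set 'I_N} -> R).

(* Maximum principle: among the maximizers of [e] on sets of size [n], one with
   the smallest sum of positions violates the equation. *)
Lemma ssep_dual_le0 e n : e set0 = 0 -> (forall A, ssep_dual bl br e A = 0) ->
  (forall A, (#|A| < n)%N -> e A = 0) -> forall A, #|A| = n -> e A <= 0.
Proof.
move=> e0 eqe small A0 /eqP A0n; rewrite leNgt; apply/negP => eA0.
case: (arg_maxP (P := fun A : {set 'I_N} => #|A| == n) e A0n) => A1 /= /eqP A1n max1.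
have A1max : (#|A1| == n) && (e A1 == e A1) by rewrite A1n !eqxx.
pose wt A := (\sum_(i in A) i)%N.
case: (arg_minnP (P := fun A : {set 'I_N} => (#|A| == n) && (e A == e A1)) wt A1max).
move=> A /andP[/eqP An /eqP eA] minA.
have eA_gt0 : 0 < e A by rewrite eA; apply: lt_le_trans eA0 _; exact: max1.
have maxA B : #|B| = n -> e B <= e A by move=> /eqP Bn; rewrite eA; exact: max1.
have /set0Pn[i0 i0A] : A != set0 by apply: contraTneq eA_gt0 => ->; rewrite e0 ltxx.
case: (arg_minnP (fun i : 'I_N => i : nat) i0A) => p pA0 pmin.
have pA : p \in A := pA0.
have cardp (s : 'S_N) : #|s @: A| = n by rewrite card_imset //; exact: perm_inj.
have bond (i j : 'I_N) : e (tperm i j @: A) - e A <= 0.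
  by rewrite subr_le0 maxA.
have right : \sum_(i : 'I_N | i.+1 == N) (i \in A)%:R * (injection br * (e (A :\ i) - e A)) <= 0.
  apply: sumr_le0 => i _; case: (boolP (i \in A)) => iA; last by rewrite mul0r.
  rewrite mul1r pmulr_rle0 // subr_le0 small ?ltW //.
  by rewrite -An (cardsD1 i A) iA.
have left : 0 <= \sum_(i : 'I_N | i == 0 :> nat) (i \in A)%:R * (extraction bl * e A).
  by apply: sumr_ge0 => i _; rewrite !mulr_ge0 // ltW.
have bonds : \sum_(i : 'I_N) \sum_(j : 'I_N | i.+1 == j) (e (tperm i j @: A) - e A) <= 0.
  by apply: sumr_le0 => i _; apply: sumr_le0.
have := eqe A; rewrite /ssep_dual.
(* [p] is the leftmost point of the chosen maximizer. At site 1 the extraction term is strictly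
   negative; elsewhere the bond to its left moves [p] to an empty site and lowers the sum of
   positions, so the value there is strictly below the maximum. *)
have [p0|p0] := posnP p.
  suff : 0 < \sum_(i : 'I_N | i == 0 :> nat) (i \in A)%:R * (extraction bl * e A) by lra.
  rewrite (bigD1 p) ?p0 //= pA mul1r ltr_pwDl ?mulr_gt0 //.
  by apply: sumr_ge0 => i _; rewrite !mulr_ge0 // ltW.
suff : \sum_(i : 'I_N) \sum_(j : 'I_N | i.+1 == j) (e (tperm i j @: A) - e A) < 0 by lra.
have qN : (p.-1 < N)%N by apply: leq_ltn_trans (leq_pred _) (ltn_ord p).
pose q := Ordinal qN; have qp : q.+1 == p by rewrite /= prednK.
have qA : q \notin A by apply/negP => /pmin; rewrite /= leqNgt ltn_predL p0.
have tA : tperm q p @: A = q |: A :\ p.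
  apply/setP => k; rewrite -[k in LHS](tpermK q p) (mem_imset _ _ perm_inj) !inE.
  case: tpermP => [->|->|/eqP/negbTE -> /eqP/negbTE ->//]; first by rewrite eqxx pA.
  rewrite (negbTE qA) eqxx /= orbF; apply/esym/negbTE.
  by apply: contraNneq qA => <-.
rewrite (bigD1 q) //= (bigD1 p) //= -addrA ltr_nwDl //.
  rewrite subr_lt0 lt_neqAle maxA // andbT; apply/negP => /eqP Eq.
  have := minA (tperm q p @: A); rewrite cardp Eq eA !eqxx => /(_ isT).
  rewrite leqNgt /wt tA big_setU1 ?inE ?(negbTE qA) ?andbF //= => /negP; apply.
  by rewrite [X in (_ < X)%N](big_setD1 p) //= ltn_add2r ltn_predL.
by rewrite -[leRHS]addr0 lerD //; [apply: sumr_le0|apply: sumr_le0 => i _; apply: sumr_le0].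
Qed.

(** Sets of size n are coupled only to sets of size n or n - 1, so the difference is shown to vanish
    size by size, with the maximum principle applied to both signs. *)
Lemma ssep_dual_unique e e' : e set0 = e' set0 ->
  (forall A, ssep_dual bl br e A = 0) -> (forall A, ssep_dual bl br e' A = 0) ->
  e =1 e'.
Proof.
move=> e0 eqe eqe'.
have sub (f g : {set 'I_N} -> R) A : ssep_dual bl br (fun A => f A - g A) A =
    ssep_dual bl br f A - ssep_dual bl br g A.
  pose F1 (h : {set 'I_N} -> R) :=
    \sum_(i : 'I_N) \sum_(j : 'I_N | i.+1 == j) (h (tperm i j @: A) - h A).
  pose F2 (h : {set 'I_N} -> R) :=
    \sum_(i : 'I_N | i == 0 :> nat) (i \in A)%:R * (extraction bl * h A).
  pose F3 (h : {set 'I_N} -> R) :=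
    \sum_(i : 'I_N | i.+1 == N) (i \in A)%:R * (injection br * (h (A :\ i) - h A)).
  have E1 : F1 (fun A => f A - g A) = F1 f - F1 g.
    rewrite /F1 -sumrB; apply: eq_bigr => i _; rewrite -sumrB.
    by apply: eq_bigr => j _; ring.
  have E2 : F2 (fun A => f A - g A) = F2 f - F2 g.
    by rewrite /F2 -sumrB; apply: eq_bigr => i _; ring.
  have E3 : F3 (fun A => f A - g A) = F3 f - F3 g.
    by rewrite /F3 -sumrB; apply: eq_bigr => i _; ring.
  change (F1 (fun A => f A - g A) - F2 (fun A => f A - g A) + F3 (fun A => f A - g A) =
    F1 f - F2 f + F3 f - (F1 g - F2 g + F3 g)).
  rewrite E1 E2 E3; ring.
suff H n A : (#|A| < n)%N -> e A - e' A = 0.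
  by move=> A; apply/eqP; rewrite -subr_eq0 (H #|A|.+1).
elim: n A => // n IH A; rewrite ltnS leq_eqVlt => /orP[/eqP An|]; last exact: IH.
apply/le_anti/andP; split.
  apply: (@ssep_dual_le0 (fun A => e A - e' A) n _ _ _ _ An) => //.
  - by rewrite e0 subrr.
  - by move=> B; rewrite sub eqe eqe' subrr.
rewrite -oppr_le0 opprB; apply: (@ssep_dual_le0 (fun A => e' A - e A) n _ _ _ _ An) => //.
- by rewrite e0 subrr.
- by move=> B; rewrite sub eqe eqe' subrr.
- by move=> B /IH/eqP; rewrite subr_eq0 => /eqP ->; rewrite subrr.
Qed.

End DualUniqueness.

(** * Product formula for the stationary moments *)

Section ExplicitMoments.
Variables (R : realType) (N : nat) (a b : R).
Implicit Types (A B C : {set 'I_N}) (i j k : 'I_N).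

(** For the k-th smallest site i_k of [A], numbered from 1, this is i_k - k; counting holes frees
    the product formula from an enumeration of [A]. *)
Definition holes_before A i := #|[set k : 'I_N | (k < i)%N && (k \notin A)]|.

Definition moment_num A : R := \prod_(i in A) (a + (holes_before A i)%:R).

Definition moment_den n : R := \prod_(k < n) (N%:R + a + b - k.+1%:R).

Hypotheses (a_gt0 : 0 < a) (b_gt0 : 0 < b).

Let rest A i : R := \prod_(k in A :\ i) (a + (holes_before A k)%:R).

Lemma moment_num_rest A i : i \in A ->
  moment_num A = (a + (holes_before A i)%:R) * rest A i.
Proof. by move=> iA; rewrite /moment_num (big_setD1 i). Qed.

Lemma holes_factor_gt0 A i : 0 < a + (holes_before A i)%:R :> R.
Proof. by rewrite ltr_wpDr. Qed.

Lemma holes_before_succ A i j : i.+1 = j :> nat ->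
  holes_before A j = (holes_before A i + (i \notin A))%N.
Proof.
move=> ij; have [iA|iA] := boolP (i \in A).
  rewrite addn0; apply: eq_card => k; rewrite !inE -ij ltnS leq_eqVlt.
  have [ki|//] := eqVneq (k : nat) i; rewrite (val_inj ki) iA ltnn //.
rewrite addnC /holes_before (cardsD1 i) !inE -ij ltnSn iA; congr addn.
apply: eq_card => k; rewrite !inE ltnS -val_eqE /= andbA; congr (_ && _).
by rewrite ltn_neqAle.
Qed.

Lemma holes_before_set A B i : (forall k, (k < i)%N -> (k \in A) = (k \in B)) ->
  holes_before A i = holes_before B i.
Proof.
move=> AB; apply: eq_card => k; rewrite !inE.
by have [ki|//] := boolP (k < i)%N; rewrite AB.
Qed.

(** Before the bond the two sets coincide, and beyond it they leave the same number of holes; only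
    the factor of the moving point changes, by one hole. *)
Lemma moment_num_hop C i j : i.+1 = j :> nat -> i \notin C -> j \notin C ->
  moment_num (j |: C) - moment_num (i |: C) = rest (i |: C) i /\
  rest (j |: C) j = rest (i |: C) i.
Proof.
move=> ij iC jC.
have eqr : rest (j |: C) j = rest (i |: C) i.
  rewrite /rest !setU1K //; apply: eq_bigr => k kC; congr (_ + _%:R).
  have ki : (k : nat) != i by apply: contraNneq iC => /val_inj <-.
  have kj : (k : nat) != j by apply: contraNneq jC => /val_inj <-.
  have [kli|ilk] := leqP k i.
    apply: holes_before_set => l lk; rewrite !inE -!val_eqE /=.
    by rewrite !ltn_eqF //; lia.
  have sw : holes_before (i |: C) k = holes_before (tperm i j @: (i |: C)) k.
    rewrite /holes_before -(card_imset _ (@perm_inj _ (tperm i j))).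
    apply: eq_card => l; rewrite -[l in LHS](tpermK i j) (mem_imset _ _ perm_inj) !inE.
    rewrite -[l in RHS](tpermK i j) (mem_imset _ _ perm_inj) tpermK !inE.
    congr (_ && _); case: tpermP => [->|->|//]; lia.
  rewrite sw; congr (holes_before _ k); apply/setP => l.
  rewrite -[l in RHS](tpermK i j) (mem_imset _ _ perm_inj) !inE.
  have ij' : i != j by rewrite -val_eqE /= -ij neq_ltn ltnSn.
  case: tpermP => [->|->|/eqP/negbTE -> /eqP/negbTE ->//].
    by rewrite (negbTE ij') (negbTE iC) eq_sym (negbTE ij') (negbTE jC).
  by rewrite !eqxx.
split=> //; rewrite (moment_num_rest (setU11 i C)) (moment_num_rest (setU11 j C)) eqr.
rewrite (holes_before_succ _ ij) (@holes_before_set (j |: C) (i |: C) i); last first.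
  by move=> k ki; rewrite !inE -!val_eqE /= !ltn_eqF // -ij ltnW.
rewrite !inE (negbTE iC) orbF -val_eqE /= -ij neq_ltn ltnSn /= natrD; ring.
Qed.

Lemma tperm_hop A i j : i \in A -> j \notin A -> tperm i j @: A = j |: A :\ i.
Proof.
move=> iA jA; have ij : i != j by apply: contraNneq jA => <-.
apply/setP => l; rewrite -[l in LHS](tpermK i j) (mem_imset _ _ perm_inj) !inE.
case: tpermP => [->|->|/eqP/negbTE -> /eqP/negbTE ->//].
  by rewrite (negbTE ij) eqxx (negbTE jA).
by rewrite eqxx iA.
Qed.

Lemma tperm_id A i j : (i \in A) = (j \in A) -> tperm i j @: A = A.
Proof.
move=> ij; apply/setP => l; rewrite -[l in LHS](tpermK i j) (mem_imset _ _ perm_inj).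
by case: tpermP => [->|->|//].
Qed.

(* The bond terms of the stationarity equation are differences of [current], so
   they telescope to the two boundary terms. *)
Let current A i : R := (i \in A)%:R * rest A i.

Lemma moment_num_bond A i j : i.+1 = j :> nat ->
  moment_num (tperm i j @: A) - moment_num A = current A i - current A j.
Proof.
move=> ij; rewrite /current; case: (boolP (i \in A)) (boolP (j \in A)) => iA [] jA.
(* With both sites occupied, the factors of [i] and [j] are equal and nonzero, so the two remaining
   products agree. *)
- rewrite tperm_id ?iA ?jA // subrr !mul1r; apply/esym/eqP; rewrite subr_eq0.
  have := moment_num_rest iA; rewrite (moment_num_rest jA).
  rewrite (holes_before_succ A ij) iA addn0 => /mulfI -> //.
  by rewrite gt_eqF ?holes_factor_gt0.
- rewrite tperm_hop // mul1r mul0r subr0.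
  have iC : i \notin A :\ i by rewrite !inE eqxx.
  have jC : j \notin A :\ i by rewrite !inE negb_and jA orbT.
  by have [] := moment_num_hop ij iC jC; rewrite setD1K.
- rewrite tpermC tperm_hop // mul1r mul0r sub0r.
  have jC : j \notin A :\ j by rewrite !inE eqxx.
  have iC : i \notin A :\ j by rewrite !inE negb_and iA orbT.
  have [] := moment_num_hop ij iC jC; rewrite setD1K // => E ->.
  by rewrite -E opprB.
- by rewrite tperm_id ?(negbTE iA) ?(negbTE jA) // !mul0r !subrr.
Qed.

Lemma moment_den_gt0 n : (n <= N)%N -> 0 < moment_den n.
Proof.
move=> nN; apply: prodr_gt0 => k _.
have : (k.+1%:R : R) <= N%:R by rewrite ler_nat (leq_trans _ nN).
by move: a_gt0 b_gt0; lra.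
Qed.

Definition moment_sol A : R := moment_num A / moment_den #|A|.

Lemma moment_sol0 : moment_sol set0 = 1.
Proof. by rewrite /moment_sol /moment_num /moment_den cards0 big_set0 big_ord0 divr1. Qed.

Lemma moment_sol_dual bl br A : extraction bl = a^-1 -> injection br = b^-1 ->
  ssep_dual bl br moment_sol A = 0.
Proof.
move=> ebl ibr; rewrite /ssep_dual.
have AN : (#|A| <= N)%N by rewrite -[X in (_ <= X)%N]card_ord max_card.
have D0 := moment_den_gt0 AN.
have -> : \sum_(i : 'I_N) \sum_(j : 'I_N | i.+1 == j)
    (moment_sol (tperm i j @: A) - moment_sol A) =
  (\sum_(i : 'I_N | i == 0 :> nat) current A i
   - \sum_(i : 'I_N | i.+1 == N) current A i) / moment_den #|A|.
  rewrite -sum_bonds mulr_suml; apply: eq_bigr => i _; rewrite mulr_suml.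
  apply: eq_bigr => j /eqP ij; rewrite /moment_sol card_imset; last exact: perm_inj.
  by rewrite -mulrBl moment_num_bond.
have -> : \sum_(i : 'I_N | i == 0 :> nat) (i \in A)%:R * (extraction bl * moment_sol A) =
  (\sum_(i : 'I_N | i == 0 :> nat) current A i) / moment_den #|A|.
  rewrite mulr_suml; apply: eq_bigr => i /eqP i0; rewrite /current.
  case: (boolP (i \in A)) => iA; rewrite ?mul0r // !mul1r ebl /moment_sol.
  (* No hole precedes site 1, so its factor is [a], which the extraction rate [a^-1] cancels. *)
  rewrite (moment_num_rest iA) (_ : holes_before A i = 0%N); last first.
    by apply: eq_card0 => k; rewrite !inE i0.
  by rewrite addr0 !mulrA mulVf ?mul1r // gt_eqF.
set r := (X in _ + X = 0).
suff -> : r = (\sum_(i : 'I_N | i.+1 == N) current A i) / moment_den #|A| by ring.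
rewrite /r mulr_suml; apply: eq_bigr => i /eqP iN; rewrite /current.
case: (boolP (i \in A)) => iA; rewrite ?mul0r // !mul1r ibr /moment_sol.
have restE : moment_num (A :\ i) = rest A i.
  apply: eq_bigr => k; rewrite !inE => /andP[ki kA]; congr (_ + _%:R).
  apply: holes_before_set => l lk; rewrite !inE -val_eqE /= ltn_eqF //.
  apply: leq_trans lk _; rewrite -ltnS iN; exact: ltn_ord.
(* All [N - #|A|] holes precede the last site. The last factor N + a + b - |A| of the denominator
   exceeds the factor a + N - |A| of that site by exactly [b], which the injection rate [b^-1]
   cancels; this dictates the form of [moment_den]. *)
have hE : holes_before A i = (N - #|A|)%N.
  rewrite -[X in (X - _)%N]card_ord -(cardsC A) addKn; apply: eq_card => k.
  rewrite !inE; apply: andb_idl => kA; rewrite ltn_neqAle -ltnS iN ltn_ord andbT.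
  by apply: contraNneq kA => /val_inj ->.
have cE := cardsD1 i A; rewrite iA add1n in cE.
have hR : (holes_before A i)%:R = N%:R - #|A|%:R :> R by rewrite hE natrB.
rewrite restE (moment_num_rest iA) hR; rewrite cE in AN D0 *.
have Dp := moment_den_gt0 (ltnW AN).
move: D0; rewrite /moment_den big_ord_recr /= -/(moment_den _) pmulr_rgt0 // => cp.
by move: cp; rewrite mulrS => cp; field; rewrite !gt_eqF.
Qed.

Variables (bl br : boundary_rates R) (P : config N -> R).
Hypotheses (ibl : injection bl = 0) (ebr : extraction br = 0).
Hypotheses (ebl : extraction bl = a^-1) (ibr : injection br = b^-1).

Lemma ssep_moment A : ssep_invariant bl br P ->
  expectation_of P (@occ R N A) = moment_num A / moment_den #|A|.
Proof.
move=> invP; have [_ P1 _] := invP.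
apply: (@ssep_dual_unique R N bl br _ _ (fun A => expectation_of P (@occ R N A)) moment_sol).
- by rewrite ebl invr_gt0.
- by rewrite ibr invr_gt0.
- rewrite moment_sol0 -[RHS]P1; apply: eq_bigr => t _.
  by rewrite /occ big_set0 mulr1.
- by move=> B; apply: stationary_dual.
- by move=> B; apply: moment_sol_dual.
Qed.

Lemma moment_num0 : moment_num set0 = 1.
Proof. by rewrite /moment_num big_set0. Qed.

Lemma moment_numU1 A i : (forall j, j \in A -> (j < i)%N) ->
  moment_num (i |: A) = (a + i%:R - #|A|%:R) * moment_num A.
Proof.
move=> Ai; have iA : i \notin A by apply/negP => /Ai; rewrite ltnn.
have ci : #|[set k : 'I_N | (k < i)%N]| = i by rewrite card_ord_lt // ltnW.
have sA : A \subset [set k : 'I_N | (k < i)%N].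
  by apply/subsetP => k /Ai; rewrite inE.
have Ai' : (#|A| <= i)%N by rewrite -[X in (_ <= X)%N]ci subset_leq_card.
rewrite (moment_num_rest (setU11 i A)) /rest setU1K //; congr (_ * _).
  rewrite -addrA -natrB //; congr (_ + _%:R).
  rewrite -[in RHS]ci -cardsDS //; apply: eq_card => k; rewrite !inE -val_eqE /=.
  by rewrite [RHS]andbC; apply: andb_id2l => ki; rewrite ltn_eqF.
apply: eq_bigr => k kA; congr (_ + _%:R); apply: holes_before_set => l lk.
by rewrite !inE -val_eqE /= ltn_eqF // (ltn_trans lk) // Ai.
Qed.

End ExplicitMoments.

(** * Rescaled cumulants of finitely many sites *)

Section FiniteSize.
Variables (R : realType) (bl br : boundary_rates R) (a b : R) (N n : nat).
Hypotheses (a_gt0 : 0 < a) (b_gt0 : 0 < b).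
Hypotheses (ibl : injection bl = 0) (ebr : extraction br = 0).
Hypotheses (ebl : extraction bl = a^-1) (ibr : injection br = b^-1).
Variables (P : config N -> R) (s : 'I_n -> nat).
Hypothesis invP : ssep_invariant bl br P.
Hypotheses (s_inj : injective s) (s_gt0 : forall i, (0 < s i)%N)
  (s_le : forall i, (s i <= N)%N) (N_large : (n.*2 <= N)%N) (N_gt0 : (0 < N)%N).

Lemma site_proof i : ((s i).-1 < N)%N.
Proof. by rewrite prednK. Qed.

Definition site i : 'I_N := Ordinal (site_proof i).

Lemma site_inj : injective site.
Proof.
move=> i j /(congr1 val) /= E; apply: s_inj.
by have := congr1 S E; rewrite !prednK.
Qed.

Definition site_moment : setfun R 'I_n := [ffun A : {set 'I_n} =>
  expectation_of P (fun w => \prod_(i in A) occupation R (s i) w)].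

Lemma occupation_site i t : occupation R (s i) t = (t (site i))%:R.
Proof.
rewrite /occupation (big_pred1 (site i)) // => k; apply/eqP/eqP => [ki|->] /=.
  by apply/val_inj; rewrite /= -ki.
by rewrite prednK.
Qed.

Lemma site_momentE A : site_moment A =
  moment_num a (site @: A) / moment_den N a b #|A|.
Proof.
rewrite ffunE -(card_imset _ site_inj) -(ssep_moment a_gt0 b_gt0 ibl ebr ebl ibr _ invP).
apply: eq_bigr => t _; congr (_ * _); rewrite /occ big_imset /=.
  by apply: eq_bigr => i _; rewrite occupation_site.
by move=> i j _ _; exact: site_inj.
Qed.

Definition height i : R := a + (s i)%:R - 1.

(** The minimum is taken of [height i / N], the quantities that converge. The default [1 + a] bounds
    (s i + a - 1) / N from above, so on a nonempty set it never wins. *)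
Definition scaled_min (A : {set 'I_n}) : R :=
  N%:R * \big[Num.min/(1 + a)]_(i in A) (height i / N%:R).

Let NR_gt0 : 0 < N%:R :> R. Proof. by rewrite ltr0n. Qed.

Lemma heightE i : height i = a + (site i)%:R.
Proof. by rewrite /height -[in LHS](prednK (s_gt0 i)) -natr1 /=; ring. Qed.

Lemma height_inj : injective height.
Proof.
move=> i j; rewrite !heightE => /addrI/eqP; rewrite eqr_nat => /eqP/val_inj.
exact: site_inj.
Qed.

Lemma scaled_min1 i : scaled_min [set i] = height i.
Proof.
rewrite /scaled_min bigmin_set1 min_l; first by rewrite mulrC divfK // gt_eqF.
rewrite ler_pdivrMr // /height.
have : (s i)%:R <= N%:R :> R by rewrite ler_nat.
have : 1 <= N%:R :> R by rewrite ler1n.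
by move: a_gt0; nra.
Qed.

Lemma scaled_minU1 (B : {set 'I_n}) i : B != set0 ->
  (forall j, j \in B -> height j < height i) -> scaled_min (i |: B) = scaled_min B.
Proof.
move=> /set0Pn[j jB] Bi; congr (_ * _); rewrite bigminU bigmin_set1 min_r //.
rewrite le_min bigmin_le_id andbT; apply: le_trans (bigmin_le_cond _ _ jB) _.
by rewrite ler_pM2r ?invr_gt0 // ltW // Bi.
Qed.

Definition scaled_weight : setfun R 'I_n :=
  [ffun A : {set 'I_n} => euler (min_cumulant scaled_min) A / N%:R].
Definition site_cumulant : setfun R 'I_n := [ffun A : {set 'I_n} => cumulant site_moment A].
(** N^(|A|-1) |A| kappa(A), with the power of N from the definition of psi; it is split as N^|A| / N
    to avoid a truncated exponent at the empty set. *)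
Definition scaled_eta : setfun R 'I_n :=
  [ffun A : {set 'I_n} => N%:R ^+ #|A| / N%:R * euler site_cumulant A].

Lemma scaled_cumulants : exists u : nat -> setfun R 'I_n,
  [/\ u 0%N = 1,
   forall A : {set 'I_n}, scaled_eta A =
     \sum_(B : {set 'I_n} | B \subset A) scaled_weight B * u #|B| (A :\: B) &
   forall c (A : {set 'I_n}), (c < #|'I_n|)%N -> u c.+1 A =
     N%:R / (N%:R + a + b - c.+1%:R - #|A|%:R) * (u c A + (scaled_eta * u c.+1) A)].
Proof.
pose G : setfun R 'I_n := [ffun A : {set 'I_n} => moment_num a (site @: A)].
pose d k := (moment_den N a b k)^-1.
have factor_gt0 k : (k <= n.*2)%N -> 0 < N%:R + a + b - k%:R :> R.
  move=> kn; have : (k%:R : R) <= N%:R by rewrite ler_nat (leq_trans kn).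
  by move: a_gt0 b_gt0; lra.
have d0 : d 0%N = 1 by rewrite /d /moment_den big_ord0 invr1.
have dE k : (k < #|'I_n|.*2)%N -> (N%:R + a + b - k.+1%:R) * d k.+1 = d k.
  rewrite card_ord => kn; rewrite /d /moment_den big_ord_recr /= invfM mulrCA.
  by rewrite divff ?mulr1 // gt_eqF // factor_gt0.
have G0 : G set0 = 1 by rewrite ffunE imset0 moment_num0.
have eG : euler G = euler (min_cumulant scaled_min) * G.
  apply: (euler_falling height_inj scaled_min1 scaled_minU1) => // B i iB Bi.
  rewrite !ffunE imsetU1 moment_numU1 => [|_ /imsetP[j jB ->]].
    by rewrite heightE card_imset //; exact: site_inj.
  by have := Bi j jB; rewrite !heightE ltrD2l ltr_nat.
have E0 : site_moment set0 = 1.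
  by rewrite site_momentE imset0 moment_num0 cards0 /moment_den big_ord0 divr1.
have eF : euler [ffun A : {set 'I_n} => G A * d (#|A| + 0)%N] =
   euler site_cumulant * [ffun A : {set 'I_n} => G A * d (#|A| + 0)%N].
  have -> : [ffun A : {set 'I_n} => G A * d (#|A| + 0)%N] = site_moment.
    by apply/ffunP => A; rewrite site_momentE !ffunE addn0.
  exact: euler_cumulant.
have [v [v0 vE vS]] := quotient_cumulants d0 dE G0 eG eF.
(* With the normalization N^(c + |A|), the powers of N at [B] and [A :\: B] combine to the one at
   [A]; in the recursion on [c] one factor N is left over, against the denominator. *)
exists (fun c => [ffun A : {set 'I_n} => N%:R ^+ (c + #|A|) * v c A]); split.
- apply/ffunP => A; rewrite ffunE v0 !setfun_1E.
  by have [->|] := eqVneq A set0; rewrite ?cards0 ?mulr1 ?mulr0.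
- move=> A; rewrite ffunE vE mulr_sumr; apply: eq_bigr => B BA.
  rewrite ![in RHS]ffunE cardsDS // subnKC ?subset_leq_card // !ffunE; ring.
move=> c A cn; rewrite [LHS]ffunE.
have := vS c A cn; rewrite setfun_mulE [X in _ = _ * (X + _)]ffunE setfun_mulE.
set Sv := \sum_(B | _) _; set Sw := \sum_(B | _) _ => vSE.
have SE : Sw = N%:R ^+ (c + #|A|) * Sv.
  rewrite /Sw /Sv mulr_sumr; apply: eq_bigr => B BA.
  rewrite [scaled_eta B]ffunE [X in _ * X = _]ffunE cardsDS //.
  have -> : (c + #|A|)%N = (#|B| + (c + (#|A| - #|B|)))%N.
    by have := subset_leq_card BA; lia.
  rewrite addSn exprD exprS; field; by rewrite gt_eqF.
have f0 : N%:R + a + b - c.+1%:R - #|A|%:R != 0 :> R.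
  rewrite gt_eqF // -addrA -opprD -natrD factor_gt0 //.
  rewrite -addnn; apply: leq_add; first by rewrite card_ord in cn.
  by rewrite -[X in (_ <= X)%N]card_ord max_card.
rewrite SE -mulrDr -vSE addSn exprS; field.
by move: f0; rewrite -natr1 [1 + _]addrC.
Qed.

End FiniteSize.

Lemma joint_cumulantE (R : comPzRingType) (T : Type) (E : (T -> R) -> R) n
    (X : 'I_n -> T -> R) :
  joint_cumulant E X =
  cumulant (fun A : {set 'I_n} => E (fun w => \prod_(i in A) X i w)) [set: 'I_n].
Proof. by []. Qed.

Definition block_weight (R : realType) n (x : 'I_n -> R) : setfun R 'I_n :=
  euler (min_cumulant (fun A : {set 'I_n} => \big[Num.min/1]_(i in A) x i)).

Lemma block_weight0 (R : realType) n (x : 'I_n -> R) : block_weight x set0 = 0.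
Proof. exact: euler0. Qed.

(** Reconciles the default [1 + a] of the finite chain with the default 1 of the limit. *)
Lemma bigmin_default (R : realDomainType) n (x : 'I_n -> R) (A : {set 'I_n}) (c d : R) :
  A != set0 -> (forall i, x i <= c) -> (forall i, x i <= d) ->
  \big[Num.min/c]_(i in A) x i = \big[Num.min/d]_(i in A) x i.
Proof.
by move=> /set0Pn[i iA] xc xd; rewrite !(bigmin_eq_arg _ _ _ _ iA).
Qed.

(** * Polynomials in the minima over blocks *)

Section BlockExpansion.
Variables (R : comPzRingType) (I : finType) (X : Type).
Variables (b : {set I} -> X -> R) (m : {set I} -> R).
Implicit Types (A B : {set I}) (f g : X -> R).

(** Links a function [f] of the points to the number [v] obtained by replacing [b B] by [m B] in one
    and the same expansion. With block minima for [b], moments for [m] and the full index set for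
    [A], this [v] is the integral of [f] against the test functions. *)
Definition block_expansion A f v := exists c : {set {set I}} -> R,
  (forall x, f x = \sum_(P : {set {set I}} | partition P A) c P * \prod_(B in P) b B x) /\
  v = \sum_(P : {set {set I}} | partition P A) c P * \prod_(B in P) m B.

Lemma block_expansion_ext A f g v : f =1 g -> block_expansion A f v -> block_expansion A g v.
Proof. by move=> fg [c [cf cv]]; exists c; split=> // x; rewrite -fg. Qed.

Lemma block_expansion0 A : block_expansion A (fun=> 0) 0.
Proof.
by exists (fun=> 0); split=> [x|]; rewrite big1 // => P _; rewrite mul0r.
Qed.

Lemma block_expansionD A f g v w : block_expansion A f v -> block_expansion A g w ->
  block_expansion A (fun x => f x + g x) (v + w).
Proof.
move=> [c [cf ->]] [d [dg ->]]; exists (fun P => c P + d P); split=> [x|].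
  by rewrite cf dg -big_split; apply: eq_bigr => P _; rewrite /= mulrDl.
by rewrite -big_split; apply: eq_bigr => P _; rewrite /= mulrDl.
Qed.

Lemma block_expansion_sum A (J : Type) (s : seq J) (Q : pred J) (f : J -> X -> R) (v : J -> R) :
  (forall j, Q j -> block_expansion A (f j) (v j)) ->
  block_expansion A (fun x => \sum_(j <- s | Q j) f j x) (\sum_(j <- s | Q j) v j).
Proof.
move=> fv; elim: s => [|j s IH].
  rewrite big_nil; apply: block_expansion_ext (block_expansion0 A) => x.
  by rewrite big_nil.
rewrite big_cons; case: ifP => Qj.
  apply: block_expansion_ext (block_expansionD (fv j Qj) IH) => x.
  by rewrite big_cons Qj.
by apply: block_expansion_ext IH => x; rewrite big_cons Qj.
Qed.

Lemma block_expansionZ A a f v : block_expansion A f v ->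
  block_expansion A (fun x => a * f x) (a * v).
Proof.
move=> [c [cf ->]]; exists (fun P => a * c P); split=> [x|].
  by rewrite cf mulr_sumr; apply: eq_bigr => P _; rewrite mulrA.
by rewrite mulr_sumr; apply: eq_bigr => P _; rewrite mulrA.
Qed.

Lemma block_expansion1 : block_expansion set0 (fun=> 1) 1.
Proof.
exists (fun=> 1); split=> [x|]; rewrite (big_pred1 set0) ?big_set0 ?mulr1 //;
by move=> P; rewrite partition_set0.
Qed.

Lemma block_expansion_block B : B != set0 -> block_expansion B (b B) (m B).
Proof.
move=> B0; have pB : partition [set B] B.
  by rewrite /partition cover1 eqxx trivIset1 inE eq_sym.
exists (fun P => (P == [set B])%:R); split=> [x|];
  rewrite (bigD1 [set B]) //= eqxx mul1r big_set1 big1 ?addr0 // => P /andP[_ /negbTE ->];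
  by rewrite mul0r.
Qed.

(** A partition with a block meeting both sets gets coefficient zero; the others are pairs of
    partitions. Disjointness is what makes products compatible with replacing [b] by [m]. *)
Lemma block_expansionM A A' f g v w : [disjoint A & A'] ->
  block_expansion A f v -> block_expansion A' g w ->
  block_expansion (A :|: A') (fun x => f x * g x) (v * w).
Proof.
move=> dA [c [cf ->]] [d [dg ->]].
exists (fun Q : {set {set I}} => if [forall C in Q, (C \subset A) || (C \subset A')]
   then c (Q ::&: A) * d (Q ::&: A') else 0).
have E (F : {set I} -> R) :
  \sum_(P : {set {set I}} | partition P (A :|: A'))
    (if [forall C in P, (C \subset A) || (C \subset A')]
     then c (P ::&: A) * d (P ::&: A') else 0) * \prod_(B in P) F B =
  (\sum_(P : {set {set I}} | partition P A) c P * \prod_(B in P) F B) *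
  (\sum_(P : {set {set I}} | partition P A') d P * \prod_(B in P) F B).
  transitivity (\sum_(P : {set {set I}} | partition P (A :|: A') &&
      [forall C in P, (C \subset A) || (C \subset A')])
     c (P ::&: A) * d (P ::&: A') * \prod_(B in P) F B).
    rewrite [RHS]big_mkcondr /=; apply: eq_bigr => P _.
    by case: ifP => // _; rewrite mul0r.
  rewrite big_partition_setU // mulr_suml; apply: eq_bigr => P1 p1.
  rewrite mulr_sumr; apply: eq_bigr => P2 p2.
  rewrite (partition_setUK dA p1 p2) [P1 :|: P2]setUC.
  rewrite (@partition_setUK _ A' A P2 P1) 1?disjoint_sym // setUC.
  rewrite (eq_bigl [predU P1 & P2]) => [|C]; last by rewrite !inE.
  rewrite bigU /=; first ring.
  rewrite -setI_eq0; apply/eqP/setP => C; rewrite !inE; apply/negP => /andP[C1 C2].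
  case/set0Pn: (partition_neq0 p1 C1) => x xC.
  have := disjointFr dA (subsetP (partitionS p1 C1) x xC).
  by rewrite (subsetP (partitionS p2 C2) x xC).
by split=> [x|]; rewrite ?cf ?dg E.
Qed.

Variables (T H : X -> setfun R I) (U : X -> nat -> setfun R I).
Variables (Tm Hm : setfun R I) (Um : nat -> setfun R I).
Variable w : {set I} -> R.
Hypothesis w0 : w set0 = 0.
Hypothesis TE : forall x B, T x B = w B * b B x.
Hypothesis TmE : forall B, Tm B = w B * m B.
Hypotheses (U0 : forall x, U x 0%N = 1) (Um0 : Um 0%N = 1).
Hypothesis US : forall x c, U x c.+1 = U x c + H x * U x c.+1.
Hypothesis UmS : forall c, Um c.+1 = Um c + Hm * Um c.+1.
Hypothesis HE : forall x A, H x A =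
  \sum_(B : {set I} | B \subset A) T x B * U x #|B| (A :\: B).
Hypothesis HmE : forall A, Hm A =
  \sum_(B : {set I} | B \subset A) Tm B * Um #|B| (A :\: B).

(** Both systems obey the same recursion on the size of [A], and every product in it is over the
    disjoint sets [B] and [A :\: B]. *)
Lemma block_expansion_system k A : (#|A| < k)%N ->
  block_expansion A (fun x => H x A) (Hm A) /\
  forall c, block_expansion A (fun x => U x c A) (Um c A).
Proof.
elim: k A => // k IH A; rewrite ltnS => Ak.
have small B : B \subset A -> B != set0 -> (#|A :\: B| < k)%N.
  move=> BA B0; apply: leq_trans Ak.
  rewrite cardsDS // ltn_subrL card_gt0 B0 (leq_trans _ (subset_leq_card BA)) //.
  by rewrite card_gt0.
have split B f g v u : B \subset A -> block_expansion B f v ->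
    block_expansion (A :\: B) g u -> block_expansion A (fun x => f x * g x) (v * u).
  move=> BA fv gu; have -> : A = B :|: A :\: B.
    by rewrite setDE setUIr setUCr setIT (setUidPr BA).
  by apply: block_expansionM => //; rewrite disjoints_subset setDE setCI setCK subsetUr.
have EH : block_expansion A (fun x => H x A) (Hm A).
  rewrite HmE; apply: (@block_expansion_ext _ (fun x =>
    \sum_(B : {set I} | B \subset A) T x B * U x #|B| (A :\: B))) => [x|].
    by rewrite HE.
  apply: block_expansion_sum => B BA; have [->|B0] := eqVneq B set0.
    rewrite TmE w0 !mul0r; apply: block_expansion_ext (block_expansion0 A) => x.
    by rewrite TE w0 !mul0r.
  apply: (split B (fun x => T x B) (fun x => U x #|B| (A :\: B)) _ _ BA); last first.
    by have [_] := IH _ (small _ BA B0); apply.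
  rewrite TmE; apply: (@block_expansion_ext _ (fun x => w B * b B x)) => [x|].
    by rewrite TE.
  exact/block_expansionZ/block_expansion_block.
have H00 x : H x set0 = 0.
  rewrite HE big1 // => B; rewrite subset0 => /eqP ->.
  by rewrite TE w0 !mul0r.
have Hm00 : Hm set0 = 0.
  by rewrite HmE big1 // => B; rewrite subset0 => /eqP ->; rewrite TmE w0 !mul0r.
split=> //; elim=> [|c IHc].
  rewrite Um0 setfun_1E; apply: (@block_expansion_ext _ (fun=> (A == set0)%:R)).
    by move=> x; rewrite U0 setfun_1E.
  have [->|_] := eqVneq A set0; [exact: block_expansion1|exact: block_expansion0].
rewrite UmS [X in block_expansion _ _ X]ffunE setfun_mulE.
apply: (@block_expansion_ext _ (fun x => U x c A +
   \sum_(B : {set I} | B \subset A) H x B * U x c.+1 (A :\: B))) => [x|].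
  by rewrite [in RHS]US [RHS]ffunE setfun_mulE.
apply: block_expansionD => //; apply: block_expansion_sum => B BA.
have [->|B0] := eqVneq B set0.
  rewrite Hm00 mul0r; apply: block_expansion_ext (block_expansion0 A) => x.
  by rewrite H00 mul0r.
apply: (split B (fun x => H x B) (fun x => U x c.+1 (A :\: B)) _ _ BA); last first.
  by have [_] := IH _ (small _ BA B0); apply.
have [->//|BneA] := eqVneq B A.
have BAp : (#|B| < k)%N.
  by apply: leq_trans Ak; apply: proper_card; rewrite properEneq BneA.
by have [] := IH _ BAp.
Qed.

End BlockExpansion.

From mathcomp Require Import all_classical all_reals all_analysis.
From mathcomp Require Import measurable_realfun.

Import numFieldNormedType.Exports.

Local Open Scope classical_set_scope.

(** * Scaling limit of the cumulants *)

Lemma cvg_near_eq (R : realType) (f g : nat -> R) (l : R) :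
  (\forall N \near \oo, f N = g N) -> g @ \oo --> l -> f @ \oo --> l.
Proof. by move=> fg; apply: cvg_trans; apply: near_eq_cvg; apply: filterS fg. Qed.

Lemma cvgn_sum (R : realType) (J : Type) (s : seq J) (P : pred J)
    (f : J -> nat -> R) (l : J -> R) :
  (forall j, P j -> f j @ \oo --> l j) ->
  (fun N => \sum_(j <- s | P j) f j N) @ \oo --> \sum_(j <- s | P j) l j.
Proof.
move=> fl; apply: (@cvg_big R^o J +%R 0 P) => //; exact: add_continuous.
Qed.

Section Convergence.
Variables (R : realType) (I : finType).
Variables (T H : setfun R I) (U : nat -> setfun R I).
Hypotheses (T0 : T finset.set0 = 0) (H0 : H finset.set0 = 0) (U0 : U 0%N = 1).
Hypothesis US : forall c, U c.+1 = U c + H * U c.+1.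
Hypothesis HE : forall A : {set I}, H A =
  \sum_(B : {set I} | B \subset A) T B * U #|B| (A :\: B).
Variables (tau eta : nat -> setfun R I) (u : nat -> nat -> setfun R I).
Variable r : nat -> nat -> nat -> R.
Hypothesis tau0 : forall N, tau N finset.set0 = 0.
Hypothesis tau_cvg : forall B, (fun N => tau N B) @ \oo --> T B.
Hypothesis r_cvg : forall c k, (fun N => r N c k) @ \oo --> (1 : R).
Hypothesis rel : \forall N \near \oo, [/\ u N 0%N = 1,
  forall A : {set I}, eta N A =
    \sum_(B : {set I} | B \subset A) tau N B * u N #|B| (A :\: B) &
  forall c (A : {set I}), (c < #|I|)%N ->
    u N c.+1 A = r N c #|A| * (u N c A + (eta N * u N c.+1) A)].

(** For given [A] the limit of [eta] comes first, from [u] on strictly smaller sets; then [u c] is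
    treated by induction on [c]. The relation for [eta] calls [u] only at [#|B|], hence the range
    [c <= #|I|]. *)
Lemma limit_system_cvg k (A : {set I}) : (#|A| < k)%N ->
  (fun N => eta N A) @ \oo --> H A /\
  forall c, (c <= #|I|)%N -> (fun N => u N c A) @ \oo --> U c A.
Proof.
elim: k A => // k IH A; rewrite ltnS => Ak.
have small (B : {set I}) : B \subset A -> B != finset.set0 -> (#|A :\: B| < k)%N.
  move=> BA B0; apply: leq_trans Ak.
  rewrite cardsDS // ltn_subrL card_gt0 B0 (leq_trans _ (subset_leq_card BA)) //.
  by rewrite card_gt0.
have eta_cvg : (fun N => eta N A) @ \oo --> H A.
  apply: (@cvg_near_eq _ _ (fun N =>
     \sum_(B : {set I} | B \subset A) tau N B * u N #|B| (A :\: B))).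
    by apply: filterS rel => N [].
  rewrite HE; apply: cvgn_sum => B BA.
  have [->|B0] := eqVneq B finset.set0.
    rewrite T0 mul0r; under eq_fun => N do rewrite tau0 mul0r.
    exact: cvg_cst.
  apply: cvgM; first exact: tau_cvg.
  by have [_] := IH _ (small _ BA B0); apply; exact: max_card.
split=> //; elim=> [_|c IHc cI].
  rewrite U0; apply: (@cvg_near_eq _ _ (fun=> (1 : setfun R I) A)); last exact: cvg_cst.
  by apply: filterS rel => N [-> _ _].
have eta0 : \forall N \near \oo, eta N finset.set0 = 0.
  apply: filterS rel => N [_ -> _]; rewrite big1 // => B.
  by rewrite finset.subset0 => /eqP ->; rewrite tau0 mul0r.
(* The term [B = set0] of the product contains the unknown [u N c.+1 A]; its coefficient vanishes,
   and it is removed before passing to the limit. *)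
apply: (@cvg_near_eq _ _ (fun N => r N c #|A| * (u N c A +
    \sum_(B : {set I} | (B \subset A) && (B != finset.set0)) eta N B * u N c.+1 (A :\: B)))).
  near=> N.
  have [_ _ ->//] : [/\ u N 0%N = 1,
    forall A : {set I}, eta N A =
      \sum_(B : {set I} | B \subset A) tau N B * u N #|B| (A :\: B) &
    forall c (A : {set I}), (c < #|I|)%N ->
      u N c.+1 A = r N c #|A| * (u N c A + (eta N * u N c.+1) A)].
    by near: N.
  rewrite setfun_mulE (bigD1 finset.set0) ?finset.sub0set //=.
  rewrite (_ : eta N finset.set0 = 0) ?mul0r ?add0r //.
  by near: N.
rewrite US [X in _ --> X]ffunE setfun_mulE (bigD1 finset.set0) ?finset.sub0set //= H0 mul0r add0r.
rewrite -[X in _ --> X]mul1r; apply: cvgM => //.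
apply: cvgD; first exact/IHc/ltnW.
apply: cvgn_sum => B /andP[BA B0]; apply: cvgM.
  have [->//|BneA] := eqVneq B A.
  have BAp : (#|B| < k)%N.
    by apply: leq_trans Ak; apply: proper_card; rewrite finset.properEneq BneA.
  by have [] := IH _ BAp.
by have [_] := IH _ (small _ BA B0); apply.
Unshelve. all: by end_near.
Qed.

End Convergence.

Section PsiLimit.
Variables (R : realType) (bl br : boundary_rates R) (a b : R) (n : nat).
Hypotheses (a_gt0 : 0 < a) (b_gt0 : 0 < b).
Hypotheses (ibl : injection bl = 0) (ebr : extraction br = 0).
Hypotheses (ebl : extraction bl = a^-1) (ibr : injection br = b^-1).
Variable P : forall N, config N -> R.
Hypothesis hP : forall N, (0 < N)%N -> ssep_invariant bl br (@P N).
Variable x : 'I_n -> R.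
Hypotheses (x_inj : injective x) (x_gt0 : forall i, 0 < x i) (x_le1 : forall i, x i <= 1).

Let s N i := Num.truncn (x i * N%:R).

Lemma cvgn_invr : (fun N : nat => (N%:R : R)^-1) @ \oo --> (0 : R).
Proof.
apply/gtr0_cvgV0; last exact: cvgr_idn.
by near=> N; rewrite ltr0n; near: N; exact: nbhs_infty_gt.
Unshelve. all: by end_near. Qed.

Lemma cvgn_affine (c : R) : (fun N : nat => (N%:R + c) / N%:R) @ \oo --> (1 : R).
Proof.
apply: (@cvg_near_eq _ _ (fun N => 1 + c * N%:R^-1)).
  near=> N; rewrite mulrDl divff // gt_eqF // ltr0n; near: N; exact: nbhs_infty_gt.
rewrite -[X in _ --> X]addr0 -(mulr0 c); apply: cvgD; first exact: cvg_cst.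
by apply: cvgM; [exact: cvg_cst|exact: cvgn_invr].
Unshelve. all: by end_near. Qed.

Lemma site_cvg i : (fun N => (s N i)%:R / N%:R) @ \oo --> x i.
Proof.
have lo : (fun N : nat => x i - N%:R^-1) @ \oo --> x i.
  rewrite -[X in _ --> X]subr0; apply: cvgB; [exact: cvg_cst|exact: cvgn_invr].
apply: (squeeze_cvgr _ lo (@cvg_cst _ (x i) _ \oo _)).
near=> N.
have N0 : 0 < N%:R :> R by rewrite ltr0n; near: N; exact: nbhs_infty_gt.
have /andP[s1 s2] : (s N i)%:R <= x i * N%:R < (s N i).+1%:R.
  by rewrite truncn_itv // mulr_ge0 // ltW.
rewrite ler_pdivlMr // ler_pdivrMr // s1 andbT mulrBl mulVf ?gt_eqF //.
by rewrite lerBlDr natr1 ltW.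
Unshelve. all: by end_near. Qed.

(** Positivity of the coordinates lifts every position above 0, and the midpoint of two distinct
    coordinates separates their sites once N is large. *)
Lemma sites_good : \forall N \near \oo, [/\ injective (s N), forall i, (0 < s N i)%N,
  forall i, (s N i <= N)%N, (n.*2 <= N)%N & (0 < N)%N].
Proof.
have inj : \forall N \near \oo, forall i j : 'I_n, i != j -> s N i != s N j.
  apply: filter_forall => i; apply: filter_forall => j.
  have [->|ij] := eqVneq i j; first by apply: nearW => N; rewrite eqxx.
  wlog xij : i j ij / x i < x j.
    move=> W; have := ij; rewrite -(inj_eq x_inj) neq_lt => /orP[|xji]; first exact: W.
    have := W j i; rewrite eq_sym => /(_ ij xji).
    by apply: filterS => N; rewrite eq_sym [s N i == _]eq_sym.
  have m1 : x i < (x i + x j) / 2 by lra.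
  have m2 : (x i + x j) / 2 < x j by lra.
  near=> N => _; apply/eqP => sij.
  have : (s N i)%:R / N%:R < (x i + x j) / 2.
    by near: N; exact: (cvgr_lt _ (site_cvg (i:=i))).
  have : (x i + x j) / 2 < (s N j)%:R / N%:R.
    by near: N; exact: (cvgr_gt _ (site_cvg (i:=j))).
  by rewrite sij; lra.
have pos : \forall N \near \oo, forall i : 'I_n, (0 < s N i)%N.
  apply: filter_forall => i; near=> N; rewrite truncn_gt0 -ler_pdivrMl // mulr1.
  by near: N; exact: nbhs_infty_ger.
near=> N; split.
- move=> i j sij; apply/eqP/negPn/negP => ij; move: sij; apply/eqP.
  by move: i j ij; near: N.
- by near: N.
- move=> i; rewrite -(ler_nat R) (@le_trans _ _ (x i * N%:R)) //.
    by rewrite truncn_le mulr_ge0 // ltW.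
  by rewrite -[leRHS]mul1r ler_wpM2r.
- by near: N; exact: nbhs_infty_ge.
- by near: N; exact: nbhs_infty_gt.
Unshelve. all: by end_near. Qed.

Variables (H : setfun R 'I_n) (U : nat -> setfun R 'I_n).
Hypotheses (H0 : H finset.set0 = 0) (U0 : U 0%N = 1).
Hypothesis US : forall c, U c.+1 = U c + H * U c.+1.
Hypothesis HE : forall A : {set 'I_n}, H A =
  \sum_(B : {set 'I_n} | B \subset A) block_weight x B * U #|B| (A :\: B).

Lemma psi_limit : (0 < n)%N ->
  (fun N : nat => N%:R ^+ n.-1 *
      joint_cumulant (expectation_of (@P N)) (fun i => @occupation R N (s N i))) @ \oo -->
  H finset.setT / n%:R.
Proof.
move=> n0.
pose tauN N := scaled_weight a N (s N).
pose etaN N := scaled_eta (@P N) (s N).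
pose rN (N c k : nat) : R := N%:R / (N%:R + a + b - c.+1%:R - k%:R).
have [u hu] : exists u : nat -> nat -> setfun R 'I_n, \forall N \near \oo, [/\ u N 0%N = 1,
  forall A : {set 'I_n}, etaN N A =
    \sum_(B : {set 'I_n} | B \subset A) tauN N B * u N #|B| (A :\: B) &
  forall c (A : {set 'I_n}), (c < #|'I_n|)%N ->
    u N c.+1 A = rN N c #|A| * (u N c A + (etaN N * u N c.+1) A)].
  (* The auxiliary series are available for good N only; stating existence as an implication allows
     a single choice of [u] for all N. *)
  have ex N : exists v : nat -> setfun R 'I_n,
    [/\ injective (s N), forall i, (0 < s N i)%N,
      forall i, (s N i <= N)%N, (n.*2 <= N)%N & (0 < N)%N] ->
    [/\ v 0%N = 1,
     forall A : {set 'I_n}, etaN N A =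
       \sum_(B : {set 'I_n} | B \subset A) tauN N B * v #|B| (A :\: B) &
     forall c (A : {set 'I_n}), (c < #|'I_n|)%N ->
       v c.+1 A = rN N c #|A| * (v c A + (etaN N * v c.+1) A)].
    have [[h1 h2 h3 h4 h5]|bad] := pselect [/\ injective (s N), forall i, (0 < s N i)%N,
      forall i, (s N i <= N)%N, (n.*2 <= N)%N & (0 < N)%N]; last by exists (fun=> 0).
    have [v hv] := scaled_cumulants a_gt0 b_gt0 ibl ebr ebl ibr (hP h5) h1 h2 h3 h4 h5.
    by exists v.
  have [u hu] := choice ex; exists u; apply: filterS sites_good => N; exact: hu.
have tau0 N : tauN N finset.set0 = 0 by rewrite /tauN ffunE euler0 mul0r.
have height_cvg i : (fun N => height a (s N) i / N%:R) @ \oo --> x i.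
  have -> : (fun N => height a (s N) i / N%:R) =
      (fun N => (s N i)%:R / N%:R + (a - 1) * N%:R^-1).
    by apply/funext => N; rewrite /height; ring.
  rewrite -[X in _ --> X]addr0 -(mulr0 (a - 1)); apply: cvgD; first exact: site_cvg.
  by apply: cvgM; [exact: cvg_cst|exact: cvgn_invr].
have tau_cvg B : (fun N => tauN N B) @ \oo --> block_weight x B.
  have [->|B0] := eqVneq B finset.set0.
    by rewrite block_weight0; under eq_fun => N do rewrite tau0; exact: cvg_cst.
  apply: (@cvg_near_eq _ _ (fun N => #|B|%:R * ((-1) ^+ #|B|.-1 * (#|B|.-1)`!%:R *
      \big[Num.min/(1 + a)]_(i in B) (height a (s N) i / N%:R)))).
    near=> N; rewrite /tauN !ffunE /scaled_min.
    have N0 : N%:R != 0 :> R by rewrite pnatr_eq0 -lt0n; near: N; exact: nbhs_infty_gt.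
    by field.
  rewrite /block_weight !ffunE; apply: cvgM; first exact: cvg_cst.
  apply: cvgM; first exact: cvg_cst.
  rewrite (@bigmin_default _ _ x B 1 (1 + a)) //; last first.
    by move=> i; apply: le_trans (x_le1 i) _; rewrite lerDl ltW.
  apply: (@cvg_big R^o _ Num.min) => //.
  exact: min_continuous.
have r_cvg c k : (fun N => rN N c k) @ \oo --> (1 : R).
  have -> : (fun N => rN N c k) =
      (fun N => ((N%:R + (a + b - c.+1%:R - k%:R)) / N%:R)^-1).
    by apply/funext => N; rewrite /rN invf_div !addrA.
  rewrite -[X in _ --> X]invr1; apply: cvgV; [exact: oner_neq0|exact: cvgn_affine].
have [etaT _] := limit_system_cvg (block_weight0 x) H0 U0 US HE tau0 tau_cvg r_cvg hu
  (ltnSn #|finset.setT : {set 'I_n}|).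
apply: (@cvg_near_eq _ _ (fun N => etaN N finset.setT * n%:R^-1)); last first.
  by apply: cvgM => //; exact: cvg_cst.
near=> N; rewrite joint_cumulantE /etaN /scaled_eta !ffunE cardsT card_ord.
have N0 : N%:R != 0 :> R by rewrite pnatr_eq0 -lt0n; near: N; exact: nbhs_infty_gt.
have -> : cumulant (site_moment (@P N) (s N)) finset.setT =
    cumulant (fun A : {set 'I_n} => expectation_of (@P N)
      (fun w => \prod_(i in A) occupation R (s N i) w)) finset.setT.
  rewrite /cumulant; apply: eq_bigr => Q _; congr (_ * _).
  by apply: eq_bigr => B _; rewrite ffunE.
have n0' : n%:R != 0 :> R by rewrite pnatr_eq0 -lt0n.
(* [euler] multiplies the cumulant at the full set by n, whence the division by n; N^(n-1) is N^n /
   N. *)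
rewrite -[in X in _ = X / _ * _ * _](prednK n0) exprS; field.
by apply/andP.
Unshelve. all: by end_near. Qed.

End PsiLimit.

(** * Integration over the cube *)

Lemma bounded_integrable (R : realType) d (T : measurableType d) (m : measure T R) (D : set T)
    (g : T -> R) (B : R) :
  measurable D -> (m D < +oo)%E -> measurable_fun D g ->
  (forall x, D x -> `|g x| <= B) -> m.-integrable D (EFin \o g).
Proof.
move=> mD Doo mg gB; apply: measurable_bounded_integrable => //.
by exists B; split; [exact: num_real|move=> M /ltW BM x Dx; exact: le_trans (gB x Dx) BM].
Qed.

Section BoundedFubini.
Context d1 d2 (T1 : measurableType d1) (T2 : measurableType d2) (R : realType).
Variables (m1 : {sigma_finite_measure set T1 -> \bar R})
  (m2 : {sigma_finite_measure set T2 -> \bar R}).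
Variables (D1 : set T1) (D2 : set T2) (f : T1 * T2 -> R) (C : R).
Hypotheses (mD1 : measurable D1) (mD2 : measurable D2).
Hypotheses (D1oo : (m1 D1 < +oo)%E) (D2oo : (m2 D2 < +oo)%E).
Hypothesis mf : measurable_fun setT f.
Hypothesis fC : forall x y, D1 x -> D2 y -> `|f (x, y)| <= C.

Let mDD : measurable (D1 `*` D2). Proof. exact: measurableX. Qed.

Let g := (EFin \o f) \_ (D1 `*` D2).

Lemma prod_integrable : (m1 \x m2)%E.-integrable (D1 `*` D2) (EFin \o f).
Proof.
apply: (@bounded_integrable _ _ _ _ _ _ C) => //.
- apply: (@le_lt_trans _ _ (m1 D1 * m2 D2)%E); last first.
    by rewrite lte_mul_pinfty // ge0_fin_numE.
  by rewrite le_eqVlt; apply/orP; left; apply/eqP; exact: product_measure1E.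
- exact: measurable_funTS.
- by move=> [x y] [/= Dx Dy]; exact: fC.
Qed.

Let ig : (m1 \x m2)%E.-integrable setT g.
Proof. by apply/(integrable_mkcond _ mDD); exact: prod_integrable. Qed.

Let section1_integrable x : D1 x -> m2.-integrable D2 (EFin \o (fun y => f (x, y))).
Proof.
move=> Dx; apply: (@bounded_integrable _ _ _ _ _ _ C) => //.
  by apply: measurable_funTS; apply: measurableT_comp mf _; exact: measurable_pair1.
by move=> y Dy; exact: fC.
Qed.

Let fubini_FE : fubini_F m2 g =
  (EFin \o (fun x => \int[m2]_(y in D2) f (x, y))) \_ D1.
Proof.
apply/funext => x; rewrite /fubini_F [RHS]patchE; case: ifPn => xD.
  rewrite inE in xD; rewrite /= fineK; last exact/integrable_fin_num/section1_integrable.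
  rewrite [RHS]integral_mkcond; apply: eq_integral => y _.
  rewrite /g !patchE; congr (if _ then _ else _).
  by apply/idP/idP; rewrite !inE /=; [case|split].
rewrite integral0_eq // => y _; rewrite /g patchE ifN //.
by apply: contra xD; rewrite !inE => -[].
Qed.

Lemma Rfubini1 : \int[(m1 \x m2)%E]_(z in D1 `*` D2) f z =
  \int[m1]_(x in D1) \int[m2]_(y in D2) f (x, y).
Proof.
rewrite /Rintegral; congr fine.
by rewrite integral_mkcond -(integral12_prod_meas1 ig) fubini_FE -integral_mkcond.
Qed.

Lemma section_Rintegral_integrable :
  m1.-integrable D1 (EFin \o (fun x => \int[m2]_(y in D2) f (x, y))).
Proof.
by apply/(proj2 (integrable_mkcond _ mD1)); rewrite -fubini_FE; exact: integrable_fubini_F.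
Qed.

Lemma measurable_section_Rintegral :
  measurable_fun D1 (fun x => \int[m2]_(y in D2) f (x, y)).
Proof. by apply/measurable_EFinP; have /measurable_int := section_Rintegral_integrable. Qed.

Lemma Rfubini : \int[m1]_(x in D1) \int[m2]_(y in D2) f (x, y) =
  \int[m2]_(y in D2) \int[m1]_(x in D1) f (x, y).
Proof.
have E1 : (\int[m1]_x \int[m2]_y g (x, y) =
    \int[m1]_(x in D1) (\int[m2]_(y in D2) f (x, y))%:E)%E.
  by rewrite [RHS]integral_mkcond -[in RHS]fubini_FE.
have section2_integrable y : D2 y -> m1.-integrable D1 (EFin \o (fun x => f (x, y))).
  move=> Dy; apply: (@bounded_integrable _ _ _ _ _ _ C) => //.
    by apply: measurable_funTS; apply: measurableT_comp mf _; exact: measurable_pair2.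
  by move=> x Dx; exact: fC.
rewrite /Rintegral -[in LHS]E1 (Fubini ig); congr fine.
rewrite [RHS]integral_mkcond; apply: eq_integral => y _; rewrite patchE.
case: ifPn => yD.
  rewrite inE in yD; rewrite /= fineK; last exact/integrable_fin_num/section2_integrable.
  rewrite [RHS]integral_mkcond; apply: eq_integral => x _.
  rewrite /g !patchE; congr (if _ then _ else _).
  by apply/idP/idP; rewrite !inE /=; [case|split].
rewrite integral0_eq // => x _; rewrite /g patchE ifN //.
by apply: contra yD; rewrite !inE => -[].
Qed.

End BoundedFubini.

Section TupleIntegral.
Variable R : realType.
Local Notation TR := (measurableTypeR R).
Local Notation leb := (@lebesgue_measure R).
Local Notation cube n := (@unit_cube R n).

Lemma measurable_unit_cube n : measurable (cube n).
Proof.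
have -> : cube n = \bigcap_(i in [set: 'I_n]) ((fun x : n.-tuple TR => tnth x i) @^-1` `[0, 1]).
  apply/seteqP; split => [x cx i _|x cx i]; last by have := cx i I; rewrite /= in_itv.
  by rewrite /= in_itv; exact: cx.
apply: fin_bigcap_measurable => // i _.
rewrite -[X in measurable X]setTI.
by apply: (measurable_tnth i).
Qed.

Lemma preimage_cons_cube n : @cons_pair R n @^-1` cube n.+1 = (`[0, 1] : set TR) `*` cube n.
Proof.
apply/seteqP; split => [[x t] /= c|[x t] [/= xI ct] i].
  split => [|i] /=; first by have := c ord0; rewrite (tnth_nth 0) /= in_itv.
  by have := c (lift ord0 i); rewrite !(tnth_nth 0).
rewrite in_itv /= in xI; have [->|] := eqVneq i ord0; first by rewrite (tnth_nth 0).
rewrite eq_sym => /unlift_some[j -> _]; have := ct j.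
by rewrite !(tnth_nth 0).
Qed.

Lemma lebesgue_unit_itv : leb `[0, 1] = 1%E.
Proof. by rewrite lebesgue_measure_itv /= lte_fin ltr01 oppr0 adde0. Qed.

Lemma lebesgue_unit_itv_lty : (leb `[0%R, 1%R] < +oo)%E.
Proof. by rewrite lebesgue_unit_itv ltry. Qed.

Lemma lebesgue_tuple_cube n : lebesgue_tuple R n (cube n) = 1%E.
Proof.
elim: n => [|n IH].
  rewrite /= diracE (_ : _ \in _ = true) //; apply/mem_set => i; by case: i.
rewrite /= /lebesgue_cons /pushforward preimage_cons_cube.
rewrite product_measure1E //; last exact: measurable_unit_cube.
by rewrite [X in (X * _)%E]lebesgue_unit_itv mul1e; exact: IH.
Qed.

Lemma Rintegral_cons n (f : n.+1.-tuple TR -> R) (C : R) :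
  measurable_fun setT f -> (forall x, cube n.+1 x -> `|f x| <= C) ->
  \int[lebesgue_tuple R n.+1]_(x in cube n.+1) f x =
  \int[leb]_(x in `[0, 1]) \int[lebesgue_tuple R n]_(t in cube n) f [tuple of x :: t].
Proof.
move=> mf fC.
have mcons := @measurable_cons_pair R n.
have mff : measurable_fun setT (f \o @cons_pair R n) by apply: measurableT_comp.
have fC' (x : TR) (t : n.-tuple TR) : (`[0, 1]%classic : set TR) x -> cube n t ->
    `|(f \o @cons_pair R n) (x, t)| <= C.
  move=> xI ct; apply: fC; rewrite -[X in cube _ X]/(cons_pair (x, t)).
  by rewrite -[_ (cons_pair _)]/((@cons_pair R n @^-1` cube n.+1) (x, t)) preimage_cons_cube.
have I1 := lebesgue_unit_itv_lty.
have I2 : (lebesgue_tuple R n (cube n) < +oo)%E by rewrite lebesgue_tuple_cube ltry.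
have mI : measurable (`[0, 1] : set TR) by exact: measurable_itv.
have mC := @measurable_unit_cube n.
have E := Rfubini1 mI mC I1 I2 mff fC'.
rewrite -[RHS]E /Rintegral; congr fine; rewrite -preimage_cons_cube.
have := @integral_pushforward _ _ _ _ R (@cons_pair R n) mcons (leb \x lebesgue_tuple R n)%E
  (cube n.+1) (EFin \o f).
apply.
- exact/measurable_EFinP.
- rewrite preimage_cons_cube; apply: (prod_integrable mI mC I1 I2 mff fC').
- exact: measurable_unit_cube.
Qed.

End TupleIntegral.

Lemma bigmin_minl (R : realType) (J : Type) (s : seq J) (P : pred J) (F : J -> R) z x :
  \big[Num.min/Num.min z x]_(j <- s | P j) F j = Num.min x (\big[Num.min/z]_(j <- s | P j) F j).
Proof.
elim: s => [|j s IH]; first by rewrite !big_nil minC.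
by rewrite !big_cons; case: ifP => // _; rewrite IH minCA.
Qed.

(** * Integrals of products of minima *)

Section CubeIntegral.
Variable R : realType.
Local Notation TR := (measurableTypeR R).
Local Notation leb := (@lebesgue_measure R).
Local Notation cube n := (@unit_cube R n).
Variables (a : R -> R) (M : R).
Hypotheses (ma : measurable_fun `[0 : R, 1] a) (M0 : 0 <= M)
  (aM : forall x : R, 0 <= x <= 1 -> `|a x| <= M).

(** Extension by zero: [a] is known to be measurable and bounded on the unit interval only. *)
Let at_ : TR -> R := a \_ `[0, 1].

Let mI : measurable (`[0, 1]%classic : set TR). Proof. exact: measurable_itv. Qed.
Let Ioo := lebesgue_unit_itv_lty R.

Let mat : measurable_fun setT at_.
Proof. by apply/(measurable_restrictT _ _).1. Qed.

Let atM x : `|at_ x| <= M.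
Proof.
rewrite /at_ patchE; case: ifPn => [|_]; last by rewrite normr0.
by rewrite inE /= in_itv => /aM.
Qed.

Definition tail_integral (y : R) : R := \int[leb]_(x in `[0, 1]) (at_ x * (y <= x)%R%:R).

Lemma tail_integralE y : 0 <= y -> tail_integral y = indicator_average a y.
Proof.
move=> y0; apply: eq_Rintegral => x xI; rewrite /at_ patchE xI indicE; congr (_ * _%:R).
by rewrite mem_setE in_itv /= y0.
Qed.

Let mle (d : measure_display) (T : measurableType d) (f g : T -> R) :
  measurable_fun setT f -> measurable_fun setT g ->
  measurable_fun setT (fun t => (f t <= g t)%R%:R : R).
Proof.
move=> mf mg; have -> : (fun t => (f t <= g t)%R%:R : R) = \1_[set t | f t <= g t].
  by apply/funext => t; rewrite indicE mem_setE.
apply: measurable_indic; rewrite -[X in measurable X]setTI.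
exact: (measurable_fun_ler mf mg).
Qed.

Let boolM (b : bool) : `|b%:R : R| <= 1.
Proof. by case: b; rewrite ?normr1 ?normr0. Qed.

Let tail_fun_measurable : measurable_fun setT (fun p : TR * TR => at_ p.2 * (p.1 <= p.2)%R%:R).
Proof.
apply: measurable_funM; first exact: measurableT_comp mat measurable_snd.
by apply: mle; [exact: measurable_fst|exact: measurable_snd].
Qed.

Let tail_fun_bound (y x : TR) : `[0, 1]%classic y -> `[0, 1]%classic x ->
  `|at_ (y, x).2 * ((y, x).1 <= (y, x).2)%R%:R| <= M.
Proof. by move=> _ _ /=; rewrite normrM -[leRHS]mulr1 ler_pM. Qed.

Lemma tail_measurable : measurable_fun (`[0, 1] : set TR) tail_integral.
Proof. exact: (measurable_section_Rintegral mI mI Ioo Ioo tail_fun_measurable tail_fun_bound). Qed.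

Lemma tail_bound y : `|tail_integral y| <= M.
Proof.
have mh : measurable_fun setT (fun x : TR => at_ x * (y <= x)%R%:R).
  apply: measurable_funM => //; apply: mle => //; exact: measurable_cst.
have bh x : `|at_ x * (y <= x)%R%:R| <= M by rewrite normrM -[leRHS]mulr1 ler_pM.
have ih : leb.-integrable (`[0, 1] : set TR) (EFin \o (fun x : TR => at_ x * (y <= x)%R%:R)).
  by apply: (@bounded_integrable _ _ _ _ _ _ M) => //; exact: measurable_funTS.
apply: le_trans (le_normr_Rintegral mI ih) _.
apply: (@le_trans _ _ (\int[leb]_(x in `[0, 1]) M)).
  apply: le_Rintegral => //.
  - apply: (@bounded_integrable _ _ _ _ _ _ M) => //.
      by apply: measurable_funTS; exact: measurableT_comp.
    by move=> x _; rewrite normr_id.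
  - apply: (@bounded_integrable _ _ _ _ _ _ M) => //.
    by move=> x _; rewrite ger0_norm.
by rewrite Rintegral_cst // [X in fine X](_ : _ = 1%E) ?mulr1 //; exact: lebesgue_unit_itv.
Qed.

Let tl : TR -> R := tail_integral \_ `[0, 1].

Let mtl : measurable_fun setT tl.
Proof. by apply/(measurable_restrictT _ _).1 => //; exact: tail_measurable. Qed.

Let tlM y : `|tl y| <= M.
Proof. by rewrite /tl patchE; case: ifPn => [_|_]; rewrite ?normr0 ?tail_bound. Qed.

(** For z in [0, 1], the integral over y from 0 to z of the c-th power of [indicator_average a].
    Here z is the minimum reached so far in a block, and c the number of its coordinates still to be
    integrated. *)
Definition tail_power c (z : R) : R := \int[leb]_(y in `[0, 1]) ((y <= z)%R%:R * tl y ^+ c).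

Let kern c z (p : TR * TR) : R := at_ p.1 * ((p.2 <= Num.min z p.1)%R%:R * tl p.2 ^+ c).

Let mkern c z : measurable_fun setT (kern c z).
Proof.
apply: measurable_funM; first exact: measurableT_comp mat measurable_fst.
apply: measurable_funM; last first.
  by apply: measurable_funX; exact: measurableT_comp mtl measurable_snd.
apply: mle; first exact: measurable_snd.
by apply: measurable_minr => //; exact: measurable_fst.
Qed.

Let kernM c z (x y : TR) : `[0, 1]%classic x -> `[0, 1]%classic y ->
  `|kern c z (x, y)| <= M * (1 * M ^+ c).
Proof.
move=> _ _; rewrite /kern normrM ler_pM // normrM ler_pM //= normrX.
by rewrite lerXn2r // nnegrE.
Qed.

Let tail_power_kern c z x : at_ x * tail_power c (Num.min z x) =
  \int[leb]_(y in `[0, 1]) kern c z (x, y).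
Proof.
rewrite /tail_power -RintegralZl //.
apply: (@bounded_integrable _ _ _ _ _ _ (1 * M ^+ c)) => //.
  apply: measurable_funTS; apply: measurable_funM; last exact: measurable_funX.
  by apply: mle => //; exact: measurable_cst.
by move=> y _; rewrite normrM ler_pM // normrX lerXn2r // nnegrE.
Qed.

Lemma tail_power_integrable c z :
  leb.-integrable (`[0, 1] : set TR) (EFin \o (fun x => at_ x * tail_power c (Num.min z x))).
Proof.
have -> : (fun x => at_ x * tail_power c (Num.min z x)) =
    (fun x => \int[leb]_(y in `[0, 1]) kern c z (x, y)).
  by apply/funext => x; exact: tail_power_kern.
exact: (section_Rintegral_integrable mI mI Ioo Ioo (mkern c z) (@kernM c z)).
Qed.

(** By Fubini, since y <= min(z, x) means y <= z and y <= x: integrating over x under the second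
    condition yields one more factor [tl y]. *)
Lemma tail_powerS c z :
  \int[leb]_(x in `[0, 1]) (at_ x * tail_power c (Num.min z x)) = tail_power c.+1 z.
Proof.
have -> : (fun x => at_ x * tail_power c (Num.min z x)) =
    (fun x => \int[leb]_(y in `[0, 1]) kern c z (x, y)).
  by apply/funext => x; exact: tail_power_kern.
rewrite (Rfubini mI mI Ioo Ioo (mkern c z) (@kernM c z)).
apply: eq_Rintegral => y yI.
transitivity (\int[leb]_(x in `[0, 1]) ((y <= z)%R%:R * tl y ^+ c * (at_ x * (y <= x)%R%:R))).
  apply: eq_Rintegral => x _; rewrite /kern /= le_min -mulnb natrM; ring.
rewrite RintegralZl //; last first.
  apply: (@bounded_integrable _ _ _ _ _ _ M) => //.
    apply: measurable_funTS; apply: measurable_funM => //; apply: mle => //.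
  by move=> x _; rewrite normrM -[leRHS]mulr1 ler_pM.
by rewrite exprSr mulrA; congr (_ * _); rewrite /tl patchE yI.
Qed.

Lemma tail_power0 z : 0 <= z <= 1 -> tail_power 0 z = z.
Proof.
move=> /andP[z0 z1]; rewrite /tail_power.
transitivity (\int[leb]_(y in `[0%R, 1%R]) (\1_`[0, z] y)).
  apply: eq_Rintegral => y; rewrite mem_setE in_itv /= => /andP[y0 y1].
  by rewrite expr0 mulr1 indicE mem_setE in_itv /= y0.
rewrite /Rintegral integral_indic // setIidl; last first.
  by apply: subset_itvl; rewrite bnd_simp.
have lz : leb `[0%R, z] = z%:E.
  rewrite lebesgue_measure_itv /= lte_fin; case: ltgtP z0 => // [_ _|<- _] //.
  by rewrite oppr0 adde0.
by rewrite [X in fine X](_ : _ = z%:E).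
Qed.

Lemma bigmin_consE n (z x : R) (P : pred 'I_n.+1) (t : n.-tuple TR) :
  \big[Num.min/z]_(i < n.+1 | P i) tnth [tuple of x :: t] i =
  \big[Num.min/(if P ord0 then Num.min z x else z)]_(i < n | P (lift ord0 i)) tnth t i.
Proof.
have E (i : 'I_n) : tnth [tuple of x :: t] (lift ord0 i) = tnth t i.
  by rewrite !(tnth_nth 0).
have E2 : \big[Num.min/z]_(i < n) (if P (lift ord0 i)
      then tnth [tuple of x :: t] (lift ord0 i) else z) =
    \big[Num.min/z]_(i < n | P (lift ord0 i)) tnth t i.
  by rewrite [RHS]bigmin_mkcond; apply: eq_bigr => i _; rewrite E.
rewrite bigmin_mkcond big_ord_recl E2 (tnth_nth 0) /=; case: ifP => _.
  by rewrite bigmin_minl.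
by rewrite [RHS]bigmin_idl.
Qed.

Definition label_count n (K : finType) (sigma : 'I_n -> K) k : nat :=
  \sum_(i < n) (sigma i == k).

(** The labels will be the blocks of a partition. The defaults [z k] remember the coordinates
    already split off, which lets [cube_integral] proceed one coordinate at a time. *)
Definition cube_integrand n (K : finType) (sigma : 'I_n -> K) (z : K -> R)
    (x : n.-tuple TR) : R :=
  (\prod_(i < n) at_ (tnth x i)) *
  \prod_k \big[Num.min/z k]_(i < n | sigma i == k) tnth x i.

Lemma cube_integrand_measurable n (K : finType) (sigma : 'I_n -> K) z :
  measurable_fun setT (cube_integrand sigma z).
Proof.
apply: measurable_funM.
  apply: measurable_prod => i _; apply: measurableT_comp mat _.
  exact: measurable_tnth.
apply: measurable_prod => k _.
elim: (index_enum 'I_n) => [|i s IH].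
  by under eq_fun => x do rewrite big_nil; exact: measurable_cst.
case ik: (sigma i == k); under eq_fun => x do rewrite big_cons ik; last exact: IH.
by apply: measurable_minr => //; exact: measurable_tnth.
Qed.

Lemma cube_integrand_bound n (K : finType) (sigma : 'I_n -> K) z (x : n.-tuple TR) :
  (forall k, 0 <= z k <= 1) -> cube n x -> `|cube_integrand sigma z x| <= M ^+ n.
Proof.
move=> zI cx; rewrite /cube_integrand normrM -[leRHS]mulr1 ler_pM //.
  rewrite normr_prod -[X in _ ^+ X]card_ord -prodr_const.
  by apply: ler_prod => i _; rewrite normr_ge0 atM.
rewrite normr_prod; apply: (@le_trans _ _ (\prod_(k : K) 1)); last by rewrite big1.
apply: ler_prod => k _; rewrite normr_ge0 /=; have /andP[zk0 zk1] := zI k.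
rewrite ger0_norm; last by apply/bigmin_geP; split=> // i _; have /andP[] := cx i.
exact: le_trans (bigmin_le_id _ _ _ _) zk1.
Qed.

Lemma cube_integral n (K : finType) (sigma : 'I_n -> K) (z : K -> R) :
  (forall k, 0 <= z k <= 1) ->
  \int[lebesgue_tuple R n]_(x in cube n) cube_integrand sigma z x =
  \prod_k tail_power (label_count sigma k) (z k).
Proof.
elim: n sigma z => [|n IH] sigma z zI.
  transitivity (\int[lebesgue_tuple R 0]_(x in cube 0) (\prod_k z k)).
    apply: eq_Rintegral => x _; rewrite /cube_integrand big_ord0 mul1r; apply: eq_bigr => k _.
    by rewrite big_ord0.
  rewrite Rintegral_cst; last exact: measurable_unit_cube.
  rewrite [X in fine X](_ : _ = 1%E) ?mulr1; last exact: lebesgue_tuple_cube.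
  apply: eq_bigr => k _; rewrite /label_count big_ord0 tail_power0 //.
rewrite (Rintegral_cons (cube_integrand_measurable sigma z)
  (fun x => @cube_integrand_bound _ _ sigma z x zI)).
have Coo : (lebesgue_tuple R n (cube n) < +oo)%E by rewrite lebesgue_tuple_cube ltry.
pose k0 := sigma ord0; pose sigma' i := sigma (lift ord0 i).
pose c := label_count sigma' k0.
pose rest := \prod_(k | k != k0) tail_power (label_count sigma k) (z k).
transitivity (\int[leb]_(x in `[0, 1]) (rest * (at_ x * tail_power c (Num.min (z k0) x)))).
  apply: eq_Rintegral => x; rewrite mem_setE in_itv /= => /andP[x0 x1].
  (* The first coordinate is absorbed into the default of its own label. *)
  pose z' k := if k0 == k then Num.min (z k) x else z k.
  have z'I k : 0 <= z' k <= 1.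
    rewrite /z'; have /andP[zk0 zk1] := zI k; case: ifP => _; last by rewrite zk0.
    by rewrite le_min zk0 x0 ge_min zk1.
  transitivity (\int[lebesgue_tuple R n]_(t in cube n) (at_ x * cube_integrand sigma' z' t)).
    apply: eq_Rintegral => t _; rewrite /cube_integrand big_ord_recl mulrA; congr (_ * _ * _).
    - by apply: eq_bigr => i _; rewrite !(tnth_nth 0).
    - by apply: eq_bigr => k _; rewrite bigmin_consE.
  rewrite RintegralZl; last 2 first.
  - exact: measurable_unit_cube.
  - apply: (@bounded_integrable _ _ _ _ _ _ (M ^+ n)).
    + exact: measurable_unit_cube.
    + exact: Coo.
    + by apply: measurable_funTS; exact: cube_integrand_measurable.
    + by move=> t; exact: cube_integrand_bound.
  rewrite IH // mulrCA; congr (_ * _); rewrite (bigD1 k0) //= mulrC /z' eqxx.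
  congr (_ * _); apply: eq_bigr => k /negbTE kk0; rewrite eq_sym kk0.
  by rewrite /label_count big_ord_recl -/k0 eq_sym kk0.
rewrite RintegralZl //; last exact: tail_power_integrable.
rewrite tail_powerS (bigD1 k0) //= mulrC; congr (_ * _).
by rewrite /label_count big_ord_recl -/k0 eqxx.
Qed.

End CubeIntegral.

(** * Coincident points form a null set *)

Section CoincidentTuples.
Variable R : realType.
Local Notation TR := (measurableTypeR R).

Lemma measurable_uniq_cat n (s : seq R) :
  measurable [set t : n.-tuple TR | uniq (s ++ t)].
Proof.
have mnth i : measurable_fun setT (fun t : n.-tuple TR => nth 0 (s ++ t) i : TR).
  under eq_fun => t do rewrite nth_cat.
  case: ltnP => _; first exact: measurable_cst.
  have [ni|ni] := ltnP (i - size s) n.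
    under eq_fun => t do rewrite -(tnth_nth 0 t (Ordinal ni)).
    exact: measurable_tnth.
  under eq_fun => t do rewrite nth_default ?size_tuple //.
  exact: measurable_cst.
pose N := (size s + n)%N.
have -> : [set t : n.-tuple TR | uniq (s ++ t)] = \bigcap_(p in [set: 'I_N * 'I_N])
    [set t : n.-tuple TR | (p.1 != p.2) ==> (nth 0 (s ++ t) p.1 != nth 0 (s ++ t) p.2)].
  apply/seteqP; split => [t /= /(uniqP 0) ut [i j] _ /=|t ct /=].
    apply/implyP; apply: contra_neq => ij; apply/val_inj.
    by apply: ut ij; rewrite inE size_cat size_tuple.
  apply/(uniqP 0) => i j; rewrite !inE size_cat size_tuple => iN jN E.
  have := ct (Ordinal iN, Ordinal jN) I; rewrite /= E eqxx implybF negbK.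
  by move=> /eqP/(congr1 val).
apply: fin_bigcap_measurable => // -[i j] _ /=.
have [_|ij] := eqVneq i j; first by rewrite (_ : [set _ | _] = setT) //; apply/seteqP; split.
rewrite [X in measurable X](_ : _ =
    ~` [set t : n.-tuple TR | nth 0 (s ++ t) i == nth 0 (s ++ t) j]).
  apply: measurableC; rewrite -[X in measurable X]setTI.
  exact: (measurable_fun_eqr (mnth i) (mnth j)).
by apply/seteqP; split => t /= /negP.
Qed.

(** The prefix [s] collects the coordinates already fixed: for [y] outside [s] the section is a set
    of the same kind with prefix [rcons s y], and the finitely many [y] in [s] form a null set. *)
Lemma coincident_null n (s : seq R) : uniq s ->
  lebesgue_tuple R n [set t : n.-tuple TR | ~~ uniq (s ++ t)] = 0%E.
Proof.
have mN m (s' : seq R) : measurable [set t : m.-tuple TR | ~~ uniq (s' ++ t)].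
  rewrite [X in measurable X](_ : _ = ~` [set t : m.-tuple TR | uniq (s' ++ t)]).
    by apply: measurableC; exact: measurable_uniq_cat.
  by apply/seteqP; split => t /= /negP.
elim: n s => [|n IH] s us.
  rewrite (_ : [set t | _] = set0) ?measure0 // -subset0 => t /=.
  by rewrite (tuple0 t) cats0 us.
rewrite /= /lebesgue_cons /pushforward.
set A := _ @^-1` _.
have mA : measurable A.
  by rewrite -[A]setTI; exact: (@measurable_cons_pair R n measurableT _ (mN n.+1 s)).
have xA y : xsection A y = [set t : n.-tuple TR | ~~ uniq (rcons s y ++ t)].
  by apply/seteqP; split => t; rewrite /xsection /= inE /A /= cat_rcons.
rewrite [LHS](_ : _ = \int[@lebesgue_measure R]_y (lebesgue_tuple R n (xsection A y)))%E //.
have -> : (\int[@lebesgue_measure R]_y (lebesgue_tuple R n (xsection A y)) =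
   \int[@lebesgue_measure R]_y (cst 0 y))%E.
  apply: ae_eq_integral => //.
    exact: measurable_fun_xsection.
  exists [set` s]; split.
  - apply: countable_measurable; first by move=> y; exact: measurable_set1.
    exact/finite_set_countable/finite_seq.
  - by apply: countable_lebesgue_measure0; exact/finite_set_countable/finite_seq.
  - move=> y /= /not_implyP[_]; rewrite xA => ne; apply/negPn/negP => ys; apply: ne.
    by apply: IH; rewrite rcons_uniq us andbT; exact: ys.
by rewrite integral0.
Qed.

End CoincidentTuples.

Lemma Rintegral_lincomb d (T : measurableType d) (R : realType) (mu : measure T R)
    (D : set T) (J : Type) (s : seq J) (Q : pred J) (c : J -> R) (f : J -> T -> R) :
  measurable D -> (forall j, Q j -> mu.-integrable D (EFin \o f j)) ->
  mu.-integrable D (EFin \o (fun x => \sum_(j <- s | Q j) c j * f j x)) /\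
  \int[mu]_(x in D) (\sum_(j <- s | Q j) c j * f j x) =
  \sum_(j <- s | Q j) c j * \int[mu]_(x in D) f j x.
Proof.
move=> mD fi; elim: s => [|j s [IHi IH]].
  have E : (fun x => \sum_(j <- [::] | Q j) c j * f j x) = fun=> 0 :> R.
    by apply/funext => x; rewrite big_nil.
  by rewrite big_nil E Rintegral_cst // mul0r; split=> //; exact: integrable0.
case Qj: (Q j); last first.
  have E : (fun x => \sum_(j <- j :: s | Q j) c j * f j x) =
      (fun x => \sum_(j <- s | Q j) c j * f j x).
    by apply/funext => x; rewrite big_cons Qj.
  by rewrite E big_cons Qj; split.
have E : (fun x => \sum_(j <- j :: s | Q j) c j * f j x) =
    (fun x => c j * f j x + \sum_(j <- s | Q j) c j * f j x).
  by apply/funext => x; rewrite big_cons Qj.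
have i1 : mu.-integrable D (EFin \o (fun x => c j * f j x)).
  rewrite (_ : _ \o _ = (fun x => (c j)%:E * (EFin \o f j) x)%E) //.
  exact/integrableZl/fi.
rewrite E big_cons Qj RintegralD // RintegralZl ?IH //; last exact: fi.
split=> //; rewrite (_ : _ \o _ = ((EFin \o (fun x => (c j * f j x)%R)) \+
  (EFin \o (fun x => (\sum_(j <- s | Q j) c j * f j x)%R)))%E) //.
exact: integrableD.
Qed.

Section BlockIntegral.
Variables (R : realType) (a : R -> R) (M : R) (n : nat).
Local Notation TR := (measurableTypeR R).
Local Notation leb := (@lebesgue_measure R).
Local Notation cube := (@unit_cube R n).
Hypotheses (ma : measurable_fun `[0 : R, 1] a) (M0 : 0 <= M)
  (aM : forall x : R, 0 <= x <= 1 -> `|a x| <= M).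

Definition average_moment k : R := \int[leb]_(x in `[0, 1]) (indicator_average a x ^+ k).

Lemma tail_power_moment c : tail_power a c 1 = average_moment c.
Proof.
apply: eq_Rintegral => y yI; have := yI; rewrite mem_setE in_itv /= => /andP[y0 y1].
by rewrite y1 mul1r patchE yI tail_integralE.
Qed.

(** Each coordinate is labelled by its block, but labels range over all subsets: one that is not a
    block labels no coordinate and gives the factor 1. *)
Definition block_integrand (P : {set {set 'I_n}}) : n.-tuple TR -> R :=
  cube_integrand a (finset.pblock P) (fun=> 1).

Lemma block_integrandE P (x : n.-tuple TR) : cube x -> finset.partition P finset.setT ->
  block_integrand P x = (\prod_(i < n) a (tnth x i)) *
    \prod_(B in P) \big[Num.min/1]_(i in B) tnth x i.
Proof.
move=> cx pP; rewrite /block_integrand /cube_integrand; congr (_ * _).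
  apply: eq_bigr => i _; rewrite patchE ifT // mem_setE in_itv /=; exact: cx.
rewrite [RHS]big_mkcond; apply: eq_bigr => B _; case: ifP => BP.
  apply: eq_bigl => i; apply/eqP/idP => [<-|iB].
    by rewrite finset.mem_pblock (finset.cover_partition pP) finset.inE.
  exact: (finset.def_pblock (finset.partition_trivIset pP) BP iB).
rewrite big_pred0 // => i; apply: contraFF BP => /eqP <-.
by rewrite finset.pblock_mem // (finset.cover_partition pP) finset.inE.
Qed.

Let zI (k : {set 'I_n}) : 0 <= (fun=> 1 : R) k <= 1. Proof. by rewrite ler01 lexx. Qed.

Lemma block_integrand_integrable P :
  (lebesgue_tuple R n).-integrable cube (EFin \o block_integrand P).
Proof.
have Coo : (lebesgue_tuple R n cube < +oo)%E by rewrite lebesgue_tuple_cube ltry.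
apply: (@bounded_integrable _ _ _ _ _ _ (M ^+ n)).
- exact: measurable_unit_cube.
- exact: Coo.
- by apply: measurable_funTS; exact: cube_integrand_measurable.
- by move=> x cx; apply: cube_integrand_bound.
Qed.

Lemma block_integral P : finset.partition P finset.setT ->
  \int[lebesgue_tuple R n]_(x in cube) block_integrand P x =
  \prod_(B in P) average_moment #|B|.
Proof.
move=> pP; rewrite /block_integrand (cube_integral ma M0 aM) //.
rewrite [RHS]big_mkcond; apply: eq_bigr => B _; rewrite tail_power_moment; case: ifP => BP.
  congr average_moment; rewrite /label_count -sum1_card [RHS]big_mkcond /=.
  apply: eq_bigr => i _; suff -> : (finset.pblock P i == B) = (i \in B) by case: (i \in B).
  apply/eqP/idP => [<-|iB].
    by rewrite finset.mem_pblock (finset.cover_partition pP) finset.inE.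
  exact: (finset.def_pblock (finset.partition_trivIset pP) BP iB).
rewrite /label_count big1 => [|i _]; last first.
  apply/eqP; rewrite eqb0; apply: contraFN BP => /eqP <-.
  by rewrite finset.pblock_mem // (finset.cover_partition pP) finset.inE.
rewrite /average_moment; under eq_Rintegral => x _ do rewrite expr0.
rewrite Rintegral_cst // mul1r [X in fine X](_ : _ = 1%E) //.
exact: lebesgue_unit_itv.
Qed.

(** [F] is built from the extension of [a] by zero, which makes it measurable on the whole space and
    not only on the cube. *)
Lemma block_expansion_integral (f : n.-tuple TR -> R) v :
  block_expansion (fun B x => \big[Num.min/1]_(i in B) tnth x i)
    (fun B : {set 'I_n} => average_moment #|B|) finset.setT f v ->
  exists F : n.-tuple TR -> R, [/\ measurable_fun setT F,
    (lebesgue_tuple R n).-integrable cube (EFin \o F),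
    forall x, cube x -> F x = f x * \prod_(k < n) a (tnth x k) &
    \int[lebesgue_tuple R n]_(x in cube) F x = v].
Proof.
move=> [c [fE vE]].
pose c' P := if finset.partition P finset.setT then c P else 0.
have [iF IF] := @Rintegral_lincomb _ _ R (lebesgue_tuple R n) cube _ (index_enum _)
  xpredT c' block_integrand (@measurable_unit_cube R n)
  (fun P _ => block_integrand_integrable P).
exists (fun x => \sum_(P : {set {set 'I_n}}) c' P * block_integrand P x); split.
- apply: measurable_sum => P; apply: measurable_funM; first exact: measurable_cst.
  exact: cube_integrand_measurable.
- exact: iF.
- move=> x cx; rewrite fE mulr_suml [RHS]big_mkcond; apply: eq_bigr => P _.
  by rewrite /c'; case: ifP => pP; rewrite ?mul0r // block_integrandE //; ring.
rewrite IF vE [RHS]big_mkcond; apply: eq_bigr => P _; rewrite /c'.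
by case: ifP => pP; rewrite ?mul0r // block_integral.
Qed.

End BlockIntegral.

(** * Values of the functionals *)

Section PsiValue.
Variables (R : realType) (bl br : boundary_rates R) (n : nat).
Hypotheses (hbl : admissible_rates bl) (hbr : admissible_rates br)
  (na0 : boundary_density bl = 0) (nb1 : boundary_density br = 1).
Variable P : forall N : nat, config N -> R.
Hypothesis hP : forall N : nat, (0 < N)%N -> ssep_invariant bl br (@P N).
Hypothesis n0 : (0 < n)%N.
Local Notation cube := (@unit_cube R n).

Lemma boundary_values : [/\ injection bl = 0, extraction br = 0,
  0 < (extraction bl)^-1 & 0 < (injection br)^-1].
Proof.
have [i0 e0 s0] := hbl; have [i0' e0' s0'] := hbr.
have ibl : injection bl = 0.
  have := congr1 (fun r => r * (injection bl + extraction bl)) na0.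
  by rewrite /boundary_density divfK ?mul0r // gt_eqF.
have ebr : extraction br = 0.
  have := congr1 (fun r => r * (injection br + extraction br)) nb1.
  rewrite /boundary_density divfK ?gt_eqF // mul1r => /eqP.
  by rewrite -subr_eq0 opprD addNKr oppr_eq0 => /eqP.
rewrite !invr_gt0; split=> //.
  by rewrite ibl add0r in s0.
by rewrite ebr addr0 in s0'.
Qed.

Lemma psi_ssep_zero (x : n.-tuple R) i : tnth x i = 0 -> psi_ssep P x = 0.
Proof.
move=> xi0; rewrite /psi_ssep; case: ifP => // _.
have occ0 N t : @occupation R N (Num.truncn (tnth x i * N%:R)) t = 0.
  by rewrite xi0 mul0r truncn0 /occupation big_pred0.
have -> : (fun N : nat => N%:R ^+ n.-1 *
      joint_cumulant (expectation_of (@P N))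
        (fun i : 'I_n => @occupation R N (Num.truncn (tnth x i * N%:R)))) = fun=> 0.
  apply/funext => N; rewrite /joint_cumulant big1 ?mulr0 // => Q pQ.
  have ic : i \in finset.cover Q by rewrite (finset.cover_partition pQ) finset.inE.
  rewrite (bigD1 (finset.pblock Q i)) ?finset.pblock_mem //= /expectation_of big1 ?mul0r ?mulr0 //.
  move=> t _; rewrite (bigD1 i) /= ?finset.mem_pblock //.
  by rewrite occ0 mul0r mulr0.
exact: lim_cst.
Qed.

Variables (H : n.-tuple R -> setfun R 'I_n) (U : n.-tuple R -> nat -> setfun R 'I_n).
Hypotheses (H0 : forall x, H x finset.set0 = 0) (U0 : forall x, U x 0%N = 1).
Hypothesis US : forall x c, U x c.+1 = U x c + H x * U x c.+1.
Hypothesis HE : forall x (A : {set 'I_n}), H x A =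
  \sum_(B : {set 'I_n} | B \subset A) block_weight (tnth x) B * U x #|B| (A :\: B).
Variables (m : {set 'I_n} -> R) (v : R).
Hypothesis HT : block_expansion (fun B x => \big[Num.min/1]_(i in B) tnth x i) m
  finset.setT (fun x => H x finset.setT) v.

Lemma psi_ssep_cube (x : n.-tuple R) : cube x ->
  psi_ssep P x = if uniq x then H x finset.setT / n%:R else 0.
Proof.
(* A zero coordinate is outside the scope of [psi_limit], as the position 0 is no site. There psi is
   0, and so is [H]: in every partition the block containing [i] has minimum 0. *)
move=> cx; have [x0|/existsPn x_neq0] := boolP [exists i, tnth x i == 0].
  have [i /eqP xi0] := existsP x0.
  rewrite (psi_ssep_zero xi0); case: ifP => // _; have [c [-> _]] := HT.
  rewrite big1 ?mul0r // => Q pQ.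
  have ic : i \in finset.cover Q by rewrite (finset.cover_partition pQ) finset.inE.
  rewrite (bigD1 (finset.pblock Q i)) ?finset.pblock_mem //= (_ : \big[_/_]_(_ in _) _ = 0).
    by rewrite mul0r mulr0.
  apply/le_anti/andP; split.
    by apply: bigmin_inf (_ : i \in finset.pblock Q i) _; rewrite ?finset.mem_pblock ?xi0.
  by apply/bigmin_geP; split=> // j _; have /andP[] := cx j.
rewrite /psi_ssep; case: ifP => // ux.
have [ibl ebr a0 b0] := boundary_values.
have xinj : injective (tnth x) by apply/tuple_uniqP.
have xgt0 i : 0 < tnth x i by have /andP[x0 _] := cx i; rewrite lt_neqAle eq_sym x_neq0.
have xle1 i : tnth x i <= 1 by have /andP[] := cx i.
have ebl : extraction bl = (extraction bl)^-1^-1 by rewrite invrK.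
have ibr : injection br = (injection br)^-1^-1 by rewrite invrK.
apply/cvg_lim => //.
exact: (psi_limit a0 b0 ibl ebr ebl ibr hP xinj xgt0 xle1 (H0 x) (U0 x) (US x) (HE x) n0).
Qed.

End PsiValue.

Lemma psi_functionalE (R : realType) (bl br : boundary_rates R)
    (P : forall N : nat, config N -> R) (a : R -> R) n :
  admissible_rates bl -> admissible_rates br ->
  boundary_density bl = 0 -> boundary_density br = 1 ->
  (forall N : nat, (0 < N)%N -> ssep_invariant bl br (@P N)) ->
  measurable_fun `[0 : R, 1] a ->
  (exists M : R, forall x : R, 0 <= x <= 1 -> `|a x| <= M) -> (0 < n)%N ->
  psi_functional P n a =
    (-1) ^+ n.-1 * (n.-1)`!%:R * free_cumulant (indicator_average a) n.
Proof.
move=> hbl hbr na0 nb1 hP ma [M aM] n0.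
have h01 : 0 <= (0 : R) <= 1 by rewrite lexx ler01.
have M0 : 0 <= M := le_trans (normr_ge0 _) (aM 0 h01).
pose TR := measurableTypeR R.
have exHU (x : n.-tuple R) : exists HU : setfun R 'I_n * (nat -> setfun R 'I_n),
  [/\ HU.1 finset.set0 = 0, HU.2 0%N = 1, forall c, HU.2 c.+1 = HU.2 c + HU.1 * HU.2 c.+1 &
    forall A, HU.1 A = \sum_(B : {set 'I_n} | B \subset A)
       block_weight (tnth x) B * HU.2 #|B| (A :\: B)].
  have [H [U hHU]] := limit_system (block_weight0 (tnth x)).
  by exists (H, U).
have [HU hHU] := choice exHU; pose H x := (HU x).1; pose U x := (HU x).2.
(* A second copy of the system, with moments of the average in place of the block minima;
   [block_expansion_system] ties it to the pointwise one. *)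
have [Hm [Um [_ Um0 UmS HmE]]] := limit_system
  (euler0 (min_cumulant (fun C : {set 'I_n} => average_moment a #|C|))).
pose w (B : {set 'I_n}) : R := #|B|%:R * ((-1) ^+ #|B|.-1 * (#|B|.-1)`!%:R).
have w0 : w finset.set0 = 0 by rewrite /w cards0 mul0r.
have TE (x : n.-tuple R) (B : {set 'I_n}) : block_weight (tnth x) B =
    w B * \big[Num.min/1]_(i in B) tnth x i.
  rewrite /block_weight /w !ffunE. exact: mulrA.
have TmE B : euler (min_cumulant (fun C : {set 'I_n} => average_moment a #|C|)) B =
    w B * average_moment a #|B|.
  by rewrite /w !ffunE; exact: mulrA.
have H0 x : H x finset.set0 = 0 by have [] := hHU x.
have U0 x : U x 0%N = 1 by have [] := hHU x.
have US x c : U x c.+1 = U x c + H x * U x c.+1 by have [_ _ h _] := hHU x; exact: h.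
have HE x A : H x A = \sum_(B : {set 'I_n} | B \subset A)
    block_weight (tnth x) B * U x #|B| (A :\: B) by have [_ _ _ h] := hHU x; exact: h.
have [HT _] := block_expansion_system w0 TE TmE U0 Um0 US UmS HE HmE
  (ltnSn #|finset.setT : {set 'I_n}|).
have HmT := moment_system n0 Um0 UmS HmE.
have [F [mF iF FE IF]] := block_expansion_integral ma M0 aM HT.
(* The indicator [uniq x] carries the convention at coinciding points; it differs from 1 only on a
   null set. *)
have psiE (x : n.-tuple TR) : unit_cube x -> psi_ssep P x * \prod_(k < n) a (tnth x k) =
    (uniq x)%:R * (F x / n%:R).
  move=> cx; rewrite (psi_ssep_cube hbl hbr na0 nb1 hP n0 H0 U0 US HE HT cx).
  by case: ifP => _; rewrite ?mul0r // mul1r FE // mulrAC.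
have mC := @measurable_unit_cube R n.
have mFn : measurable_fun setT (fun x => F x / n%:R).
  by apply: measurable_funM => //; exact: measurable_cst.
have -> : psi_functional P n a = \int[lebesgue_tuple R n]_(x in @unit_cube R n) (F x / n%:R).
  rewrite /psi_functional /Rintegral; congr fine.
  transitivity (\int[lebesgue_tuple R n]_(x in @unit_cube R n) ((uniq x)%:R * (F x / n%:R))%:E)%E.
    by apply: eq_integral => x; rewrite inE => cx; rewrite psiE.
  apply: ae_eq_integral => //.
  - apply/measurable_EFinP; apply: measurable_funTS; apply: measurable_funM => //.
    have -> : (fun x : n.-tuple TR => (uniq x)%:R : R) = \1_[set t | uniq ([::] ++ t)].
      by apply/funext => x; rewrite indicE mem_setE.
    by apply: measurable_indic; exact: measurable_uniq_cat.
  - by apply/measurable_EFinP; exact: measurable_funTS.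
  exists [set t : n.-tuple TR | ~~ uniq ([::] ++ t)]; split.
  - rewrite (_ : [set t | _] = ~` [set t : n.-tuple TR | uniq ([::] ++ t)]).
      by apply: measurableC; exact: measurable_uniq_cat.
    by apply/seteqP; split => t /= /negP.
  - exact: coincident_null.
  - move=> x /= /not_implyP[cx ne]; apply/negP => ux; apply: ne.
    by rewrite ux mul1r.
transitivity (n%:R^-1 * Hm finset.setT).
  rewrite -IF -RintegralZl //; apply: eq_Rintegral => x _; exact: mulrC.
have nf : n`!%:R = n%:R * (n.-1)`!%:R :> R by rewrite -natrM -[in LHS](prednK n0) factS prednK.
(* As the limit is [H] divided by n, the n! of [moment_system] becomes (n-1)!. *)
rewrite HmT nf /free_cumulant; field.
by rewrite pnatr_eq0 -lt0n.
Qed.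

Lemma indicator_average_scale (R : realType) (a : R -> R) (v x : R) :
  measurable_fun `[0 : R, 1] a ->
  (exists M : R, forall x : R, 0 <= x <= 1 -> `|a x| <= M) ->
  indicator_average (fun y => v * a y) x = v * indicator_average a x.
Proof.
move=> ma [M aM]; rewrite /indicator_average -RintegralZl //.
  by apply: eq_Rintegral => y _; rewrite mulrA.
apply: (@bounded_integrable _ _ _ _ _ _ M) => //.
- exact: lebesgue_unit_itv_lty.
- apply: measurable_funM => //; apply: measurable_funTS.
  (* As a function of y, the indicator of 0 <= x <= y is that of a half-line, or zero when x is
     negative. *)
  have [x0|x0] := leP 0 x; last first.
    rewrite (_ : (fun y => _) = cst 0); first exact: measurable_cst.
    by apply/funext => y; rewrite indicE mem_setE in_itv /= leNgt x0.
  rewrite (_ : (fun y => _) = \1_`[x, +oo[); first exact: measurable_indic.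
  by apply/funext => y; rewrite !indicE !mem_setE !in_itv /= x0 andbT.
move=> y; rewrite /= in_itv /= => /aM ay; rewrite normrM indicE.
by case: (_ \in _); rewrite ?normr1 ?normr0 ?mulr1 ?mulr0 // (le_trans _ ay).
Qed.

Lemma free_cumulant_average_scale (R : realType) (a : R -> R) (v : R) n :
  measurable_fun `[0 : R, 1] a ->
  (exists M : R, forall x : R, 0 <= x <= 1 -> `|a x| <= M) -> (0 < n)%N ->
  free_cumulant (indicator_average (fun y => v * a y)) n =
  v ^+ n * free_cumulant (indicator_average a) n.
Proof.
move=> ma ba n0; rewrite /free_cumulant -free_cumulant_scale //.
congr (free_cumulant_of_moments _ n); apply/funext => k.
have [M aM] := ba.
have h01 : 0 <= (0 : R) <= 1 by rewrite lexx ler01.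
have M0 : 0 <= M := le_trans (normr_ge0 _) (aM 0 h01).
rewrite -RintegralZl //.
  by apply: eq_Rintegral => x _; rewrite indicator_average_scale // exprMn.
apply: (@bounded_integrable _ _ _ _ _ _ (M ^+ k)) => //.
- exact: lebesgue_unit_itv_lty.
- apply: measurable_funX.
  apply: (eq_measurable_fun (tail_integral a)) => [x|].
    by rewrite mem_setE in_itv /= => /andP[x0 _]; rewrite tail_integralE.
  exact: (tail_measurable ma M0 aM).
move=> x; rewrite /= in_itv /= => /andP[x0 _].
by rewrite -tail_integralE // normrX lerXn2r ?nnegrE // (tail_bound ma M0 aM).
Qed.

Theorem lemma8 (R : realType) (bl br : boundary_rates R)
    (hbl : admissible_rates bl) (hbr : admissible_rates br)
    (na0 : boundary_density bl = 0) (nb1 : boundary_density br = 1)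
    (P : forall N : nat, config N -> R)
    (hP : forall N : nat, (0 < N)%N -> ssep_invariant bl br (P N))
    (a : R -> R) (ma : measurable_fun `[0 : R, 1] a)
    (ba : exists M : R, forall x : R, 0 <= x <= 1 -> `|a x| <= M) :
  (exists c : nat -> R,
     is_power_series (F0_term P) a c /\
     is_power_series (@free_series_term R) a c) /\
  (forall n : nat, (0 < n)%N ->
     psi_functional P n a =
       (-1) ^+ n.-1 * (n.-1)`!%:R * free_cumulant (indicator_average a) n).
Proof.
have psiE (b : R -> R) : measurable_fun `[0 : R, 1] b ->
    (exists M : R, forall x : R, 0 <= x <= 1 -> `|b x| <= M) ->
    forall n : nat, (0 < n)%N -> psi_functional P n b =
      (-1) ^+ n.-1 * (n.-1)`!%:R * free_cumulant (indicator_average b) n.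
  by move=> mb bb n n0; exact: (psi_functionalE hbl hbr na0 nb1 hP).
split; last exact: psiE.
(* The coefficients are the terms at v = 1, since the n-th free cumulant is homogeneous of degree n
   in the test function. *)
exists (@free_series_term R a).
have scaled (v : R) n : (0 < n)%N ->
    free_series_term (fun x => v * a x) n = free_series_term a n * v ^+ n.
  by move=> n0; rewrite /free_series_term free_cumulant_average_scale //; ring.
split=> v n n0; last exact: scaled.
rewrite -scaled // /F0_term /free_series_term psiE //; first last.
- have [M aM] := ba; exists (`|v| * M) => x /aM ax; rewrite normrM ler_wpM2l //.
- by apply: measurable_funM => //; exact: measurable_cst.
(* The constants agree: (-1)^(n-1) (n-1)! / n! = - (-1)^n / n. *)
case: n n0 => // n _; rewrite /= factS natrM exprS; field.
rewrite addrC natr1 !pnatr_eq0 /= -lt0n; exact: fact_gt0.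
Qed.
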